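(* Consider a single-source, single-destination network (all commodities have the same source $s$ and destination $d$, possibly different values-of-time $\gamma_i$) whose travel times satisfy: (i) for every $e\in E$ and $g_e,\tilde g_e\in L_+(H)$ with $\int_0^t\tilde g_e\,\mathrm d\sigma\le\int_0^tg_e\,\mathrm d\sigma$ for all $t\in H$, we have $\int_{T_e(\tilde g_e,\cdot)^{-1}([0,t])}\tilde g_e\,\mathrm d\sigma\le\int_{T_e(g_e,\cdot)^{-1}([0,t])}g_e\,\mathrm d\sigma$ for all $t\in H$; (ii) for every $e\in E$ and $g_e,\tilde g_e\in L_+(H)$ with $\tilde g_e\le g_e$, $D_e(\tilde g_e,\cdot)\le D_e(g_e,\cdot)$. Then every system optimal flow is implementable.
   Context: Setting. $G=(V,E)$ finite directed graph; $\delta^\pm(v)$ edges leaving/entering $v$. Time horizons $H'=[0,t_f']\subsetneq H=[0,t_f]$, Lebesgue measure $\sigma$. Finite commodity set $I$; commodity $i$ has source $s_i$, destination $d_i$, value-of-time $\gamma_i>0$, inflow rate $r_i\in L_+(H)\setminus\{0\}$; $\mathcal W_i$ is the set of $s_i$–$d_i$ walks (finite edge tuples, repetitions allowed) tagged by $i$, $\mathcal W=\bigcup_i\mathcal W_i$. Each $g\in L_+(H)^E$ induces traversal times $D_e(g,\cdot)=D_e(g_e,\cdot):H\to\mathbb R_+$, $T_e(g,t)=t+D_e(g,t)$, $A_{w,1}=\mathrm{id}$, $A_{w,j}(g,\cdot)=T_{w[j-1]}(g,\cdot)\circ A_{w,j-1}(g,\cdot)$ for $j\le|w|+1$. $\Lambda$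 is the set of $h\in L_+(H)^{\mathcal W}$ with $\sum_w\|h_w\|_1<\infty$ and $\sum_{w\in\mathcal W_i}h_w=r_i$ such that $\int_0^tg_e\,\mathrm d\sigma=\sum_w\sum_{j:w[j]=e}\int_{A_{w,j}(g,\cdot)^{-1}([0,t])}h_w\,\mathrm d\sigma$ has a solution $g$ supported on $H'$; $\ell:\Lambda\to L_+(H)^E$ is a fixed map choosing such a solution. For $u\in L_+(H)^E$, $\Lambda^u,\ell^u$ are defined the same way with fixed travel times $D^u(g,t):=D(u,t)$. Standing assumptions: (1) there is $\tau^{\min}>0$ with, for all $g\in L_+(H)^E$, $e\in E$: $D_e(g,\cdot)$ absolutely continuous, $T_e(g,\cdot)$ nondecreasing, $D_e(g,t)\ge\tau^{\min}$ on $H'$, and there is $g_e^-\in L_+(H)$ with $\int_{T_e(g,\cdot)^{-1}([0,t])}g_e\,\mathrm d\sigma=\int_0^tg_e^-\,\mathrm d\sigma$ for all $t$; (2) there is $\tau^{\max}$ with $D_e(g,t)\le\tau^{\max}$ on $H'$ for $g\in\ell(\Lambda)$; (3) $A_{w,j}(g,\cdot)(H)\subseteq H$ for $g\in\ell(\Lambda)$; (4) for $u$ supported on $H'$ and $h\in\Lambda^u$, $\ell^u(h)=u$ implies $\ell(h)=u$. Costs: $\Psi_{(\hat w,i)}(g,t)=\gamma_i(A_{w,|w|+1}(g,t)-t)$; for tolls $p:H\to\mathbb R_+^E$, $P^p_w(g,t)=\sum_{j\le|w|}p_{w[j]}(A_{w,j}(g,t))$. $h\in\Lambda$ is a $p$-DUE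 if for all $i$, $w\in\mathcal W_i$, a.e. $t$: $h_w(t)>0\Rightarrow\Psi_w(g,t)+P^p_w(g,t)\le\Psi_{w'}(g,t)+P^p_{w'}(g,t)$ for all $w'\in\mathcal W_i$, with $g=\ell(h)$. $g$ is implementable if there are tolls $p\ge0$ and a $p$-DUE $h$ with $\ell(h)=g$ and $\sum_e\int_Hp_eg_e\,\mathrm d\sigma<\infty$. A system optimal flow minimizes $\sum_e\int_HD_e(g,\cdot)g_e\,\mathrm d\sigma$ over $g\in\ell(\Lambda)$. *)

(* Defs.v *)
From HB Require Import structures.
From mathcomp Require Import all_boot all_order all_algebra.
From mathcomp Require Import all_classical all_reals all_analysis.
Set Implicit Arguments. Unset Strict Implicit. Unset Printing Implicit Defensive.
Import Order.TTheory GRing.Theory Num.Theory.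
Import numFieldNormedType.Exports.
Local Open Scope classical_set_scope.
Local Open Scope ring_scope.

Section DNL.
Variable R : realType.
Local Notation mu := (@lebesgue_measure R).

Definition Hset (tf : R) : set R := [set t | 0 <= t <= tf].

Definition aeeq (tf : R) (f g : R -> R) : Prop :=
  {ae mu, forall t, Hset tf t -> f t = g t}.
Definition aele (tf : R) (f g : R -> R) : Prop :=
  {ae mu, forall t, Hset tf t -> f t <= g t}.

(* f is a (nonnegative representative of an) element of L_+(H) *)
Definition Lplus (tf : R) (f : R -> R) : Prop :=
  measurable_fun (Hset tf) f /\ (forall t, Hset tf t -> 0 <= f t) /\
  mu.-integrable (Hset tf) (EFin \o f).

Definition supported_on (tf' tf : R) (f : R -> R) : Prop :=
  {ae mu, forall t, tf' < t <= tf -> f t = 0}.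

Definition abs_cont (a b : R) (f : R -> R) : Prop :=
  forall eps : R, 0 < eps -> exists2 del : R, 0 < del &
    forall (n : nat) (x y : 'I_n -> R),
      (forall k, a <= x k /\ x k <= y k /\ y k <= b) ->
      (forall k l, k != l -> y k <= x l \/ y l <= x k) ->
      \sum_(k < n) (y k - x k) < del ->
      \sum_(k < n) `|f (y k) - f (x k)| < eps.

Definition nondecr_on (S : set R) (f : R -> R) : Prop :=
  forall x y, S x -> S y -> x <= y -> f x <= f y.

Definition int0 (t : R) (f : R -> R) : \bar R :=
  (\int[mu]_(x in [set x : R | (0 <= x <= t)%R]) (f x)%:E)%E.
Definition int_pre (tf : R) (F : R -> R) (t : R) (f : R -> R) : \bar R :=
  (\int[mu]_(x in [set x : R | Hset tf x /\ (0 <= F x <= t)%R]) (f x)%:E)%E.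

Section Network.
Variables (V E : finType) (etail ehead : E -> V).
Variables (I : finType) (src dst : I -> V).

Fixpoint is_walk_from (v d : V) (w : seq E) : bool :=
  match w with
  | [::] => v == d
  | e :: w' => (etail e == v) && is_walk_from (ehead e) d w'
  end.

(* walks tagged by a commodity: W = union of the W_i *)
Definition isW (w : seq E * I) : bool := is_walk_from (src w.2) (dst w.2) w.1.
Definition Wset : set (seq E * I) := [set w | isW w].
Definition Wi (i : I) : set (seq E * I) := [set w | isW w /\ w.2 = i].

Definition Tt (DD : (E -> R -> R) -> E -> R -> R) (g : E -> R -> R) (e : E) (t : R) : R :=
  t + DD g e t.

(* Aw DD g w j = A_{w, j+1}(g, .) of the paper (0-indexed):
   Aw 0 = id, Aw (j+1) = T_{w[j]} o Aw j *)
Fixpoint Aw (DD : (E -> R -> R) -> E -> R -> R) (g : E -> R -> R)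
    (w : seq E) (j : nat) (t : R) : R :=
  match w, j with
  | e :: w', j'.+1 => Aw DD g w' j' (Tt DD g e t)
  | _, _ => t
  end.

Definition flow_eq (tf : R) (DD : (E -> R -> R) -> E -> R -> R)
    (h : seq E * I -> R -> R) (g : E -> R -> R) : Prop :=
  forall e t, Hset tf t ->
    int0 t (g e) =
    (\esum_(w in Wset)
       \sum_(j < size w.1 | nth e w.1 j == e) int_pre tf (Aw DD g w.1 j) t (h w))%E.

Definition Lam (tf' tf : R) (r : I -> R -> R) (DD : (E -> R -> R) -> E -> R -> R)
    (h : seq E * I -> R -> R) : Prop :=
  (forall w, isW w -> Lplus tf (h w)) /\
  (forall w, ~~ isW w -> h w = (fun=> 0)) /\
  (\esum_(w in Wset) \int[mu]_(x in Hset tf) (h w x)%:E < +oo)%E /\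
  (forall i, {ae mu, forall t, Hset tf t ->
      (\esum_(w in Wi i) (h w t)%:E = (r i t)%:E)%E}) /\
  exists g : E -> R -> R, (forall e, Lplus tf (g e)) /\
    (forall e, supported_on tf' tf (g e)) /\ flow_eq tf DD h g.

(* l is a map choosing, for each h in Lambda, such a solution;
   it is a map on L-classes (respects a.e.-equality) *)
Definition l_spec (tf' tf : R) (r : I -> R -> R) (DD : (E -> R -> R) -> E -> R -> R)
    (l : (seq E * I -> R -> R) -> E -> R -> R) : Prop :=
  (forall h, Lam tf' tf r DD h ->
    (forall e, Lplus tf (l h e)) /\ (forall e, supported_on tf' tf (l h e)) /\
    flow_eq tf DD h (l h)) /\
  (forall h h', Lam tf' tf r DD h -> Lam tf' tf r DD h' ->
    (forall w, isW w -> aeeq tf (h w) (h' w)) ->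
    forall e, aeeq tf (l h e) (l h' e)).

Definition Dstd (D : E -> (R -> R) -> R -> R) : (E -> R -> R) -> E -> R -> R :=
  fun g e => D e (g e).
Definition Du (D : E -> (R -> R) -> R -> R) (u : E -> R -> R) :
    (E -> R -> R) -> E -> R -> R :=
  fun _ e => D e (u e).

Definition Psi (gamma : I -> R) (D : E -> (R -> R) -> R -> R) (g : E -> R -> R)
    (w : seq E * I) (t : R) : R :=
  gamma w.2 * (Aw (Dstd D) g w.1 (size w.1) t - t).

Fixpoint tollw (p : E -> R -> R) (D : E -> (R -> R) -> R -> R) (g : E -> R -> R)
    (w : seq E) (t : R) : R :=
  match w with
  | [::] => 0
  | e :: w' => p e t + tollw p D g w' (Tt (Dstd D) g e t)
  end.

Definition is_DUE (tf' tf : R) (r : I -> R -> R) (gamma : I -> R)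
    (D : E -> (R -> R) -> R -> R) (l : (seq E * I -> R -> R) -> E -> R -> R)
    (p : E -> R -> R) (h : seq E * I -> R -> R) : Prop :=
  Lam tf' tf r (Dstd D) h /\
  forall w, isW w -> {ae mu, forall t, Hset tf t -> 0 < h w t ->
    forall w', isW w' -> w'.2 = w.2 ->
      Psi gamma D (l h) w t + tollw p D (l h) w.1 t <=
      Psi gamma D (l h) w' t + tollw p D (l h) w'.1 t}.

Definition implementable (tf' tf : R) (r : I -> R -> R) (gamma : I -> R)
    (D : E -> (R -> R) -> R -> R) (l : (seq E * I -> R -> R) -> E -> R -> R)
    (g : E -> R -> R) : Prop :=
  exists p : E -> R -> R,
    (forall e, measurable_fun (Hset tf) (p e)) /\
    (forall e t, Hset tf t -> 0 <= p e t) /\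
    exists h, is_DUE tf' tf r gamma D l p h /\
      (forall e, aeeq tf (l h e) (g e)) /\
      (\sum_(e : E) \int[mu]_(x in Hset tf) (p e x * g e x)%:E < +oo)%E.

Definition total_cost (tf : R) (D : E -> (R -> R) -> R -> R) (g : E -> R -> R) : \bar R :=
  (\sum_(e : E) \int[mu]_(x in Hset tf) (D e (g e) x * g e x)%:E)%E.

Definition system_optimal (tf' tf : R) (r : I -> R -> R)
    (D : E -> (R -> R) -> R -> R) (l : (seq E * I -> R -> R) -> E -> R -> R)
    (g : E -> R -> R) : Prop :=
  (forall e, Lplus tf (g e)) /\
  (exists h, Lam tf' tf r (Dstd D) h /\ forall e, aeeq tf (l h e) (g e)) /\
  (forall h', Lam tf' tf r (Dstd D) h' ->
     (total_cost tf D g <= total_cost tf D (l h'))%E).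

End Network.
End DNL.

(* Main.v *)
Require Import Defs.
From HB Require Import structures.
From mathcomp Require Import all_boot all_order all_algebra.
From mathcomp Require Import all_classical all_reals all_analysis.
From mathcomp Require Import measurable_realfun ring lra.
Set Implicit Arguments. Unset Strict Implicit. Unset Printing Implicit Defensive.
Import Order.TTheory GRing.Theory Num.Theory.
Import numFieldNormedType.Exports.
Local Open Scope classical_set_scope.
Local Open Scope ring_scope.

(** With the travel times frozen at a flow [u] that satisfies flow conservation
    and does not leave [d], dynamic routing becomes a linear program: the
    unknowns are the fractions of the inflow rates put on the finitely many walks
    of bounded size, and the edge loads depend linearly on them. We minimise the
    value-weighted travel time among the assignments with load exactly [u]. A
    minimiser exists because nested convex sets of bounded functions contain an
    almost everywhere convergent sequence, and the tolls are the Lagrange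
    multipliers of the load constraint. They are bounded functions because the
    constraint admits an exact penalty: an assignment with load [x] can be turned
    into one with load [u] at a cost proportional to the mass of the positive part
    of [x - u], by thinning the walks where edges are overloaded and re-routing
    the missing flow along a decomposition of what remains of [u]. Minimality for
    the tolled costs, tested by moving flow from one walk to another, is the
    equilibrium condition, and assumption (4) brings us back from frozen to true
    travel times.

    Optimality enters only to show that no flow leaves [d]. Cut every walk at its
    first visit to [d], so that the edge loads shrink from [u] to [uu]. Sending
    the flow that actually arrives at a node, in order of arrival, along the same
    edges as the corresponding portion of [uu] yields a genuine flow [g]; by (i)
    and (ii) its cumulative arrivals are never later than those of [uu]. Hence its
    cost is at most that of [uu] under the travel times of [u], which is smaller
    than the cost of [u] unless [uu = u]. *)

(** * Bounded measurable functions and real-valued integrals *)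

(** Exit times are monotone but may be constant on intervals, so an arbitrary assignment can load an
    edge with atoms; only special loads such as [u] are known to have densities. Loads are therefore
    measures, compared relative to one finite measure that dominates them all, and conservation is
    used in weak form, against bounded test functions vanishing at [d].

    A plain separation argument for the load constraint would give a functional on bounded
    functions, which need not be a function of time. The exact penalty avoids this. Its constant is
    a bound for the cost of a walk, because re-routed flow pays at most that much per unit.

    The common source and destination enter in the re-routing: every walk from [s] to [d] serves
    every commodity, so one decomposition of the missing flow can be shared in proportion to the
    missing rates. A decomposition is finite because each edge carrying flow takes at least [tau].
    It stops on reaching [d], so flow that leaves [d] again could not be reproduced; this is why
    such flow has to be excluded. *)

Section Bounded.
Context d (T : measurableType d) (R : realType).
Implicit Types b f g : T -> R.

(** The common class of test functions: they are integrable against every finite measure and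
    multiply [L1] into itself. *)
Definition bm b := measurable_fun setT b /\ exists C, forall x, `|b x| <= C.

Lemma bm_meas b : bm b -> measurable_fun setT b. Proof. by case. Qed.

Lemma bm_cst (c : R) : bm (fun _ => c).
Proof. by split; [exact: measurable_cst|exists `|c|]. Qed.

Lemma bmD b1 b2 : bm b1 -> bm b2 -> bm (fun x => b1 x + b2 x).
Proof.
move=> [m1 [C1 h1]] [m2 [C2 h2]]; split; first exact: measurable_funD.
by exists (C1 + C2) => x; rewrite (le_trans (ler_normD _ _))// lerD.
Qed.

Lemma bmN b : bm b -> bm (fun x => - b x).
Proof.
move=> [m [C h]]; split; first exact: measurableT_comp.
by exists C => x; rewrite normrN.
Qed.

Lemma bmB b1 b2 : bm b1 -> bm b2 -> bm (fun x => b1 x - b2 x).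
Proof. by move=> h1 h2; apply: bmD => //; exact: bmN. Qed.

Lemma bmM b1 b2 : bm b1 -> bm b2 -> bm (fun x => b1 x * b2 x).
Proof.
move=> [m1 [C1 h1]] [m2 [C2 h2]]; split; first exact: measurable_funM.
by exists (C1 * C2) => x; rewrite normrM ler_pM.
Qed.

Lemma bm_norm b : bm b -> bm (fun x => `|b x|).
Proof.
move=> [m [C h]]; split; first exact: measurableT_comp.
by exists C => x; rewrite normr_id.
Qed.

Lemma bm_max b1 b2 : bm b1 -> bm b2 -> bm (fun x => Num.max (b1 x) (b2 x)).
Proof.
move=> [m1 [C1 h1]] [m2 [C2 h2]]; split; first exact: measurable_maxr.
exists (C1 + C2) => x; have := h1 x; have := h2 x.
have : 0 <= C1 by exact: le_trans (h1 x). have : 0 <= C2 by exact: le_trans (h2 x).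
by rewrite /Num.max; case: ifP => _; lra.
Qed.

Lemma bm_indic (A : set T) : measurable A -> bm (fun x => \1_A x).
Proof.
move=> mA; split; first exact: measurable_indic.
by exists 1 => x; rewrite indicE; case: (_ \in _); rewrite ?normr1 ?normr0.
Qed.

Lemma bm_sum (J : Type) (s : seq J) (P : pred J) (b : J -> T -> R) :
  (forall j, P j -> bm (b j)) -> bm (fun x => \sum_(j <- s | P j) b j x).
Proof.
move=> h; elim: s => [|j s IH].
  rewrite (_ : (fun _ => _) = fun _ => 0); first exact: bm_cst.
  by apply/funext => x; rewrite big_nil.
case Pj : (P j).
  rewrite (_ : (fun _ => _) = fun x => b j x + \sum_(j <- s | P j) b j x).
    by apply: bmD => //; exact: h.
  by apply/funext => x; rewrite big_cons Pj.
rewrite (_ : (fun _ => _) = fun x => \sum_(j <- s | P j) b j x)//.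
by apply/funext => x; rewrite big_cons Pj.
Qed.

Lemma bm_bnd f (C : R) : measurable_fun setT f -> (forall x, 0 <= f x <= C) -> bm f.
Proof.
move=> mf h; split => //; exists C => x; have /andP[h0 h1] := h x.
by rewrite ger0_norm.
Qed.

Variable mu : {measure set T -> \bar R}.

Definition L1 f := mu.-integrable setT (EFin \o f).

Lemma L1_meas f : L1 f -> measurable_fun setT f.
Proof. by move=> h; apply/measurable_EFinP; exact: measurable_int h. Qed.

Lemma L1_cst0 : L1 (fun _ => 0).
Proof. exact: integrable0. Qed.

Lemma L1D f g : L1 f -> L1 g -> L1 (fun x => f x + g x).
Proof. by move=> hf hg; have := integrableD measurableT hf hg. Qed.

Lemma L1N f : L1 f -> L1 (fun x => - f x).
Proof. by move=> hf; have := integrableN hf. Qed.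

Lemma L1B f g : L1 f -> L1 g -> L1 (fun x => f x - g x).
Proof. by move=> hf hg; apply: L1D => //; exact: L1N. Qed.

Lemma L1M f b : L1 f -> bm b -> L1 (fun x => f x * b x).
Proof.
move=> hf [mb [C hC]]; apply: (integrableMl measurableT hf) => //.
exists C; split; first exact: num_real.
by move=> M CM x _ /=; apply: le_trans (hC x) (ltW CM).
Qed.

Lemma L1Z (c : R) f : L1 f -> L1 (fun x => c * f x).
Proof.
move=> hf; rewrite (_ : (fun _ => _) = fun x => f x * c); last first.
  by apply/funext => x; rewrite mulrC.
by apply: L1M => //; exact: bm_cst.
Qed.

Lemma L1_sum (J : Type) (s : seq J) (P : pred J) (f : J -> T -> R) :
  (forall j, P j -> L1 (f j)) -> L1 (fun x => \sum_(j <- s | P j) f j x).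
Proof.
move=> h; elim: s => [|j s IH].
  rewrite (_ : (fun _ => _) = fun _ => 0); first exact: L1_cst0.
  by apply/funext => x; rewrite big_nil.
case Pj : (P j).
  rewrite (_ : (fun _ => _) = fun x => f j x + \sum_(j <- s | P j) f j x).
    by apply: L1D => //; exact: h.
  by apply/funext => x; rewrite big_cons Pj.
rewrite (_ : (fun _ => _) = fun x => \sum_(j <- s | P j) f j x)//.
by apply/funext => x; rewrite big_cons Pj.
Qed.

Lemma L1_dom f g : measurable_fun setT f -> L1 g -> (forall x, `|f x| <= g x) -> L1 f.
Proof.
move=> mf hg h; apply: (le_integrable measurableT _ _ hg).
  exact/measurable_EFinP.
by move=> x _ /=; rewrite lee_fin (le_trans (h x))// ler_norm.
Qed.

Definition II f : R := \int[mu]_x f x.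

Lemma II_EFin f : L1 f -> (\int[mu]_x (f x)%:E = (II f)%:E)%E.
Proof. by move=> hf; rewrite /II /Rintegral fineK//; exact: integrable_fin_num hf. Qed.

Lemma II_ge0 f : (forall x, 0 <= f x) -> 0 <= II f.
Proof. by move=> h; apply: Rintegral_ge0 => x _. Qed.

Lemma IID f g : L1 f -> L1 g -> II (fun x => f x + g x) = II f + II g.
Proof. by move=> hf hg; rewrite /II RintegralD. Qed.

Lemma IIB f g : L1 f -> L1 g -> II (fun x => f x - g x) = II f - II g.
Proof. by move=> hf hg; rewrite /II RintegralB. Qed.

Lemma IIZ (c : R) f : L1 f -> II (fun x => c * f x) = c * II f.
Proof. by move=> hf; rewrite /II RintegralZl. Qed.

Lemma II0 : II (fun _ => 0) = 0.
Proof. by rewrite /II Rintegral_cst// mul0r. Qed.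

Lemma eq_II f g : f =1 g -> II f = II g.
Proof. by move=> h; congr II; exact/funext. Qed.

Lemma le_II f g : L1 f -> L1 g -> (forall x, f x <= g x) -> II f <= II g.
Proof. by move=> hf hg h; apply: le_Rintegral. Qed.

Lemma II_sum (J : Type) (s : seq J) (P : pred J) (f : J -> T -> R) :
  (forall j, P j -> L1 (f j)) ->
  II (fun x => \sum_(j <- s | P j) f j x) = \sum_(j <- s | P j) II (f j).
Proof.
move=> h; elim: s => [|j s IH].
  by rewrite big_nil -[RHS]II0; apply: eq_II => x; rewrite big_nil.
rewrite big_cons; case Pj : (P j).
  rewrite -IH -IID; [|exact: h|exact: L1_sum].
  by apply: eq_II => x; rewrite big_cons Pj.
by rewrite -IH; apply: eq_II => x; rewrite big_cons Pj.
Qed.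

Lemma ae_eq_II f g : L1 f -> L1 g -> {ae mu, forall x, f x = g x} -> II f = II g.
Proof.
move=> hf hg h; rewrite /II /Rintegral; congr fine; apply: ae_eq_integral => //.
- exact: measurable_int hf.
- exact: measurable_int hg.
- by apply: filterS h => x -> _.
Qed.

Lemma II_eq0_ae f : L1 f -> (forall x, 0 <= f x) -> II f = 0 -> {ae mu, forall x, f x = 0}.
Proof.
move=> hf f0 h.
have : ae_eq mu setT (EFin \o f) (cst 0%E).
  apply/(ae_eq_integral_abs mu measurableT); first exact: measurable_int hf.
  transitivity (\int[mu]_x (f x)%:E)%E; last by rewrite II_EFin// h.
  by apply: eq_integral => x _ /=; rewrite ger0_norm.
by apply: filterS => x /(_ I) /= [].
Qed.

Lemma le0_II_eq0 f : (forall x, 0 <= f x) -> II f <= 0 -> II f = 0.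
Proof. by move=> f0 h; apply/eqP; rewrite eq_le h II_ge0. Qed.

End Bounded.
Arguments eq_II {d T R mu f g} _.
Arguments II_ge0 {d T R mu f} _.
Arguments le0_II_eq0 {d T R mu f} _ _.

Section AE.
Context d (T : measurableType d) (R : realType).
Variable mu : {measure set T -> \bar R}.

Lemma ae_mp (A B : T -> Prop) : (forall x, A x -> B x) ->
  {ae mu, forall x, A x} -> {ae mu, forall x, B x}.
Proof. by move=> h; apply: filterS. Qed.

Lemma ae_and (A B : T -> Prop) :
  {ae mu, forall x, A x} -> {ae mu, forall x, B x} -> {ae mu, forall x, A x /\ B x}.
Proof. by apply: filterS2. Qed.

Lemma ae_all_seq (J : eqType) (s : seq J) (A : J -> T -> Prop) :
  (forall j, j \in s -> {ae mu, forall x, A j x}) -> {ae mu, forall x, forall j, j \in s -> A j x}.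
Proof.
elim: s => [|j s IH] h; first exact: aeW.
have hj : {ae mu, forall x, A j x} by apply: h; rewrite mem_head.
have hs : {ae mu, forall x, forall k, k \in s -> A k x}.
  by apply: IH => k ks; apply: h; rewrite inE ks orbT.
move: (ae_and hj hs); apply: ae_mp => x [h1 h2] k.
by rewrite inE => /predU1P[->//|]; exact: h2.
Qed.

End AE.

(** * Images of densities under finitely many maps *)

Section Density.
Context d (T : measurableType d) (R : realType).
Variable mu : {sigma_finite_measure set T -> \bar R}.
Variables (k : T -> R) (hk : L1 mu k) (k0 : forall x, 0 <= k x).

Definition density_measure (A : set T) : \bar R := (\int[mu]_(x in A) (k x)%:E)%E.

Let densm0 : density_measure set0 = 0%E. Proof. by rewrite /density_measure integral_set0. Qed.
Let densm_ge0 A : (0 <= density_measure A)%E.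
Proof. by apply: integral_ge0 => x _; rewrite lee_fin. Qed.
Let densm_sigma : semi_sigma_additive density_measure.
Proof.
by apply: semi_sigma_additive_nng_induced => //; exact: measurable_int hk.
Qed.
HB.instance Definition _ :=
  isMeasure.Build _ _ _ density_measure densm0 densm_ge0 densm_sigma.

Let density_measure_fin : fin_num_fun density_measure.
Proof. by apply: lty_fin_num_fun; change (\int[mu]_x (k x)%:E < +oo)%E; rewrite (II_EFin hk) ltry. Qed.
HB.instance Definition _ := Measure_isFinite.Build _ _ _ density_measure density_measure_fin.

(** The change of variables formula holds for the Radon-Nikodym derivative of this measure, and that
    derivative agrees with [k] almost everywhere because both have the same integral over every
    measurable set. *)
Lemma integral_density_measure (f : T -> \bar R) : (forall x, 0 <= f x)%E ->
  measurable_fun setT f -> (\int[density_measure]_x f x = \int[mu]_x (f x * (k x)%:E))%E.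
Proof.
move=> f0 mf.
pose nu : {finite_measure set T -> \bar R} := density_measure.
have numu : nu `<< mu.
  apply/null_content_dominatesP => A mA muA; rewrite /nu /= /density_measure.
  apply: null_set_integral => //.
  apply/measurable_funTS; exact: measurable_int hk.
have := Radon_Nikodym_SigmaFinite.change_of_variables numu f0 measurableT mf.
rewrite -[RHS]/(\int[density_measure]_x f x)%E => <-.
apply: ae_eq_integral => //.
- apply: emeasurable_funM => //.
  exact: measurable_int (Radon_Nikodym_SigmaFinite.f_integrable numu).
- by apply: emeasurable_funM => //; exact: measurable_int hk.
have : ae_eq mu setT (Radon_Nikodym_SigmaFinite.f nu mu) (EFin \o k).
  apply: integral_ae_eq => //.
  - exact: Radon_Nikodym_SigmaFinite.f_integrable.
  - exact: measurable_int hk.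
  - by move=> A _ mA; rewrite -Radon_Nikodym_SigmaFinite.f_integral.
by apply: filterS => x /= h _; rewrite h.
Qed.

Lemma density_push_ex d' (T' : measurableType d') (phi : T -> T') :
  measurable_fun setT phi ->
  exists nu : {measure set T' -> \bar R}, forall f : T' -> \bar R,
    (forall x, 0 <= f x)%E -> measurable_fun setT f ->
    (\int[nu]_x f x = \int[mu]_x (f (phi x) * (k x)%:E))%E.
Proof.
move=> mphi.
unshelve eexists; first by unshelve refine (pushforward density_measure phi : {measure set T' -> \bar R}).
move=> f f0 mf; rewrite ge0_integral_pushforward//= preimage_setT.
by rewrite integral_density_measure//; exact: measurableT_comp.
Qed.

End Density.

Section BmMisc.
Context d1 (T : measurableType d1) d2 (T' : measurableType d2) (R : realType).

Lemma bm_comp (b : T' -> R) (phi : T -> T') :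
  bm b -> measurable_fun setT phi -> bm (fun x => b (phi x)).
Proof.
move=> [mb [C hC]] mphi; split; first exact: measurableT_comp.
by exists C => x.
Qed.

Lemma L1_fin (nu : {finite_measure set T -> \bar R}) (b : T -> R) : bm b -> L1 nu b.
Proof.
move=> [mb [C hC]]; apply: measurable_bounded_integrable => //.
  by rewrite -ge0_fin_numE// fin_num_measure.
exists C; split; first exact: num_real.
by move=> M CM x _ /=; apply: le_trans (hC x) (ltW CM).
Qed.

End BmMisc.

Section AsFinite.
Context d (T : measurableType d) (R : realType).
(** An alias on which a proof of finiteness can be registered as a structure, for measures that come
    out of an existential. *)
Definition as_finite (nu : {measure set T -> \bar R}) (h : fin_num_fun nu) :
  set T -> \bar R := nu.
HB.instance Definition _ nu h := Measure.copy (@as_finite nu h) nu.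
HB.instance Definition _ nu h := Measure_isFinite.Build _ _ _ (@as_finite nu h) h.
End AsFinite.

Section Push.
Context d1 (T : measurableType d1) d2 (T' : measurableType d2) (R : realType).
Variable mu : {sigma_finite_measure set T -> \bar R}.
Implicit Type s : seq ((T -> R) * (T -> T')).

(* A pair [(k, phi)] stands for the image under [phi] of the measure with density [k]. *)
Definition atom_ok (p : (T -> R) * (T -> T')) :=
  [/\ L1 mu p.1, forall x, 0 <= p.1 x & measurable_fun setT p.2].

Definition atoms_int s (b : T' -> R) : R := \sum_(p <- s) II mu (fun x => p.1 x * b (p.2 x)).

Lemma atom_L1 p b : atom_ok p -> bm b -> L1 mu (fun x => p.1 x * b (p.2 x)).
Proof. by move=> [h1 _ h3] hb; apply: L1M => //; exact: bm_comp. Qed.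

Lemma atoms_int_cons p s b : atoms_int (p :: s) b = II mu (fun x => p.1 x * b (p.2 x)) + atoms_int s b.
Proof. by rewrite /atoms_int big_cons. Qed.

Lemma atoms_int_cat s1 s2 b : atoms_int (s1 ++ s2) b = atoms_int s1 b + atoms_int s2 b.
Proof. by rewrite /atoms_int big_cat. Qed.

Lemma atoms_intD s b1 b2 : List.Forall atom_ok s -> bm b1 -> bm b2 ->
  atoms_int s (fun x => b1 x + b2 x) = atoms_int s b1 + atoms_int s b2.
Proof.
move=> + h1 h2; elim=> [|p {}s hp hs IH]; first by rewrite /atoms_int !big_nil addr0.
rewrite !atoms_int_cons IH addrACA -IID ?atom_L1//; congr (_ + _).
by apply: eq_II => x; rewrite mulrDr.
Qed.

Lemma atoms_intZ s c b : List.Forall atom_ok s -> bm b ->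
  atoms_int s (fun x => c * b x) = c * atoms_int s b.
Proof.
move=> + h1; elim=> [|p {}s hp hs IH]; first by rewrite /atoms_int !big_nil mulr0.
rewrite !atoms_int_cons IH mulrDr -IIZ ?atom_L1//; congr (_ + _).
by apply: eq_II => x; rewrite mulrCA.
Qed.

(** Nonnegative integrands follow by induction on the list; a signed bounded one is reduced to them
    by adding a constant. *)
Lemma atoms_int_measure s : List.Forall atom_ok s ->
  exists nu : {finite_measure set T' -> \bar R},
    (forall A, measurable A -> nu A = (atoms_int s (fun x => \1_A x))%:E) /\
    forall b, bm b -> II nu b = atoms_int s b.
Proof.
move=> hs.
have [nu hnu] : exists nu : {measure set T' -> \bar R}, forall f, bm f ->
    (forall x, 0 <= f x) -> (\int[nu]_x (f x)%:E = (atoms_int s f)%:E)%E.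
  elim: hs => [|p {}s hp _ [nu IH]].
    exists mzero => f [mf _] f0; rewrite integral_measure_zero.
    by rewrite /atoms_int big_nil.
  have [hp1 hp2 hp3] := hp.
  have [nu1 hnu1] := density_push_ex hp1 hp2 hp3.
  exists (measure_add nu1 nu) => f bf f0.
  have mf : measurable_fun setT (EFin \o f) by apply/measurable_EFinP; exact: bm_meas.
  rewrite ge0_integral_measure_add//; last by move=> x _; rewrite lee_fin.
  rewrite IH// atoms_int_cons EFinD hnu1//.
  rewrite -(II_EFin (atom_L1 _ bf)); last by split.
  by congr (_ + _)%E; apply: eq_integral => x _; rewrite -EFinM mulrC.
have nuA A : measurable A -> nu A = (atoms_int s (fun x => \1_A x))%:E.
  move=> mA; rewrite -hnu; [|exact: bm_indic|by move=> x; rewrite indicE].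
  by rewrite integral_indic// setIT.
have fnu : fin_num_fun nu by move=> A mA; rewrite nuA.
pose nu' : {finite_measure set T' -> \bar R} := as_finite fnu.
exists nu'; split => // b hb.
have [mb [C' hC]] := hb; pose C : R := `|C'|.
have C0 x : 0 <= b x + C.
  by have := hC x; have := ler_norm C'; rewrite -/C ler_norml; lra.
have hC' : bm (fun _ : T' => C) := bm_cst _ _.
have h f : bm f -> (forall x, 0 <= f x) -> II nu' f = atoms_int s f.
  by move=> bf f0; apply: EFin_inj; rewrite -hnu// -II_EFin//; exact: L1_fin.
have := h _ (bmD hb hC') C0.
rewrite IID ?atoms_intD//; try exact: L1_fin.
rewrite (h (fun=> C))//; last by move=> _; exact: normr_ge0.
by move/addIr.
Qed.

End Push.

(** * Radon-Nikodym densities with values in the unit interval *)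

Section RN.
Context d (T : measurableType d) (R : realType).
Variables (nu mu : {finite_measure set T -> \bar R}).
Hypothesis numu : forall A, measurable A -> (nu A <= mu A)%E.

Lemma II_setI_indic (m : {finite_measure set T -> \bar R}) (A : set T) : measurable A ->
  ((II m (fun x => \1_A x))%:E = m A)%E.
Proof.
move=> mA; rewrite -II_EFin; last by apply: L1_fin; exact: bm_indic.
by rewrite integral_indic// setIT.
Qed.

(** The derivative [h] lies in [[0, 1]] almost everywhere because [nu] is nonnegative and at most
    [mu]. Truncating it makes the bounds hold at every point, as later pointwise estimates
    require. *)
Lemma finite_density : exists f : T -> R,
  [/\ measurable_fun setT f, forall x, 0 <= f x <= 1 &
      forall b, bm b -> II nu b = II mu (fun x => f x * b x)].
Proof.
have dom : nu `<< mu.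
  apply/null_content_dominatesP => A mA muA.
  by apply/eqP; rewrite eq_le measure_ge0 andbT -muA; exact: numu.
pose g := Radon_Nikodym (charge_of_finite_measure nu) mu.
have gfin x : g x \is a fin_num by exact: Radon_Nikodym_fin_num.
pose h x := fine (g x).
have hE : EFin \o h = g by apply/funext => x /=; rewrite fineK.
have ih : L1 mu h by rewrite /L1 hE; exact: Radon_Nikodym_integrable.
have mh := L1_meas ih.
have key b : bm b -> II nu b = II mu (fun x => h x * b x).
  move=> hb.
  have := Radon_Nikodym_change_of_variables dom measurableT (L1_fin nu hb).
  rewrite -/g => E; apply: EFin_inj; rewrite -II_EFin; last exact: L1_fin.
  rewrite -[LHS]E -II_EFin; last exact: L1M.
  by apply: eq_integral => x _ /=; rewrite -(congr1 (fun f => f x) hE) /= -EFinM mulrC.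
have bA A : measurable A -> bm (fun x : T => (\1_A x : R)) by exact: bm_indic.
pose A := [set x | h x < 0]; pose B := [set x | 1 < h x].
have mA : measurable A.
  rewrite -[A]setTI (_ : A = h @^-1` `]-oo, 0[%classic); first exact: mh.
  by apply/seteqP; split => x /=; rewrite in_itv.
have mB : measurable B.
  rewrite -[B]setTI (_ : B = h @^-1` `]1, +oo[%classic); first exact: mh.
  by apply/seteqP; split => x /=; rewrite in_itv/= andbT.
have aeA : {ae mu, forall x, h x * - \1_A x = 0}.
  apply: II_eq0_ae.
  - by apply: L1M => //; apply: bmN; exact: bA.
  - move=> x; rewrite indicE /A; case: (boolP (x \in _)).
      by rewrite inE /= => ?; rewrite mulrN1; lra.
    by rewrite oppr0 mulr0.
  apply: le0_II_eq0.
    move=> x; rewrite indicE /A; case: (boolP (x \in _)).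
      by rewrite inE /= => ?; rewrite mulrN1; lra.
    by rewrite oppr0 mulr0.
  rewrite -key; last by apply: bmN; exact: bA.
  rewrite (eq_II (g := fun x => -1 * \1_A x)); last by move=> x; rewrite mulN1r.
  rewrite IIZ; last by apply: L1_fin; exact: bA.
  by rewrite mulN1r oppr_le0 II_ge0// => x; rewrite indicE.
have aeB : {ae mu, forall x, (h x - 1) * \1_B x = 0}.
  have p0 x : 0 <= (h x - 1) * \1_B x.
    rewrite indicE /B; case: (boolP (x \in _)).
      by rewrite inE /= => ?; rewrite mulr1; lra.
    by rewrite mulr0.
  have i1 : L1 mu (fun x => h x - 1) by apply: L1B => //; apply: L1_fin; exact: bm_cst.
  apply: II_eq0_ae => //; first by apply: L1M => //; exact: bA.
  apply: le0_II_eq0 => //.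
  rewrite (eq_II (g := fun x => h x * \1_B x - \1_B x)); last by move=> x; ring.
  rewrite IIB; [|by apply: L1M => //; exact: bA|by apply: L1_fin; exact: bA].
  rewrite -key; last exact: bA.
  by rewrite subr_le0 -lee_fin (II_setI_indic nu mB) (II_setI_indic mu mB); exact: numu.
pose f x := Num.min 1 (Num.max 0 (h x)).
have mf : measurable_fun setT f by apply: measurable_minr => //; exact: measurable_maxr.
have f01 x : 0 <= f x <= 1.
  by rewrite /f le_min ler01 le_max lexx ge_min lexx.
exists f; split => // b hb; rewrite key//; apply: ae_eq_II.
- exact: L1M.
- by apply: L1_fin; apply: bmM => //; exact: bm_bnd mf f01.
apply: filterS2 aeA aeB => x; rewrite !indicE => h1 h2.
have {}h1 : 0 <= h x.
  rewrite leNgt; apply/negP => h0; move: h1.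
  by rewrite mem_set//= mulrN1 => /eqP; rewrite oppr_eq0 lt_eqF.
have {}h2 : h x <= 1.
  rewrite leNgt; apply/negP => h0; move: h2.
  by rewrite mem_set//= mulr1 => /eqP; rewrite subr_eq0 gt_eqF.
by rewrite /f max_r// min_r.
Qed.

End RN.

Section PushCompare.
Context d1 (T : measurableType d1) d2 (T' : measurableType d2) (R : realType).
Variable mu : {sigma_finite_measure set T -> \bar R}.
Implicit Type s : seq ((T -> R) * (T -> T')).

Lemma push_density s1 s2 : List.Forall (atom_ok mu) s1 -> List.Forall (atom_ok mu) s2 ->
  (forall A, measurable A -> atoms_int mu s1 (fun x => \1_A x) <= atoms_int mu s2 (fun x => \1_A x)) ->
  exists f : T' -> R, [/\ measurable_fun setT f, forall x, 0 <= f x <= 1 &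
    forall b, bm b -> atoms_int mu s1 b = atoms_int mu s2 (fun x => f x * b x)].
Proof.
move=> /atoms_int_measure[nu1 [n1 i1]] /atoms_int_measure[nu2 [n2 i2]] h.
have [|f [mf f01 fE]] := @finite_density _ _ _ nu1 nu2.
  by move=> A mA; rewrite n1// n2// lee_fin; exact: h.
exists f; split => // b hb; rewrite -i1// -i2 ?fE//.
by apply: bmM => //; exact: bm_bnd mf f01.
Qed.

End PushCompare.

Section PushExt.
Context d1 (T : measurableType d1) (R : realType).
Variable mu : {sigma_finite_measure set T -> \bar R}.
Implicit Type s : seq ((T -> R) * (T -> R)).

(** Half-lines form a generating system stable under intersection, so total mass and distribution
    function determine a finite measure on the line. *)
Lemma push_ext s1 s2 : List.Forall (atom_ok mu) s1 -> List.Forall (atom_ok mu) s2 ->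
  atoms_int mu s1 (fun=> 1) = atoms_int mu s2 (fun=> 1) ->
  (forall t, atoms_int mu s1 (fun x => ((x : R) <= t)%R%:R) = atoms_int mu s2 (fun x => ((x : R) <= t)%R%:R)) ->
  forall b, bm b -> atoms_int mu s1 b = atoms_int mu s2 b.
Proof.
move=> ok1 ok2 tot h b hb.
have [nu1 [n1 i1]] := atoms_int_measure ok1; have [nu2 [n2 i2]] := atoms_int_measure ok2.
have b1 : bm (fun _ : R => 1 : R) := bm_cst _ _.
have E A : measurable A -> nu1 A = nu2 A.
  apply: (measure_unique (@RGenOInfty.G R) (fun k => `](- k%:R), +oo[%classic)).
  - exact: RGenOInfty.measurableE.
  - move=> _ _ [x ->] [y ->]; exists (Num.max x y).
    by apply/seteqP; split => z /=; rewrite !in_itv/= !andbT gt_max => /andP.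
  - by move=> k; exists (- k%:R).
  - apply/seteqP; split => // x _; exists (Num.truncn `|x|).+1 => //=.
    rewrite in_itv/= andbT; have /andP[_] := truncn_itv (normr_ge0 x).
    by have := ler_norm (- x); rewrite normrN; lra.
  - move=> _ [x ->]; apply: (eq_trans (n1 _ _)) => //; apply/esym/(eq_trans (n2 _ _)) => //.
    apply/esym; congr EFin.
    have E1 s : List.Forall (atom_ok mu) s ->
        atoms_int mu s (fun y => \1_(`]x, +oo[%classic) y) =
        atoms_int mu s (fun=> 1) + -1 * atoms_int mu s (fun y => (y <= x)%R%:R).
      move=> ok.
      have bx : bm (fun y : R => ((y <= x)%R%:R : R)).
        rewrite (_ : (fun _ => _) = fun y => \1_(`]-oo, x]%classic) y); first exact: bm_indic.
        by apply/funext => y; rewrite indicE mem_setE/= in_itv.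
      rewrite -atoms_intZ// -atoms_intD//; last by apply: bmM => //; exact: bm_cst.
      congr atoms_int; apply/funext => y; rewrite indicE mem_setE/= in_itv/= andbT ltNge.
      by case: (y <= x) => /=; lra.
    by rewrite !E1// tot h.
  - by move=> k; apply: (@le_lt_trans _ _ (atoms_int mu s1 (fun x => \1_(`](- k%:R), +oo[%classic) x))%:E); rewrite ?ltry// -n1.
rewrite -i1// -i2// /II /Rintegral; congr fine.
by apply: eq_measure_integral => A mA _; exact: E.
Qed.

End PushExt.

(** * Convergence in convex sets and duality *)

Section FastConvergence.
Context d (T : measurableType d) (R : realType).
Variable m : {finite_measure set T -> \bar R}.
Variables (J : eqType) (s : seq J) (F : nat -> J -> T -> R).
Hypothesis bF : forall n j, bm (F n j).
Hypothesis fast : forall n,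
  \sum_(j <- s) II m (fun x => (F n.+1 j x - F n j x) ^+ 2) <= 8 * (8^-1) ^+ n.

(** The weight [2 ^+ n] still leaves integrals of order [4^-1 ^+ n], so the [q n] have an almost
    everywhere finite sum. Each increment [D] satisfies [D <= 2^-1 ^+ n + 2 ^+ n * D ^+ 2], hence
    the increments are summable at those points. *)
Let q n x : R := 2 ^+ n * \sum_(j <- s) (F n.+1 j x - F n j x) ^+ 2.

Let bsq n j : bm (fun x => (F n.+1 j x - F n j x) ^+ 2).
Proof. by apply: bmM; apply: bmB. Qed.

Let bq n : bm (q n).
Proof. by apply: bmM; [exact: bm_cst|exact: bm_sum]. Qed.

Let q0 n x : 0 <= q n x.
Proof. by rewrite mulr_ge0// sumr_ge0// => j _; exact: sqr_ge0. Qed.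

Let Iq n : II m (q n) <= 8 * (4^-1) ^+ n.
Proof.
rewrite IIZ; last by apply: L1_fin; exact: bm_sum.
rewrite II_sum; last by move=> j _; apply: L1_fin.
apply: le_trans (ler_wpM2l _ (fast n)) _ => //.
have -> : (4^-1 : R) = 2 * 8^-1 by lra.
by rewrite exprMn mulrCA.
Qed.

Let G x := (\sum_(n <oo) (q n x)%:E)%E.

Let mq n : measurable_fun setT (fun x => (q n x)%:E).
Proof. by apply/measurable_EFinP; exact: bm_meas. Qed.

Let mG : measurable_fun setT G.
Proof. by apply: ge0_emeasurable_sum => // n x _ _; rewrite lee_fin. Qed.

Let IG : (\int[m]_x G x < +oo)%E.
Proof.
rewrite /G integral_nneseries//; last by move=> n x _; rewrite lee_fin.
apply: (@le_lt_trans _ _ 16%:E); last exact: ltry.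
apply: lime_le.
  by apply: is_cvg_nneseries => n _ _; apply: integral_ge0 => x _; rewrite lee_fin.
apply: nearW => n.
rewrite (eq_bigr (fun k => (II m (q k))%:E)); last by move=> k _; rewrite II_EFin//; exact: L1_fin.
rewrite sumEFin lee_fin.
(* The slack term makes the bound inductive: with [x] for [4^-1 ^+ n], adding [8 * x] to
   [16 - 11 * x] gives at most [16 - 11 * x / 4]. *)
apply: (@le_trans _ _ (16 - 11 * (4^-1) ^+ n)); last first.
  have : 0 <= (4^-1 : R) ^+ n by rewrite exprn_ge0.
  lra.
elim: n => [|n IH]; first by rewrite big_geq// expr0; lra.
rewrite big_nat_recr//= exprS; have := Iq n.
have : 0 <= (4^-1 : R) ^+ n by rewrite exprn_ge0. 
move: IH; lra.
Qed.

Let A := [set x | (G x < +oo)%E].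

Let mA : measurable A.
Proof.
rewrite /A -[X in measurable X]setTI; exact: emeasurable_fun_infty_o.
Qed.

Let mA0 : m (~` A) = 0%E.
Proof.
have iG : m.-integrable setT G.
  apply/integrableP; split => //.
  rewrite (eq_integral G)// => x _; rewrite gee0_abs//.
  by apply: nneseries_ge0 => n _ _; rewrite lee_fin.
have /negligibleP : m.-negligible (~` A).
  have [N [mN N0 hN]] := integrable_ae measurableT iG.
  exists N; split => // x /= hx; apply: hN => /= /(_ I) hG; apply: hx.
  by rewrite /A /= ltey_eq hG.
by apply; exact: measurableC.
Qed.

Let cvgA x j : A x -> j \in s -> cvgn (F ^~ j ^~ x).
Proof.
move=> Ax js.
rewrite [X in cvgn X](_ : _ = (fun n => F 0 j x + series (telescope (fun n => F n j x)) n)); last first.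
  by apply/funext => n; rewrite [LHS](eq_sum_telescope (fun n => F n j x)).
apply: is_cvgD; first exact: is_cvg_cst.
apply: normed_cvg; apply: nondecreasing_is_cvgn.
  by apply/nondecreasing_series => n _ _; exact: normr_ge0.
exists (2 + fine (G x)) => _ [n _ <-] /=.
have G0 : (0 <= G x)%E by apply: nneseries_ge0 => k _ _; rewrite lee_fin.
have : \sum_(0 <= k < n) q k x <= fine (G x).
  rewrite -lee_fin fineK ?ge0_fin_numE// -sumEFin.
  by apply: nneseries_lim_ge => k _; rewrite lee_fin.
suff : series (fun k => `|telescope (fun n => F n j x) k|) n <=
    2 - 2 * 2^-1 ^+ n + \sum_(0 <= k < n) q k x.
  have : 0 <= (2^-1 : R) ^+ n by rewrite exprn_ge0.
  rewrite /series/=; lra.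
rewrite /series /=; elim: n => [|n IH]; first by rewrite !big_geq// expr0; lra.
rewrite !big_nat_recr//= exprS; set D := `|_|.
have : D <= 2^-1 ^+ n + q n x.
  have p2 : 0 < (2 : R) ^+ n by rewrite exprn_gt0.
  have -> : (2^-1 : R) ^+ n = (2 ^+ n)^-1 by rewrite exprVn.
  (* Either [D] is at most [(2 ^+ n)^-1], or [2 ^+ n * D] is at least 1 and then [D] is at most
     [2 ^+ n * D ^+ 2]. *)
  apply: (@le_trans _ _ ((2 ^+ n)^-1 + 2 ^+ n * D ^+ 2)).
    have [D1|D1] := leP D (2 ^+ n)^-1.
      by rewrite (le_trans D1)// lerDl mulr_ge0// ?sqr_ge0 ?ltW.
    have : 1 <= 2 ^+ n * D by rewrite -ler_pdivrMl// mulr1 ltW.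
    have : 0 <= (2 ^+ n)^-1 :> R by rewrite invr_ge0 ltW.
    have : 0 <= D by exact: normr_ge0.
    nra.
  rewrite lerD2l /q ler_pM2l// /D real_normK ?num_real// /telescope.
  rewrite (big_rem j)//= lerDl sumr_ge0// => k _; exact: sqr_ge0.
move: IH; lra.
Qed.

Lemma fast_cvg : exists (A : set T) (f : J -> T -> R),
  [/\ measurable A, m (~` A) = 0%E, forall j, j \in s -> measurable_fun setT (f j),
      forall x, A x -> forall j, j \in s -> F ^~ j ^~ x @ \oo --> f j x &
      forall x, ~ A x -> forall j, f j x = 0].
Proof.
(* Multiplying by the indicator of [A] makes the sequence converge at every point, so the limit is
   measurable on the whole space and 0 off [A]. *)
exists A, (fun j x => lim ((F n j x * \1_A x) @[n --> \oo])).
have cv x j : j \in s -> cvgn (fun n => F n j x * \1_A x).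
  move=> js; have [Ax|Ax] := pselect (A x).
    apply: is_cvgM; first exact: cvgA. exact: is_cvg_cst.
  rewrite indicE memNset//=; under eq_fun do rewrite mulr0; exact: is_cvg_cst.
split => //.
- move=> j js; apply: (@measurable_fun_cvg _ _ _ setT (fun n x => F n j x * \1_A x)).
    by move=> n; apply: measurable_funM; [exact: bm_meas|exact: measurable_indic].
  by move=> x _; exact: cv.
- move=> x Ax j js.
  have -> : (fun n => F n j x * \1_A x) = (fun n => F n j x).
    by apply/funext => n; rewrite indicE mem_set// mulr1.
  exact: cvgA.
- move=> x Ax j; rewrite indicE memNset//=; under eq_fun do rewrite mulr0.
  exact: lim_cst.
Qed.

End FastConvergence.

Section NestedConvex.
Context d (T : measurableType d) (R : realType).
Variable m : {finite_measure set T -> \bar R}.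
Variables (J : eqType) (s : seq J) (P : nat -> (J -> T -> R) -> Prop) (C : R).
Hypothesis Pdec : forall n f, P n.+1 f -> P n f.
Hypothesis Pcvx : forall n f g, P n f -> P n g -> P n (fun j x => 2^-1 * f j x + 2^-1 * g j x).
Hypothesis Pne : forall n, exists f, P n f.
Hypothesis Pbd : forall n f, P n f ->
  forall j, measurable_fun setT (f j) /\ forall x, 0 <= f j x <= C.

Let bP n f j : P n f -> bm (f j).
Proof. by move=> /Pbd /(_ j)[mf hf]; exact: bm_bnd mf hf. Qed.

Let N2 (f : J -> T -> R) := \sum_(j <- s) II m (fun x => f j x ^+ 2).

Let a n := inf [set N2 f | f in P n].
Let B := \sum_(j <- s) II m (fun _ => C ^+ 2).

Let N20 f : 0 <= N2 f.
Proof. by apply: sumr_ge0 => j _; apply: II_ge0 => x; exact: sqr_ge0. Qed.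

Let N2B n f : P n f -> N2 f <= B.
Proof.
move=> Pf; apply: ler_sum => j _; apply: le_II.
- by apply: L1_fin; apply: bmM; exact: bP Pf.
- by apply: L1_fin; exact: bm_cst.
- move=> x; have [_ /(_ x)/andP[h0 h1]] := Pbd Pf j.
  by rewrite ler_sqr ?nnegrE// (le_trans h0).
Qed.

Let hasinf n : has_inf [set N2 f | f in P n].
Proof.
split; first by have [f Pf] := Pne n; exists (N2 f), f.
by exists 0 => _ [f _ <-].
Qed.

Let a_le n f : P n f -> a n <= N2 f.
Proof. by move=> Pf; apply: ge_inf; [exact: (hasinf n).2|exists f]. Qed.

Let a_nd n k : (n <= k)%N -> a n <= a k.
Proof.
elim: k => [|k IH]; first by rewrite leqn0 => /eqP->.
rewrite leq_eqVlt => /predU1P[->//|]; rewrite ltnS => /IH h; apply: (le_trans h).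
apply: lb_le_inf; first exact: (hasinf _).1.
by move=> _ [f Pf <-]; apply: a_le; exact: Pdec.
Qed.

Let Pdecn n k f : (n <= k)%N -> P k f -> P n f.
Proof.
elim: k => [|k IH]; first by rewrite leqn0 => /eqP->.
rewrite leq_eqVlt => /predU1P[->//|]; rewrite ltnS => /IH h Pf; apply: h.
exact: Pdec.
Qed.

Let asup := sup (range a).

Let hassup : has_sup (range a).
Proof.
split; first by exists (a 0%N), 0%N.
exists B => _ [n _ <-]; have [f Pf] := Pne n; apply: le_trans (N2B Pf); exact: a_le.
Qed.

Let a_sup n : a n <= asup.
Proof. by apply: ub_le_sup; [exact: hassup.2|exists n]. Qed.

(** The midpoint of [f] and [g] is again in [P i], so its squared norm is at least [a i]. *)
Let parallelogram i f g : P i f -> P i g ->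
  \sum_(j <- s) II m (fun x => (f j x - g j x) ^+ 2) <= 2 * N2 f + 2 * N2 g - 4 * a i.
Proof.
move=> Pf Pg; have := a_le (Pcvx Pf Pg).
suff -> : \sum_(j <- s) II m (fun x => (f j x - g j x) ^+ 2) = 2 * N2 f + 2 * N2 g -
   4 * N2 (fun j x => 2^-1 * f j x + 2^-1 * g j x) by lra.
rewrite /N2 !mulr_sumr -big_split -sumrB/=; apply: eq_bigr => j _.
have bf := bP j Pf; have bg := bP j Pg.
have L b : bm b -> L1 m (fun x => b x ^+ 2) by move=> hb; apply: L1_fin; exact: bmM.
have bh : bm (fun x => 2^-1 * f j x + 2^-1 * g j x).
  by apply: bmD; apply: bmM => //; exact: bm_cst.
rewrite -!IIZ; [|exact: L..].
rewrite -IID; [|by apply: L1Z; exact: L..].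
rewrite -IIB; [|by apply: L1D; apply: L1Z; exact: L|by apply: L1Z; exact: (L _ bh)].
by apply: eq_II => x; field.
Qed.

(* Elements of nearly minimal L2 norm are Cauchy by the parallelogram identity;
   a fast subsequence converges almost everywhere. *)
Lemma nested_convex_cvg : exists (F : nat -> J -> T -> R) (A : set T) (f : J -> T -> R),
  [/\ forall n, P n (F n), measurable A, m (~` A) = 0%E &
    [/\ forall j, j \in s -> measurable_fun setT (f j),
      forall x, A x -> forall j, j \in s -> F ^~ j ^~ x @ \oo --> f j x &
      forall x, ~ A x -> forall j, f j x = 0]].
Proof.
(* Two errors of size [del n] enter the parallelogram bound, from the norms and from the distance of
   [a i] to its supremum; together they give [8 * del n], the rate that [fast_cvg] asks for. *)
pose del n : R := (8^-1) ^+ n.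
have del0 n : 0 < del n by rewrite exprn_gt0.
have H n : exists p : nat * (J -> T -> R),
    [/\ (n <= p.1)%N, asup - del n <= a p.1, P p.1 p.2 & N2 p.2 <= a p.1 + del n].
  have [_ [i _ <-] hi] := sup_adherent (del0 n) hassup.
  (* The index is at least [i], so that [a k] is close to the supremum, and at least [n], so that
     the chosen element also satisfies [P n]. *)
  pose k := maxn n i.
  have [_ [f Pf <-] hf] := inf_adherent (del0 n) (hasinf k).
  exists (k, f); split => //=; first exact: leq_maxl.
  - by apply: (le_trans (ltW hi)); apply: a_nd; exact: leq_maxr.
  - exact: ltW.
have [p hp] := choice H.
pose F n := (p n).2.
have PF n : P n (F n) by have [h1 _ h3 _] := hp n; exact: Pdecn h3.
have [A [f [mA mA0 mf cv z]]] : exists (A : set T) (f : J -> T -> R),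
  [/\ measurable A, m (~` A) = 0%E, forall j, j \in s -> measurable_fun setT (f j),
      forall x, A x -> forall j, j \in s -> F ^~ j ^~ x @ \oo --> f j x &
      forall x, ~ A x -> forall j, f j x = 0].
  apply: fast_cvg => [n j|n]; first exact: bP (PF n).
  have [_ h2 h3 h4] := hp n; have [_ g2 g3 g4] := hp n.+1.
  pose i := minn (p n).1 (p n.+1).1.
  have P1 : P i (F n) by apply: Pdecn h3; exact: geq_minl.
  have P2 : P i (F n.+1) by apply: Pdecn g3; exact: geq_minr.
  apply: (le_trans (parallelogram P2 P1)).
  have hdel : del n.+1 <= del n by rewrite /del exprS; have := del0 n; rewrite /del; lra.
  have : asup - del n <= a i by rewrite /i /minn; case: ifP => _ //; lra.
  have := a_sup (p n).1; have := a_sup (p n.+1).1.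
  rewrite -/(del n); move: h4 g4; rewrite -/(F n) -/(F n.+1); lra.
by exists F, A, f.
Qed.

End NestedConvex.

Lemma cvg_sumr (R : realType) (J : eqType) (l : seq J) (x : nat -> J -> R) (y : J -> R) :
  (forall j, j \in l -> x n j @[n --> \oo] --> y j) ->
  (\sum_(j <- l) x n j) @[n --> \oo] --> \sum_(j <- l) y j.
Proof.
elim: l => [|j l IH] h.
  by rewrite big_nil; under eq_fun do rewrite big_nil; exact: cvg_cst.
rewrite big_cons; under eq_fun do rewrite big_cons.
by apply: cvgD; [apply: h; rewrite mem_head|apply: IH => k kl; apply: h; rewrite inE kl orbT].
Qed.

Section DominatedConvergence.
Context d (T : measurableType d) (R : realType).
Variable m : {measure set T -> \bar R}.

Lemma II_cvg (F : nat -> T -> R) (f g : T -> R) : (forall n, measurable_fun setT (F n)) ->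
  measurable_fun setT f -> L1 m g -> {ae m, forall x, F ^~ x @ \oo --> f x} ->
  (forall n x, `|F n x| <= g x) -> II m (F n) @[n --> \oo] --> II m f.
Proof.
move=> mF mf ig cv dom.
have [] := @dominated_convergence _ _ _ m setT measurableT (fun n => EFin \o F n) (EFin \o f) (EFin \o g).
- by move=> n; apply/measurable_EFinP.
- exact/measurable_EFinP.
- apply: filterS cv => x h _; exact: (cvg_comp _ _ h).
- exact: ig.
- by apply: aeW => x n _ /=; rewrite lee_fin.
move=> h1 _ h2; rewrite /II /Rintegral.
apply: fine_cvg; rewrite fineK; last exact: integrable_fin_num.
exact: h2.
Qed.

End DominatedConvergence.

(* [huber] is a differentiable approximation of [c0 * max 0 y] whose derivative
   [huber'] stays in [0, c0]. *)
Section Huber.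
Variables (R : realType) (lam c0 : R).
Hypotheses (lam0 : 0 < lam) (c00 : 0 <= c0).

Definition huber' (y : R) := Num.min c0 (Num.max 0 (lam * y)).
Definition huber (y : R) := huber' y * y - huber' y ^+ 2 / (2 * lam).

Lemma huber'_itv y : 0 <= huber' y <= c0.
Proof. by rewrite /huber' le_min c00 le_max lexx ge_min lexx. Qed.

(** [huber' y] is the projection of [lam * y] on [[0, c0]], and this is its variational inequality.
    Equivalently, it maximises [q * y - q ^+ 2 / (2 * lam)] over [q] in [[0, c0]], with maximum
    [huber y]. *)
Lemma huber'_var y q : 0 <= q <= c0 -> (q - huber' y) * (lam * y - huber' y) <= 0.
Proof.
by rewrite /huber' /Num.min /Num.max => /andP[q0 q1]; case: (ltP 0 (lam * y)) => h1;
  case: ltP => h2; nra.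
Qed.

Lemma huber_le y : huber y <= huber' y * y.
Proof. by rewrite /huber gerBl divr_ge0// ?sqr_ge0// mulr_ge0// ltW. Qed.

(** Quadratic upper bound of a function whose derivative is [lam]-Lipschitz: the difference of the
    two sides is a square plus a term that [huber'_var] makes nonnegative. *)
Lemma huber_upper y y' :
  huber y' <= huber y + huber' y * (y' - y) + lam / 2 * (y' - y) ^+ 2.
Proof.
have := huber'_var y (huber'_itv y').
rewrite /huber; set p := huber' y; set q := huber' y' => h.
rewrite -subr_ge0.
have -> : p * y - p ^+ 2 / (2 * lam) + p * (y' - y) + lam / 2 * (y' - y) ^+ 2 -
   (q * y' - q ^+ 2 / (2 * lam)) =
   (2 * lam)^-1 * ((lam * (y' - y) - (q - p)) ^+ 2 + 2 * - ((q - p) * (lam * y - p))).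
  by field; rewrite gt_eqF.
by rewrite mulr_ge0 ?invr_ge0 ?addr_ge0 ?sqr_ge0 ?mulr_ge0 ?oppr_ge0// ltW.
Qed.

(** The competitor [q] equal to [c0] or 0, by the sign of [y], loses at most [c0 ^+ 2 / (2 * lam)]
    against the unsmoothed penalty. *)
Lemma huber_lower y : c0 * Num.max 0 y - c0 ^+ 2 / (2 * lam) <= huber y.
Proof.
pose q := if 0 < y then c0 else 0.
have hq : 0 <= q <= c0 by rewrite /q; case: ifP; rewrite ?lexx ?c00.
have qy : c0 * Num.max 0 y = q * y.
  by rewrite /q /Num.max; case: ifP => _; rewrite ?mulr0 ?mul0r.
have qc : q ^+ 2 <= c0 ^+ 2 by rewrite ler_sqr ?nnegrE//; case/andP: hq.
rewrite qy /huber; have := huber'_var y hq; set p := huber' y => h.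
have h2 : q ^+ 2 / (2 * lam) <= c0 ^+ 2 / (2 * lam).
  by rewrite ler_pM2r// invr_gt0 mulr_gt0.
suff : q * y - q ^+ 2 / (2 * lam) <= p * y - p ^+ 2 / (2 * lam) by move: h2; lra.
rewrite -subr_ge0.
have -> : p * y - p ^+ 2 / (2 * lam) - (q * y - q ^+ 2 / (2 * lam)) =
   (2 * lam)^-1 * ((q - p) ^+ 2 + 2 * - ((q - p) * (lam * y - p))).
  by field; rewrite gt_eqF.
by rewrite mulr_ge0 ?invr_ge0 ?addr_ge0 ?sqr_ge0 ?mulr_ge0 ?oppr_ge0// ltW.
Qed.

End Huber.

(** * Bounded Lagrange multipliers from an exact penalty *)

Section Duality.
Context d (T : measurableType d) (R : realType).
Variable m : {finite_measure set T -> \bar R}.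
(** [Q c y] stands for an admissible point of cost [c] with constraint residual [y], [v] for the
    optimal value at residual 0, and [c0] for the penalty constant. *)
Variables (E : finType) (Q : R -> (E -> T -> R) -> Prop) (v c0 : R).
Hypothesis c00 : 0 <= c0.
Hypothesis Qbd : forall c y, Q c y ->
  forall e, measurable_fun setT (y e) /\ forall x, `|y e x| <= 1.
Hypothesis Qcvx : forall c y c' y' t, Q c y -> Q c' y' -> 0 <= t <= 1 ->
  Q ((1 - t) * c + t * c') (fun e x => (1 - t) * y e x + t * y' e x).
Hypothesis Qne : exists c y, Q c y.
Hypothesis Qpen : forall c y, Q c y ->
  v <= c + c0 * \sum_e II m (fun x => Num.max 0 (y e x)).

Let bQ c y e : Q c y -> bm (y e).
Proof. by move=> /Qbd /(_ e)[my hy]; split => //; exists 1. Qed.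

Let Mt := \sum_(e : E) II m (fun _ => 1).
Let M0 : 0 <= Mt.
Proof. by apply: sumr_ge0 => e _; exact: II_ge0. Qed.

Let bh' lam (b : T -> R) : 0 < lam -> bm b -> bm (fun x => huber' lam c0 (b x)).
Proof.
move=> l0 hb; apply: (@bm_bnd _ _ _ _ c0); last by move=> x; exact: huber'_itv.
apply: measurable_minr => //; apply: measurable_maxr => //.
by apply: measurable_funM => //; exact: bm_meas.
Qed.

Let bh lam (b : T -> R) : 0 < lam -> bm b -> bm (fun x => huber lam c0 (b x)).
Proof.
move=> l0 hb; apply: bmB; first by apply: bmM => //; exact: bh'.
by apply: bmM; [apply: bmM; exact: bh'|exact: bm_cst].
Qed.

Let Phi lam (c : R) (y : E -> T -> R) := c + \sum_e II m (fun x => huber lam c0 (y e x)).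

Let Phi_lower lam c y : 0 < lam -> Q c y -> v - c0 ^+ 2 / (2 * lam) * Mt <= Phi lam c y.
Proof.
move=> l0 Qy; have := Qpen Qy.
suff : c0 * (\sum_e II m (fun x => Num.max 0 (y e x))) - c0 ^+ 2 / (2 * lam) * Mt <=
  \sum_e II m (fun x => huber lam c0 (y e x)) by rewrite /Phi; lra.
rewrite /Mt !mulr_sumr -sumrB; apply: ler_sum => e _.
have bm0 : bm (fun x => Num.max 0 (y e x)).
  by apply: bm_max; [exact: bm_cst|exact: bQ Qy].
rewrite -IIZ; last exact: L1_fin.
rewrite -IIZ; last by apply: L1_fin; exact: bm_cst.
rewrite -IIB; last 2 first.
- by apply: L1Z; exact: L1_fin.
- by apply: L1Z; apply: L1_fin; exact: bm_cst.
apply: le_II.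
- by apply: L1B; apply: L1Z; apply: L1_fin => //; exact: bm_cst.
- by apply: L1_fin; apply: bh => //; exact: bQ Qy.
- by move=> x; rewrite mulr1; exact: huber_lower.
Qed.

(** [K / lam] covers the smoothing error of [huber_lower] and the error [lam^-1] of the approximate
    first-order condition. *)
Let K := c0 ^+ 2 * Mt + 1.

(** First-order condition at a near-minimiser: moving a fraction [t] towards a competitor lowers
    [Phi lam] by at most [t ^+ 2], while [huber_upper] bounds the change by [t] times the linearised
    difference plus [2 * lam * t ^+ 2 * Mt]. Dividing by [t] leaves the error
    [t * (1 + 2 * lam * Mt)]. *)
Let approx lam : 1 <= lam -> exists p : E -> T -> R,
  (forall e, measurable_fun setT (p e) /\ forall x, 0 <= p e x <= c0) /\
  forall c y, Q c y -> v - K / lam <= c + \sum_e II m (fun x => p e x * y e x).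
Proof.
move=> lam1; have lam0 : 0 < lam by exact: lt_le_trans lam1.
(* The step size for which the error of the first-order condition is exactly [lam^-1]. *)
pose t := (lam * (1 + 2 * lam * Mt))^-1.
have d1 : 1 <= 1 + 2 * lam * Mt by rewrite lerDl !mulr_ge0// ltW.
have d0 : 1 <= lam * (1 + 2 * lam * Mt) by rewrite mulr_ege1.
have t0 : 0 < t by rewrite invr_gt0; exact: lt_le_trans d0.
have t1 : t <= 1 by rewrite invf_le1//; exact: lt_le_trans d0.
pose S := [set z | exists c y, Q c y /\ z = Phi lam c y].
have hS : has_inf S.
  split; first by have [c [y Qy]] := Qne; exists (Phi lam c y), c, y.
  by exists (v - c0 ^+ 2 / (2 * lam) * Mt) => _ [c [y [Qy ->]]]; exact: Phi_lower.
have t20 : 0 < t ^+ 2 by rewrite exprn_gt0.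
have [_ [c [y [Qy ->]]] hcy] := inf_adherent t20 hS.
have by_ e : bm (y e) by exact: bQ Qy.
exists (fun e x => huber' lam c0 (y e x)); split.
  by move=> e; split; [exact: bm_meas (bh' lam0 _)|move=> x; exact: huber'_itv].
move=> c' y' Qy'; have by' e : bm (y' e) by exact: bQ Qy'.
pose ct := (1 - t) * c + t * c'.
pose yt e x := (1 - t) * y e x + t * y' e x.
have Qt : Q ct yt by apply: Qcvx => //; rewrite ltW.
have byt e : bm (yt e) by exact: bQ Qt.
have near : Phi lam c y - t ^+ 2 <= Phi lam ct yt.
  have : inf S <= Phi lam ct yt by apply: ge_inf; [exact: hS.2|exists ct, yt].
  lra.
have up : \sum_e II m (fun x => huber lam c0 (yt e x)) <=
  \sum_e II m (fun x => huber lam c0 (y e x)) +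
  t * (\sum_e II m (fun x => huber' lam c0 (y e x) * y' e x) -
       \sum_e II m (fun x => huber' lam c0 (y e x) * y e x)) + 2 * lam * t ^+ 2 * Mt.
  rewrite -sumrB /Mt !mulr_sumr -!big_split/=; apply: ler_sum => e _.
  have b1 : bm (fun x => huber' lam c0 (y e x)) by exact: bh'.
  have b2 : bm (fun x => huber lam c0 (y e x)) by exact: bh.
  have b3 : bm (fun x => huber' lam c0 (y e x) * y' e x) by exact: bmM.
  have b4 : bm (fun x => huber' lam c0 (y e x) * y e x) by exact: bmM.
  have b5 : bm (fun _ : T => 1 : R) by exact: bm_cst.
  rewrite -IIB; [|exact: L1_fin..].
  rewrite -IIZ; last by apply: L1B; exact: L1_fin.
  rewrite -IIZ; last exact: L1_fin.
  rewrite -IID; [|exact: L1_fin|by apply: L1Z; apply: L1B; exact: L1_fin].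
  rewrite -IID; last 2 first.
  - by apply: L1D; [exact: L1_fin|apply: L1Z; apply: L1B; exact: L1_fin].
  - by apply: L1Z; exact: L1_fin.
  apply: le_II.
  - by apply: L1_fin; exact: bh.
  - apply: L1D; [|by apply: L1Z; exact: L1_fin].
    by apply: L1D; [exact: L1_fin|apply: L1Z; apply: L1B; exact: L1_fin].
  - move=> x; apply: le_trans (huber_upper lam0 c00 (y e x) (yt e x)) _.
    have -> : yt e x - y e x = t * (y' e x - y e x) by rewrite /yt; ring.
    rewrite exprMn mulr1.
    have [_ /(_ x)] := Qbd Qy e; have [_ /(_ x)] := Qbd Qy' e.
    rewrite !ler_norml => /andP[h1 h2] /andP[h3 h4].
    have h5 : (y' e x - y e x) ^+ 2 <= 2 ^+ 2.
      set D := _ - _; have D1 : D <= 2 by rewrite /D; lra.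
      have D2 : - 2 <= D by rewrite /D; lra.
      by rewrite -subr_ge0 subr_sqr mulr_ge0//; lra.
    have h6 : t ^+ 2 * (y' e x - y e x) ^+ 2 <= t ^+ 2 * 2 ^+ 2 by rewrite ler_wpM2l// ltW.
    have : lam * (t ^+ 2 * (y' e x - y e x) ^+ 2) <= lam * (t ^+ 2 * 2 ^+ 2) by rewrite ler_pM2l.
    lra.
have lo : v - c0 ^+ 2 / (2 * lam) * Mt <= c + \sum_e II m (fun x => huber' lam c0 (y e x) * y e x).
  apply: le_trans (Phi_lower lam0 Qy) _; rewrite lerD2l; apply: ler_sum => e _; apply: le_II.
  - by apply: L1_fin; exact: bh.
  - by apply: L1_fin; apply: bmM => //; exact: bh'.
  - by move=> x; exact: huber_le.
move: near up; rewrite /Phi /ct.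
set s0 := \sum_e II m _; set s1 := \sum_e II m _.
set s3 := \sum_e II m _; set s4 := \sum_e II m _ => near up.
have key : - (t * (1 + 2 * lam * Mt)) <= (c' - c) + (s3 - s4).
  rewrite -(ler_pM2l t0); move: near up; nra.
have tE : t * (1 + 2 * lam * Mt) = lam^-1.
  by rewrite /t invfM divfK// gt_eqF// (lt_le_trans _ d1).
have KE : K / lam = 2 * (c0 ^+ 2 / (2 * lam) * Mt) + lam^-1.
  by rewrite /K; field; rewrite gt_eqF.
have : 0 <= c0 ^+ 2 / (2 * lam) * Mt by rewrite mulr_ge0// divr_ge0 ?sqr_ge0// mulr_ge0// ltW.
move: lo; rewrite -/s4; move: key; rewrite tE KE; lra.
Qed.

(* At a near-minimiser of the penalty smoothed by [huber], the derivative of the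
   penalty is a near-optimal multiplier; these converge as [lam] grows. *)
Lemma duality : exists p : E -> T -> R,
  (forall e, measurable_fun setT (p e) /\ forall x, 0 <= p e x <= c0) /\
  forall c y, Q c y -> v <= c + \sum_e II m (fun x => p e x * y e x).
Proof.
(* The approximate multipliers themselves need not converge. Those with error at most [K / n.+1%:R]
   form nested nonempty convex sets, to which [nested_convex_cvg] applies. *)
pose P (n : nat) (p : E -> T -> R) :=
  (forall e, measurable_fun setT (p e) /\ forall x, 0 <= p e x <= c0) /\
  forall c y, Q c y -> v - K / n.+1%:R <= c + \sum_e II m (fun x => p e x * y e x).
have K0 : 0 <= K by rewrite /K addr_ge0// mulr_ge0// sqr_ge0.
have bP n p e : P n p -> bm (p e) by move=> [/(_ e)[mp hp] _]; exact: bm_bnd mp hp.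
have [F [A [f [PF mA mA0 [mf cv z]]]]] : exists (F : nat -> E -> T -> R) (A : set T) (f : E -> T -> R),
  [/\ forall n, P n (F n), measurable A, m (~` A) = 0%E &
    [/\ forall j, j \in enum E -> measurable_fun setT (f j),
      forall x, A x -> forall j, j \in enum E -> F ^~ j ^~ x @ \oo --> f j x &
      forall x, ~ A x -> forall j, f j x = 0]].
  apply: (@nested_convex_cvg _ _ _ m E (enum E) P c0).
  - move=> n p [hp1 hp2]; split => // c y /hp2; apply: le_trans.
    by rewrite lerD2l lerN2 ler_wpM2l// lef_pV2 ?posrE// ler_nat.
  - move=> n f g Pf Pg; have [f1 f2] := Pf; have [g1 g2] := Pg; split.
      move=> e; have [mf hf] := f1 e; have [mg hg] := g1 e; split.
        by apply: measurable_funD; apply: measurable_funM.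
      by move=> x; have := hf x; have := hg x; lra.
    move=> c y Qy; have := f2 _ _ Qy; have := g2 _ _ Qy; set k := K / _.
    suff -> : \sum_e II m (fun x => (2^-1 * f e x + 2^-1 * g e x) * y e x) =
       2^-1 * (\sum_e II m (fun x => f e x * y e x)) + 2^-1 * (\sum_e II m (fun x => g e x * y e x)) by lra.
    rewrite !mulr_sumr -big_split/=; apply: eq_bigr => e _.
    have i1 : L1 m (fun x => f e x * y e x).
      by apply: L1_fin; apply: bmM; [exact: bP Pf|exact: bQ Qy].
    have i2 : L1 m (fun x => g e x * y e x).
      by apply: L1_fin; apply: bmM; [exact: bP Pg|exact: bQ Qy].
    rewrite -!IIZ// -IID; [|exact: L1Z..].
    by apply: eq_II => x; ring.
  - move=> n; have [|p hp] := @approx n.+1%:R; first by rewrite ler1n.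
    by exists p.
  - by move=> n p [hp _] e; exact: hp.
have fb e x : 0 <= f e x <= c0.
  have [Ax|/z->] := pselect (A x); last by rewrite lexx.
  have h := cv x Ax e (mem_enum _ _).
  rewrite -(cvg_lim (@Rhausdorff R) h); apply/andP; split.
    apply: limr_ge; first by apply/cvg_ex; exists (f e x).
    by apply: nearW => n; have [/(_ e)[_ /(_ x)/andP[]]] := PF n.
  apply: limr_le; first by apply/cvg_ex; exists (f e x).
  by apply: nearW => n; have [/(_ e)[_ /(_ x)/andP[]]] := PF n.
exists f; split; first by move=> e; split => //; apply: mf; rewrite mem_enum.
move=> c y Qy.
have aeA : {ae m, forall x, A x}.
  exists (~` A); split => //; exact: measurableC.
have cvI : (c + \sum_e II m (fun x => F n e x * y e x)) + K * n.+1%:R^-1 @[n --> \oo] -->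
    (c + \sum_e II m (fun x => f e x * y e x)) + K * 0.
  apply: cvgD; last by apply: cvgM; [exact: cvg_cst|exact: cvg_harmonic].
  apply: cvgD; first exact: cvg_cst.
  apply: cvg_sumr => e _; apply: (@II_cvg _ _ _ _ _ _ (fun=> c0)).
  - by move=> n; apply: bm_meas; apply: bmM; [exact: bP (PF n)|exact: bQ Qy].
  - apply: bm_meas; apply: bmM; last exact: bQ Qy.
    by apply: bm_bnd (fb e); apply: mf; rewrite mem_enum.
  - by apply: L1_fin; exact: bm_cst.
  - apply: filterS aeA => x Ax; apply: cvgM; last exact: cvg_cst.
    by apply: cv => //; rewrite mem_enum.
  - move=> n x; have [/(_ e)[_ /(_ x)/andP[h1 h2]] _] := PF n.
    have [_ /(_ x) h3] := Qbd Qy e.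
    by rewrite normrM ger0_norm// -[leRHS]mulr1 ler_pM.
rewrite mulr0 addr0 in cvI; rewrite -(cvg_lim (@Rhausdorff R) cvI).
apply: limr_ge; first by apply/cvg_ex; eexists; exact: cvI.
apply: nearW => n; have [_ /(_ _ _ Qy)] := PF n.
by rewrite lerBlDr.
Qed.

End Duality.

(** * Walks, loads and flow decomposition *)

Section Paths.
Context (R : realType) (E : finType) (T : E -> R -> R).
Implicit Types (b q : E -> R -> R) (w : seq E).

Fixpoint pathsum b w t : R :=
  if w is e :: w' then b e t + pathsum b w' (T e t) else 0.
Fixpoint pathprod q w t : R :=
  if w is e :: w' then q e t * pathprod q w' (T e t) else 1.
Fixpoint pathend w t : R := if w is e :: w' then pathend w' (T e t) else t.

Hypothesis mT : forall e, measurable_fun setT (T e).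

Lemma bm_pathsum b w : (forall e, bm (b e)) -> bm (pathsum b w).
Proof.
move=> hb; elim: w => [|e w IH] /=; first exact: bm_cst.
by apply: bmD => //; apply: (bm_comp IH).
Qed.

Lemma bm_pathprod q w : (forall e, bm (q e)) -> bm (pathprod q w).
Proof.
move=> hb; elim: w => [|e w IH] /=; first exact: bm_cst.
by apply: bmM => //; apply: (bm_comp IH).
Qed.

Lemma pathprod_ge0 q w t : (forall e t, 0 <= q e t) -> 0 <= pathprod q w t.
Proof. by move=> q0; elim: w t => [|e w IH] t //=; rewrite mulr_ge0. Qed.

Lemma pathsum_ge0 b w t : (forall e t, 0 <= b e t) -> 0 <= pathsum b w t.
Proof. by move=> q0; elim: w t => [|e w IH] t //=; rewrite addr_ge0. Qed.

Lemma pathsum_le b1 b2 w t : (forall e t, b1 e t <= b2 e t) -> pathsum b1 w t <= pathsum b2 w t.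
Proof. by move=> h; elim: w t => [|e w IH] t //=; rewrite lerD. Qed.

Lemma pathsum_cst (c : R) w t : pathsum (fun _ _ => c) w t = (size w)%:R * c.
Proof. by elim: w t => [|e w IH] t /=; rewrite ?mul0r// IH -natr1; ring. Qed.

Lemma pathsumD b1 b2 w t :
  pathsum (fun e x => b1 e x + b2 e x) w t = pathsum b1 w t + pathsum b2 w t.
Proof. by elim: w t => [|e w IH] t /=; rewrite ?addr0// IH; ring. Qed.

Lemma pathsumZ (c : R) b w t : pathsum (fun e x => c * b e x) w t = c * pathsum b w t.
Proof. by elim: w t => [|e w IH] t /=; rewrite ?mulr0// IH; ring. Qed.

Lemma pathend_pathsum w t : pathend w t = t + pathsum (fun e x => T e x - x) w t.
Proof. by elim: w t => [|e w IH] t /=; rewrite ?addr0// IH; ring. Qed.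

End Paths.

(** * Decomposition of a conserved flow into walks *)

Section Decomposition.
Context (R : realType) (V E : finType) (tail head : E -> V).
Local Notation mu := (@lebesgue_measure R).
Variables (s d : V) (T : E -> R -> R) (tau T0 : R) (z : E -> R -> R) (rho : R -> R).

Fixpoint walks (K : nat) (v : V) : seq (seq E) :=
  (if v == d then [:: [::]] else [::]) ++
  (if K is K'.+1 then
     flatten [seq [seq e :: w | w <- walks K' (head e)] | e <- enum E & tail e == v]
   else [::]).

Lemma sum_walksS (K : nat) (v : V) (G : seq E -> R) :
  \sum_(w <- walks K.+1 v) G w =
  (v == d)%:R * G [::] + \sum_(e | tail e == v) \sum_(w <- walks K (head e)) G (e :: w).
Proof.
rewrite [walks K.+1 v]/= big_cat/=; congr (_ + _).
  by case: eqP => _; rewrite ?big_seq1 ?big_nil ?mul1r ?mul0r.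
rewrite big_flatten/= big_map big_filter big_enum_cond/=.
by apply: eq_big => [//|e _]; rewrite big_map.
Qed.

Lemma sum_walks0 (v : V) (G : seq E -> R) :
  \sum_(w <- walks 0 v) G w = (v == d)%:R * G [::].
Proof.
by rewrite /= cats0; case: eqP => _; rewrite ?big_seq1 ?big_nil ?mul1r ?mul0r.
Qed.

(* The share of [e] in the flow leaving its tail; 0 when that flow vanishes, as then [z e t / 0 = 0]. *)
Definition split (e : E) (t : R) : R := z e t / \sum_(e' | tail e' == tail e) z e' t.
Local Notation q := split.

(** With the shares [q] as transition probabilities and share 0 on edges leaving [d], this is the
    probability that a particle leaving [v] at time [t] reaches [d] within [K] edges; [reachsum] is
    the expected total of [b] on that event. *)
Definition reach K v t := \sum_(w <- walks K v) pathprod T q w t.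
Definition reachsum b K v t := \sum_(w <- walks K v) pathprod T q w t * pathsum T b w t.

Hypothesis tau0 : 0 < tau.
Hypothesis mT : forall e, measurable_fun setT (T e).
Hypothesis zL : forall e, L1 mu (z e).
Hypothesis z0 : forall e t, 0 <= z e t.
Hypothesis zs : forall e t, z e t != 0 -> 0 <= t <= T0.
Hypothesis hT : forall e t, z e t != 0 -> t + tau <= T e t.
Hypothesis zd : forall e t, tail e = d -> z e t = 0.
Hypothesis rhoL : L1 mu rho.
Hypothesis rho0 : forall t, 0 <= rho t.
(** Weak form of flow conservation: it needs no density for the flow out of an edge, and test
    functions vanishing at [d] leave the arrivals there free. *)
Hypothesis WC : forall beta : V -> R -> R, (forall v, bm (beta v)) -> (forall t, beta d t = 0) ->
  \sum_e II mu (fun t => z e t * beta (tail e) t) =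
  II mu (fun t => rho t * beta s t) + \sum_e II mu (fun t => z e t * beta (head e) (T e t)).

Lemma split_ge0 e t : 0 <= q e t.
Proof. by rewrite divr_ge0// sumr_ge0. Qed.

Lemma sum_split_le1 v t : \sum_(e | tail e == v) q e t <= 1.
Proof.
rewrite /split; under eq_bigr => e /eqP -> do over.
rewrite -mulr_suml; have [->|h] := eqVneq (\sum_(e | tail e == v) z e t) 0.
  by rewrite mul0r.
by rewrite divff.
Qed.

Lemma split_le1 e t : q e t <= 1.
Proof.
apply: le_trans (sum_split_le1 (tail e) t); rewrite (bigD1 e)//= lerDl sumr_ge0// => e' _.
exact: split_ge0.
Qed.

Lemma mul_split e t : (\sum_(e' | tail e' == tail e) z e' t) * q e t = z e t.
Proof.
rewrite /split mulrC; have [h|h] := eqVneq (\sum_(e' | tail e' == tail e) z e' t) 0.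
  rewrite h mulr0; apply/esym/eqP; rewrite eq_le z0 andbT -h (bigD1 e)//= lerDl.
  by rewrite sumr_ge0.
by rewrite divfK.
Qed.

Lemma split_neq0 e t : q e t != 0 -> z e t != 0.
Proof. by apply: contra_neq => h; rewrite /split h mul0r. Qed.

Lemma bm_split e : bm (q e).
Proof.
apply: (@bm_bnd _ _ _ _ 1); last by move=> t; rewrite split_ge0 split_le1.
have mz e' : measurable_fun setT (z e') by exact: L1_meas (zL e').
have mS : measurable_fun setT (fun t => \sum_(e' | tail e' == tail e) z e' t).
  by apply: (@L1_meas _ _ _ mu); apply: L1_sum => e' _; exact: zL.
(* Inversion of a nonnegative number is written as the power -1, which is a measurable function. *)
rewrite (_ : split e = fun t => z e t * (\sum_(e' | tail e' == tail e) z e' t) `^ (-1)).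
  apply: measurable_funM => //; exact: (measurableT_comp (measurable_powR (-1 : R)) mS).
by apply/funext => t; rewrite powR_inv1// sumr_ge0.
Qed.

(** Pooling the flow at each tail and dividing it again by the shares gives back [z]. *)
Lemma sum_z_split (Y : E -> R) t :
  \sum_e z e t * (\sum_(e' | tail e' == tail e) q e' t * Y e') = \sum_e z e t * Y e.
Proof.
under eq_bigr do rewrite mulr_sumr.
rewrite (exchange_big_dep predT)//=; apply: eq_bigr => e' _.
under eq_bigr do rewrite mulrA.
rewrite -mulr_suml -mulr_suml; congr (_ * _); rewrite -[RHS]mul_split; congr (_ * _).
by apply: eq_bigl => e; rewrite eq_sym.
Qed.

Lemma bm_reach K v : bm (reach K v).
Proof. by apply: bm_sum => w _; apply: bm_pathprod => //; exact: bm_split. Qed.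

Lemma bm_reachsum b K v : (forall e, bm (b e)) -> bm (reachsum b K v).
Proof.
move=> hb; apply: bm_sum => w _; apply: bmM; last exact: bm_pathsum.
by apply: bm_pathprod => //; exact: bm_split.
Qed.

Lemma reachS K v t : reach K.+1 v t =
  (v == d)%:R + \sum_(e | tail e == v) q e t * reach K (head e) (T e t).
Proof.
rewrite /reach sum_walksS/= mulr1; congr (_ + _); apply: eq_bigr => e _.
by rewrite mulr_sumr.
Qed.

Lemma reachsumS b K v t : reachsum b K.+1 v t =
  \sum_(e | tail e == v) q e t * (b e t * reach K (head e) (T e t) + reachsum b K (head e) (T e t)).
Proof.
rewrite /reachsum /reach sum_walksS/= mulr0 mulr0 add0r; apply: eq_bigr => e _.
rewrite mulrDr !mulr_sumr -big_split/=; apply: eq_bigr => w _; ring.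
Qed.

Lemma split_d e t : tail e = d -> q e t = 0.
Proof. by move=> h; rewrite /split zd// mul0r. Qed.

Lemma reach_d K t : reach K d t = 1.
Proof.
case: K => [|K]; first by rewrite /reach sum_walks0 eqxx mul1r.
rewrite reachS eqxx big1 ?addr0// => e /eqP h; by rewrite split_d// mul0r.
Qed.

Lemma reachsum_d b K t : reachsum b K d t = 0.
Proof.
case: K => [|K]; first by rewrite /reachsum sum_walks0 /= mulr0 mulr0.
rewrite reachsumS big1// => e /eqP h; by rewrite split_d// mul0r.
Qed.

Lemma reach_ge0 K v t : 0 <= reach K v t.
Proof. by apply: sumr_ge0 => w _; apply: pathprod_ge0; exact: split_ge0. Qed.

Lemma reach_le1 K v t : reach K v t <= 1.
Proof.
elim: K v t => [|K IH] v t; first by rewrite /reach sum_walks0/= mulr1; case: eqP.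
rewrite reachS; have [->|vd] := eqVneq v d.
  by rewrite big1 ?addr0// => e /eqP h; rewrite split_d// mul0r.
rewrite add0r; apply: le_trans (sum_split_le1 v t); apply: ler_sum => e _.
by rewrite ler_piMr// split_ge0.
Qed.

Lemma reach_mono K v t : reach K v t <= reach K.+1 v t.
Proof.
elim: K v t => [|K IH] v t.
  by rewrite reachS /reach sum_walks0/= mulr1 lerDl sumr_ge0// => e _;
     rewrite mulr_ge0 ?split_ge0// sumr_ge0// => w _; apply: pathprod_ge0; exact: split_ge0.
rewrite [leLHS]reachS [leRHS]reachS lerD2l; apply: ler_sum => e _.
by rewrite ler_wpM2l ?split_ge0.
Qed.

Let miss K (c : R) := \sum_e II mu (fun t => z e t * ((1 - reach K (tail e) t) * (c <= t)%R%:R)).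

Let bm_ge (c : R) : bm (fun t : R => (c <= t)%R%:R : R).
Proof.
rewrite (_ : (fun _ => _) = fun t => \1_(`[c, +oo[%classic) t); first exact: bm_indic.
by apply/funext => t; rewrite indicE mem_setE/= in_itv/= andbT.
Qed.

Let bm_miss K v (c : R) : bm (fun t => (1 - reach K v t) * (c <= t)%R%:R).
Proof. by apply: bmM => //; apply: bmB; [exact: bm_cst|exact: bm_reach]. Qed.

Let z_reachS K e t : z e t * reach K.+1 (tail e) t =
  z e t * \sum_(e' | tail e' == tail e) q e' t * reach K (head e') (T e' t).
Proof.
rewrite reachS; case: eqP => [/zd ->|_]; first by rewrite !mul0r.
by rewrite add0r.
Qed.

(** [miss K c] is the flow departing at time [c] or later that fails to reach [d] within [K] edges.
    Expanding [reach K.+1] along its first edge moves the failing flow to the heads, at least [tau]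
    later; by conservation, what arrives at the heads is part of what departs from the tails. *)
Let missS K (c : R) : miss K.+1 c <= miss K (c + tau).
Proof.
pose beta v t := (1 - reach K v t) * (c + tau <= t)%R%:R.
have bb v : bm (beta v) by exact: bm_miss.
have bT e : bm (fun t => beta (head e) (T e t)) by exact: bm_comp.
have := WC bb; rewrite [leRHS]/miss /beta => -> //; last first.
  by move=> t; rewrite reach_d subrr mul0r.
rewrite -[leLHS]add0r; apply: lerD.
  apply: II_ge0 => t; rewrite !mulr_ge0// subr_ge0; exact: reach_le1.
have bR e : bm (fun t => reach K (head e) (T e t)) by apply: bm_comp => //; exact: bm_reach.
have b1 e : bm (fun t => (1 - reach K (head e) (T e t)) * (c <= t)%R%:R).
  by apply: bmM => //; apply: bmB => //; exact: bm_cst.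
apply: (@le_trans _ _ (\sum_e II mu (fun t => z e t * ((1 - reach K (head e) (T e t)) * (c <= t)%R%:R)))).
  have i1 e : L1 mu (fun t => z e t * ((1 - reach K.+1 (tail e) t) * (c <= t)%R%:R)).
    by apply: L1M => //; exact: bm_miss.
  have i2 e : L1 mu (fun t => z e t * ((1 - reach K (head e) (T e t)) * (c <= t)%R%:R)).
    by apply: L1M => //; exact: b1.
  rewrite /miss -!II_sum; [|by move=> e _; exact: i2|by move=> e _; exact: i1].
  apply: le_II; [by apply: L1_sum => e _; exact: i1|by apply: L1_sum => e _; exact: i2|] => t.
  under eq_bigr do rewrite mulrA mulrBr mulr1 z_reachS.
  under [leRHS]eq_bigr do rewrite mulrA mulrBr mulr1.
  by rewrite -!mulr_suml !sumrB sum_z_split.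
apply: ler_sum => e _; apply: le_II.
- by apply: L1M => //; exact: b1.
- by apply: L1M => //; exact: bT.
move=> t.
have [->|ze] := eqVneq (z e t) 0; first by rewrite !mul0r.
rewrite ler_wpM2l// ler_wpM2l ?subr_ge0 ?reach_le1//.
case: (leP c t) => ct; last by rewrite ler0n.
by rewrite (le_trans _ (hT ze))// lerD2r.
Qed.

(** After [K] uses of [missS] the cut-off time has passed [T0], beyond which [z] vanishes. *)
Lemma reach_ae1 K : T0 < K%:R * tau ->
  \sum_e II mu (fun t => z e t * (1 - reach K (tail e) t)) = 0.
Proof.
move=> hK.
have H n (c : R) : miss n c <= miss 0 (c + n%:R * tau).
  elim: n c => [|n IH] c; first by rewrite mul0r addr0.
  apply: le_trans (missS _ _) (le_trans (IH _) _).
  by rewrite -addrA -natr1 mulrDl mul1r [tau + _]addrC.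
apply/eqP; rewrite eq_le; apply/andP; split; last first.
  apply: sumr_ge0 => e _; apply: II_ge0 => t; rewrite mulr_ge0// subr_ge0.
  exact: reach_le1.
have -> : \sum_e II mu (fun t => z e t * (1 - reach K (tail e) t)) = miss K 0.
  apply: eq_bigr => e _; apply: eq_II => t.
  have [->|/zs/andP[-> _]] := eqVneq (z e t) 0; first by rewrite !mul0r.
  by rewrite mulr1.
apply: le_trans (H _ _) _; rewrite /miss big1// => e _.
rewrite -[RHS](II0 mu); apply: eq_II => t.
have [->|/zs/andP[_ h]] := eqVneq (z e t) 0; first by rewrite !mul0r.
by rewrite leNgt add0r (le_lt_trans h hK)/= !mulr0.
Qed.

(** Conservation for the test function [1 - reach K] has left side 0 by [reach_ae1], so the
    nonnegative terms on the right all vanish. *)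
Lemma reach_source_head K : T0 < K%:R * tau ->
  II mu (fun t => rho t * (1 - reach K s t)) = 0 /\
  forall e, II mu (fun t => z e t * (1 - reach K (head e) (T e t))) = 0.
Proof.
move=> hK.
have n0 K' v t : 0 <= 1 - reach K' v t by rewrite subr_ge0 reach_le1.
have bb v : bm (fun t => 1 - reach K v t) by apply: bmB; [exact: bm_cst|exact: bm_reach].
have bd t : 1 - reach K d t = 0 by rewrite reach_d subrr.
have /esym/eqP := WC bb bd; rewrite (reach_ae1 hK) paddr_eq0; last 2 first.
- by apply: II_ge0 => t; rewrite mulr_ge0.
- by apply: sumr_ge0 => e _; apply: II_ge0 => t; rewrite mulr_ge0.
move=> /andP[/eqP h1 h2]; split => // e; move: h2; rewrite psumr_eq0; last first.
  by move=> e' _; apply: II_ge0 => t; rewrite mulr_ge0.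
by move=> /allP/(_ e (mem_index_enum _))/implyP/(_ isT)/eqP.
Qed.

(** Only walks with exactly [K.+1] edges are new. Their total weight is
    [reach K.+1 v t - reach K v t], and each collects at most [K.+1%:R * C]. *)
Let reachsum_step b C K v t : (forall e t, `|b e t| <= C) ->
  `|reachsum b K.+1 v t - reachsum b K v t| <= K.+1%:R * C * (reach K.+1 v t - reach K v t).
Proof.
move=> hC; elim: K v t => [|K IH] v t.
  rewrite [reachsum b 0 v t]/reachsum sum_walks0 /= !mulr0 subr0 mul1r.
  rewrite reachS reachsumS [reach 0 v t]/reach sum_walks0/= mulr1 addrAC subrr add0r.
  rewrite mulr_sumr; apply: le_trans (ler_norm_sum _ _ _) _; apply: ler_sum => e _.
  rewrite [reachsum b 0 _ _]/reachsum sum_walks0 /= !mulr0 addr0.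
  rewrite normrM (ger0_norm (split_ge0 _ _)) normrM (ger0_norm (reach_ge0 _ _ _)).
  by rewrite mulrCA ler_wpM2r // mulr_ge0 ?split_ge0 ?reach_ge0.
rewrite !(reachsumS _ K.+1, reachsumS _ K) !(reachS K.+1, reachS K).
rewrite opprD addrACA subrr add0r.
rewrite -!sumrB mulr_sumr; apply: le_trans (ler_norm_sum _ _ _) _; apply: ler_sum => e _.
rewrite -!mulrBr normrM (ger0_norm (split_ge0 _ _)) mulrCA ler_wpM2l ?split_ge0//.
set x := T e t; have h := IH (head e) x; have h2 := reach_mono K (head e) x.
rewrite opprD addrACA -mulrBr; apply: le_trans (ler_normD _ _) _.
rewrite normrM (ger0_norm (x := reach _ _ _ - _)) ?subr_ge0//.
rewrite -[K.+2%:R]natr1 mulrDl mul1r mulrDl [leRHS]addrC; apply: lerD => //.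
by rewrite ler_wpM2r// subr_ge0.
Qed.

(** Conservation is tested with [reachsum b K.+1]. Expanding it along the first edge yields the
    integral of [b] plus the transported [reachsum], which cancels against the head term, because
    [reachsum] is stationary wherever [reach K] is already 1. The source term remains. *)
Lemma flow_decomposition K b : T0 < K%:R * tau -> (forall e, bm (b e)) ->
  \sum_e II mu (fun t => z e t * b e t) =
  \sum_(w <- walks K.+1 s) II mu (fun t => rho t * pathprod T q w t * pathsum T b w t).
Proof.
move=> hK hb; have [_ hz] := reach_source_head hK.
have bS K' v : bm (reachsum b K' v) by exact: bm_reachsum.
have bR K' e : bm (fun t => reach K' (head e) (T e t)) by apply: bm_comp => //; exact: bm_reach.
have bST K' e : bm (fun t => reachsum b K' (head e) (T e t)) by exact: bm_comp.
have bJ e := bmM (hb e) (bR K e).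
have bJ2 e := bmD (bJ e) (bST K e).
have LJ e := L1M (zL e) (bJ2 e).
have := WC (bS K.+1) (reachsum_d b K.+1).
have -> : \sum_e II mu (fun t => z e t * reachsum b K.+1 (tail e) t) =
   \sum_e II mu (fun t => z e t * (b e t * reach K (head e) (T e t) + reachsum b K (head e) (T e t))).
  rewrite -!II_sum; last 2 first.
  - by move=> e _; exact: LJ.
  - by move=> e _; exact: (L1M (zL e) (bS K.+1 (tail e))).
  apply: eq_II => t; rewrite -[RHS]sum_z_split; apply: eq_bigr => e _; by rewrite reachsumS.
have [C hC] : exists C, forall e t, `|b e t| <= C.
  have [c hc] := choice (fun e => (hb e).2).
  exists (\sum_e `|c e|) => e t; apply: le_trans (hc e t) _.
  by rewrite (bigD1 e)//= (le_trans (ler_norm _))// lerDl sumr_ge0.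
have zR e : {ae mu, forall t, z e t * (1 - reach K (head e) (T e t)) = 0}.
  apply: II_eq0_ae => //.
    by apply: L1M => //; apply: bmB; [exact: bm_cst|exact: bR].
  by move=> t; rewrite mulr_ge0// subr_ge0 reach_le1.
have -> : \sum_e II mu (fun t => z e t * (b e t * reach K (head e) (T e t) + reachsum b K (head e) (T e t)))
  = \sum_e II mu (fun t => z e t * b e t) + \sum_e II mu (fun t => z e t * reachsum b K.+1 (head e) (T e t)).
  rewrite -big_split/=; apply: eq_bigr => e _.
  rewrite -IID; [|exact: (L1M (zL e) (hb e))|exact: (L1M (zL e) (bST _ e))].
  apply: ae_eq_II.
  - exact: LJ.
  - by apply: L1D; [exact: (L1M (zL e) (hb e))|exact: (L1M (zL e) (bST _ e))].
  move: (zR e); apply: ae_mp => t /eqP; rewrite mulf_eq0 => /orP[/eqP ->|]; first by rewrite !mul0r addr0.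
  rewrite subr_eq0 => /eqP h; rewrite -h mulr1 mulrDr; congr (_ + _ * _).
  have := reachsum_step K (head e) (T e t) hC.
  have := reach_mono K (head e) (T e t); rewrite -h => h1.
  have -> : reach K.+1 (head e) (T e t) = 1 by apply/eqP; rewrite eq_le h1 reach_le1.
  by rewrite subrr mulr0 normr_le0 subr_eq0 => /eqP.
move=> /addIr ->.
rewrite -II_sum; last first.
  move=> w _; apply: L1M; last exact: bm_pathsum.
  by apply: L1M => //; apply: bm_pathprod => //; exact: bm_split.
apply: eq_II => t; rewrite /reachsum mulr_sumr; apply: eq_bigr => w _.
by rewrite mulrA.
Qed.

End Decomposition.

Section WalkFacts.
Context (R : realType) (V E : finType) (tail head : E -> V).
Variables (d : V).
Local Notation walks := (walks tail head d).

Lemma mem_walks K v w :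
  (w \in walks K v) = is_walk_from tail head v d w && (size w <= K)%N.
Proof.
elim: K v w => [|K IH] v w.
  rewrite /= cats0 leqn0; case: w => [|e w] /=; last by rewrite andbF; case: eqP.
  by case: eqP.
rewrite [walks K.+1 v]/= mem_cat; case: w => [|e w] /=.
  rewrite andbT; case: eqP => //= _; apply/negP => /flattenP[_ /mapP[e _ ->]] /mapP[w _].
  by [].
rewrite ltnS -andbA; rewrite (_ : (_ \in (if _ then _ else _)) = false) ?orFb; last by case: eqP.
apply/flattenP/idP => [[_ /mapP[e' + ->] /mapP[w' hw' [-> ->]]]|/andP[ev h]].
  by rewrite mem_filter => /andP[-> _] /=; rewrite -IH.
exists [seq e :: w0 | w0 <- walks K (head e)].
  by apply/mapP; exists e => //; rewrite mem_filter ev mem_enum.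
by apply/mapP; exists w => //; rewrite IH.
Qed.

Lemma uniq_walks K v : uniq (walks K v).
Proof.
elim: K v => [|K IH] v; first by rewrite /= cats0; case: eqP.
rewrite [walks K.+1 v]/= cat_uniq; apply/and3P; split; first by case: eqP.
  apply/hasPn => w /flattenP[_ /mapP[e _ ->]] /mapP[w' _ ->]; by case: eqP.
set es := [seq e <- enum E | _]; have : uniq es by rewrite filter_uniq// enum_uniq.
elim: es => [//|e es IHes] /= /andP[ees ues].
rewrite cat_uniq map_inj_uniq ?IH; last by move=> ? ? [].
rewrite IHes// andbT /=; apply/hasPn => w /flattenP[_ /mapP[e' e's ->]] /mapP[w' _ ->].
apply/mapP => -[w'' _ [ee' _]]; by rewrite -ee' e's in ees.
Qed.

Lemma pathsum_telescope (T : E -> R -> R) (beta : V -> R -> R) v w t :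
  is_walk_from tail head v d w ->
  pathsum T (fun e x => beta (tail e) x) w t + beta d (pathend T w t) =
  beta v t + pathsum T (fun e x => beta (head e) (T e x)) w t.
Proof.
elim: w v t => [|e w IH] v t /=; first by move=> /eqP ->; rewrite add0r addr0.
by move=> /andP[/eqP <- /IH h]; rewrite -addrA h addrA.
Qed.

End WalkFacts.

Section PathProducts.
Context (R : realType) (E : finType) (T : E -> R -> R).

Lemma pathprod_le1 (q : E -> R -> R) w t : (forall e t, 0 <= q e t <= 1) ->
  0 <= pathprod T q w t <= 1.
Proof.
move=> h; elim: w t => [|e w IH] t /=; first by rewrite ler01 lexx.
by have /andP[h1 h2] := h e t; have /andP[h3 h4] := IH (T e t); rewrite mulr_ge0// mulr_ile1.
Qed.

(** A product of factors in [[0, 1]] is at most each of them: flow thinned along its whole walk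
    loads every edge at most as if it were thinned at that edge alone. *)
Lemma pathprod_pathsum (q b : E -> R -> R) w t : (forall e t, 0 <= q e t <= 1) ->
  (forall e t, 0 <= b e t) ->
  pathprod T q w t * pathsum T b w t <= pathsum T (fun e x => q e x * b e x) w t.
Proof.
move=> hq hb; elim: w t => [|e w IH] t /=; first by rewrite mulr0.
have /andP[q0 q1] := hq e t; have /andP[p0 p1] := pathprod_le1 w (T e t) hq.
have s0 := pathsum_ge0 T w (T e t) hb; have := IH (T e t) => ih.
rewrite mulrDr; apply: lerD.
  by rewrite -mulrA ler_wpM2l// ler_piMl.
apply: le_trans ih; rewrite -mulrA ler_piMl// mulr_ge0//.
Qed.

(** Union bound: what is lost along the walk is at most the sum of the losses at its edges. *)
Lemma one_sub_pathprod (q : E -> R -> R) w t : (forall e t, 0 <= q e t <= 1) ->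
  1 - pathprod T q w t <= pathsum T (fun e x => 1 - q e x) w t.
Proof.
move=> hq; elim: w t => [|e w IH] t /=; first by rewrite subrr.
have /andP[q0 q1] := hq e t; have := pathprod_le1 w (T e t) hq; have := IH (T e t).
by set p := pathprod _ _ _ _; nra.
Qed.

Lemma pathprod_neq0 (q1 q2 : E -> R -> R) w t : (forall e t, q1 e t != 0 -> q2 e t != 0) ->
  pathprod T q1 w t != 0 -> pathprod T q2 w t != 0.
Proof.
move=> h; elim: w t => [|e w IH] t //=.
by rewrite !mulf_eq0 !negb_or => /andP[/h -> /IH].
Qed.

Lemma pathsum_le_size (b : E -> R -> R) (C : R) w t : (forall e t, b e t <= C) ->
  pathsum T b w t <= (size w)%:R * C.
Proof. by move=> h; rewrite -(pathsum_cst T C w t); exact: pathsum_le. Qed.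

(* Indicator that every edge of [w] carries flow when it is reached. *)
Definition alive (u : E -> R -> R) w t := pathprod T (fun e x => (u e x != 0)%:R) w t.

Lemma alive01 u w t : alive u w t = (alive u w t != 0)%:R.
Proof.
rewrite /alive; elim: w t => [|e w IH] t /=; first by rewrite oner_neq0.
rewrite mulf_eq0 negb_or {1}IH.
by case: (u e t != 0); rewrite ?mul1r ?mul0r/= ?oner_neq0 ?eqxx.
Qed.

Lemma eq_pathsum_alive (u b1 b2 : E -> R -> R) w t :
  (forall e t, u e t != 0 -> b1 e t = b2 e t) -> alive u w t != 0 ->
  pathsum T b1 w t = pathsum T b2 w t.
Proof.
move=> h; rewrite /alive; elim: w t => [|e w IH] t //=.
rewrite mulf_eq0 negb_or => /andP[h1 /IH ->]; rewrite h//.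
by move: h1; case: (u e t != 0) => //; rewrite eqxx.
Qed.

Lemma dead_pathsum (u b : E -> R -> R) (M : R) w t : (forall e t, 0 <= b e t) ->
  (forall e t, u e t = 0 -> M <= b e t) -> alive u w t = 0 -> M <= pathsum T b w t.
Proof.
move=> b0 h; rewrite /alive; elim: w t => [|e w IH] t /=; first by move/eqP; rewrite oner_eq0.
move=> /eqP; rewrite mulf_eq0 => /orP[|/eqP /IH h2].
  have [/h h1 _|_] := eqVneq (u e t) 0; last by rewrite oner_eq0.
  by rewrite -[M]addr0 lerD// pathsum_ge0.
by rewrite -[M]add0r lerD.
Qed.

(** Each edge takes at least [tau], but only entry times are known to lie in [[0, T0]]; the last
    edge is therefore not counted. *)
Lemma alive_size (u : E -> R -> R) (tau T0 : R) w t : 0 <= tau ->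
  (forall e t, u e t != 0 -> 0 <= t <= T0) -> (forall e t, u e t != 0 -> t + tau <= T e t) ->
  w != [::] -> alive u w t != 0 -> 0 <= t /\ t + (size w).-1%:R * tau <= T0.
Proof.
move=> tau0 us uT; rewrite /alive; elim: w t => [//|e w IH] t _ /=.
rewrite mulf_eq0 negb_or => /andP[h1 h2].
have ut : u e t != 0 by move: h1; case: (u e t != 0) => //; rewrite eqxx.
have /andP[t0 t1] := us _ _ ut; split => //.
have [w0|wn] := eqVneq w [::]; first by rewrite w0 /= mul0r addr0.
have [_ h3] := IH _ wn h2; apply: le_trans h3; have := uT _ _ ut.
have -> : size w = (size w).-1.+1 by rewrite prednK// lt0n size_eq0.
by rewrite -natr1 mulrDl mul1r /=; lra.
Qed.

End PathProducts.

(** * Loads of weighted walks as measures on the edges *)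

Section Loads.
Context (R : realType) (E : finType) (T : E -> R -> R).
Local Notation mu := (@lebesgue_measure R).
Hypothesis mT : forall e, measurable_fun setT (T e).

Lemma atom_id (h : R -> R) : L1 mu h -> (forall t, 0 <= h t) -> atom_ok mu (h, id : R -> R).
Proof. by move=> h1 h2; apply: And3; [exact: h1|exact: h2|exact: measurable_id]. Qed.

(** Entry times into [e] as functions of the departure time, one for each occurrence of [e] in the
    walk. *)
Fixpoint visits (e : E) (w : seq E) : seq (R -> R) :=
  if w is e' :: w' then
    (if e' == e then [:: id] else [::]) ++ [seq phi \o T e' | phi <- visits e w']
  else [::].

Lemma sum_visits e (b : R -> R) w t :
  \sum_(phi <- visits e w) b (phi t) = pathsum T (fun e' x => (e' == e)%:R * b x) w t.
Proof.
elim: w t => [|e' w IH] t /=; first by rewrite big_nil.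
rewrite big_cat big_map/= IH; congr (_ + _).
by case: eqP => _; rewrite ?big_seq1 ?big_nil ?mul1r ?mul0r.
Qed.

Definition load (hs : seq ((R -> R) * seq E)) (b : E -> R -> R) : R :=
  \sum_(p <- hs) II mu (fun t => p.1 t * pathsum T b p.2 t).

Definition load_atoms (hs : seq ((R -> R) * seq E)) (e : E) :=
  flatten [seq [seq (p.1, phi) | phi <- visits e p.2] | p <- hs].

Definition load_ok (hs : seq ((R -> R) * seq E)) :=
  List.Forall (fun p => L1 mu p.1 /\ forall t, 0 <= p.1 t) hs.

Lemma load_ok_cons p hs : load_ok (p :: hs) -> [/\ L1 mu p.1, forall t, 0 <= p.1 t & load_ok hs].
Proof. by move=> h; inversion h as [|? ? [h1 h2] h3]. Qed.

Lemma load_cons p hs b : load (p :: hs) b = II mu (fun t => p.1 t * pathsum T b p.2 t) + load hs b.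
Proof. by rewrite /load big_cons. Qed.

Lemma forall_cat (A : Type) (P : A -> Prop) (s1 s2 : seq A) :
  List.Forall P s1 -> List.Forall P s2 -> List.Forall P (s1 ++ s2).
Proof. by elim: s1 => [//|a s IH] h hs2; inversion h; constructor => //; exact: IH. Qed.

Lemma forall_flatten (A : Type) (P : A -> Prop) (J : Type) (s : seq J) (F : J -> seq A) :
  (forall j, List.Forall P (F j)) -> List.Forall P (flatten [seq F j | j <- s]).
Proof.
move=> h; elim: s => [|j s IH] /=; first by constructor.
by apply: forall_cat.
Qed.

Lemma load_atoms_ok hs e : load_ok hs -> List.Forall (atom_ok mu) (load_atoms hs e).
Proof.
elim: hs => [|p hs IH] hok; first by constructor.
have [h1 h2 h3] := load_ok_cons hok.
apply: forall_cat; last exact: IH.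
elim: p.2 => [|e' w IHw] /=; first by constructor.
rewrite map_cat; apply: forall_cat.
  case: eqP => _ /=; last by constructor.
  by constructor; [exact: atom_id|constructor].
move: (visits e w) IHw; elim=> [|phi l IHl] h /=; first by constructor.
inversion h as [|? ? [g1 g2 g3] g4]; subst; constructor; last exact: IHl.
by apply: And3; [exact: g1|exact: g2|exact: (measurableT_comp g3 (mT e'))].
Qed.

Lemma atoms_int_load_atoms hs e (b : R -> R) : load_ok hs -> bm b ->
  atoms_int mu (load_atoms hs e) b = load hs (fun e' x => (e' == e)%:R * b x).
Proof.
move=> + hb; elim: hs => [|p hs IH] hok; first by rewrite /atoms_int /load !big_nil.
have [h1 h2 h3] := load_ok_cons hok.
rewrite /load_atoms /= atoms_int_cat load_cons IH//; congr (_ + _).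
have ok : List.Forall (atom_ok mu) [seq (p.1, phi) | phi <- visits e p.2].
  by have := @load_atoms_ok [:: p] e; rewrite /load_atoms /= cats0; apply; constructor.
rewrite /atoms_int big_map/=.
have -> : (fun t => p.1 t * pathsum T (fun e' x => (e' == e)%:R * b x) p.2 t) =
    fun t => \sum_(phi <- visits e p.2) p.1 t * b (phi t).
  by apply/funext => t; rewrite -sum_visits mulr_sumr.
elim: (visits e p.2) ok => [|phi l IHl] ok.
  by rewrite big_nil -[LHS](II0 mu); apply: eq_II => t; rewrite big_nil.
inversion ok as [|? ? g1 g2]; subst.
have L1l : L1 mu (fun t => \sum_(phi0 <- l) p.1 t * b (phi0 t)).
  elim: (l) g2 => [|phi' l' IHl'] g2.
    by under eq_fun do rewrite big_nil; exact: L1_cst0.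
  inversion g2 as [|? ? k1 k2]; subst.
  by under eq_fun do rewrite big_cons; apply: L1D; [exact: (atom_L1 k1 hb)|exact: IHl'].
rewrite big_cons IHl//.
have := IID (atom_L1 g1 hb) L1l => /= <-.
by apply: eq_II => t; rewrite big_cons.
Qed.

Lemma L1_pathsum (h : R -> R) b w : L1 mu h -> (forall e, bm (b e)) ->
  L1 mu (fun t => h t * pathsum T b w t).
Proof. by move=> hL hb; apply: L1M => //; exact: bm_pathsum. Qed.

Lemma load_sum hs (J : Type) (s : seq J) (P : pred J) (b : J -> E -> R -> R) : load_ok hs ->
  (forall j e, bm (b j e)) ->
  load hs (fun e x => \sum_(j <- s | P j) b j e x) = \sum_(j <- s | P j) load hs (b j).
Proof.
move=> + hb; elim: hs => [|p hs IH] hok.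
  by rewrite /load big_nil big1// => j _; rewrite big_nil.
have [h1 h2 h3] := load_ok_cons hok.
rewrite load_cons IH//; under [RHS]eq_bigr do rewrite load_cons.
rewrite big_split/=; congr (_ + _).
rewrite -II_sum; last by move=> j _; exact: L1_pathsum.
apply: eq_II => t; rewrite -mulr_sumr; congr (_ * _).
elim: p.2 t => [|e w IHw] t /=; first by rewrite big1.
by rewrite IHw big_split.
Qed.

Lemma load_edges hs b : load_ok hs -> (forall e, bm (b e)) ->
  load hs b = \sum_e load hs (fun e' x => (e' == e)%:R * b e x).
Proof.
move=> hok hb; rewrite -load_sum//; last first.
  by move=> e e'; apply: bmM => //; exact: bm_cst.
congr load; apply/funext => e; apply/funext => x.
rewrite (bigD1 e)//= eqxx mul1r big1 ?addr0// => e' /negPf h.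
by rewrite eq_sym h mul0r.
Qed.

Lemma load_density (nu : E -> {finite_measure set R -> \bar R}) hs : load_ok hs ->
  (forall e A, measurable A ->
     ((load hs (fun e' x => (e' == e)%:R * \1_A x))%:E <= nu e A)%E) ->
  exists f : E -> R -> R, [/\ forall e, measurable_fun setT (f e),
    forall e x, 0 <= f e x <= 1 &
    forall b, (forall e, bm (b e)) ->
      load hs b = \sum_e II (nu e) (fun x => f e x * b e x)].
Proof.
move=> hok dom.
have H e : exists f : R -> R, [/\ measurable_fun setT f, forall x, 0 <= f x <= 1 &
    forall b, bm b -> load hs (fun e' x => (e' == e)%:R * b x) = II (nu e) (fun x => f x * b x)].
  have [nu1 [n1 i1]] := atoms_int_measure (load_atoms_ok e hok).
  have [|f [mf f01 fE]] := @finite_density _ _ _ nu1 (nu e).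
    move=> A mA; rewrite n1//; apply: le_trans (dom e A mA).
    by rewrite atoms_int_load_atoms//; exact: bm_indic.
  exists f; split => // b hb; rewrite -fE// i1// atoms_int_load_atoms//.
have [f hf] := choice H.
exists f; split => [e|e|b hb]; [by have [] := hf e|by have [] := hf e|].
rewrite load_edges//; apply: eq_bigr => e _.
by have [_ _ ->] := hf e.
Qed.

Lemma load_density_lebesgue (z : E -> R -> R) hs : load_ok hs ->
  (forall e, L1 mu (z e)) -> (forall e t, 0 <= z e t) ->
  (forall e A, measurable A ->
     load hs (fun e' x => (e' == e)%:R * \1_A x) <= II mu (fun x => z e x * \1_A x)) ->
  exists f : E -> R -> R, [/\ forall e, measurable_fun setT (f e),
    forall e x, 0 <= f e x <= 1 &
    forall b, (forall e, bm (b e)) ->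
      load hs b = \sum_e II mu (fun x => z e x * f e x * b e x)].
Proof.
move=> hok zL z0 dom.
have H e : exists nu : {finite_measure set R -> \bar R},
    (forall A, measurable A -> nu A = (II mu (fun x => z e x * \1_A x))%:E) /\
    forall b, bm b -> II nu b = II mu (fun x => z e x * b x).
  have [|nu [n1 i1]] := @atoms_int_measure _ _ _ _ _ mu [:: (z e, id : R -> R)].
    by constructor; [exact: atom_id|constructor].
  exists nu; split => [A mA|b hb]; first by rewrite n1// /atoms_int big_seq1.
  by rewrite i1// /atoms_int big_seq1.
have [nu hnu] := choice H.
have [|f [mf f01 fE]] := @load_density nu hs hok.
  by move=> e A mA; have [-> // _] := hnu e; rewrite lee_fin; exact: dom.
exists f; split => // b hb; rewrite fE//; apply: eq_bigr => e _.
have [_ ->] := hnu e; last by apply: bmM => //; exact: bm_bnd (mf e) (f01 e).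
by apply: eq_II => x; rewrite mulrA.
Qed.

End Loads.

(** * The linear program with frozen travel times *)

Section LP.
Context (R : realType) (V E I : finType) (tail head : E -> V).
Local Notation mu := (@lebesgue_measure R).
Variables (s d : V) (T : E -> R -> R) (tau T0 : R) (u : E -> R -> R) (r : I -> R -> R).
Variables (c : I -> E -> R -> R) (Cc : R) (N : nat).
Hypothesis hN : T0 < N%:R * tau.
Hypothesis tau0 : 0 < tau.
Hypothesis mT : forall e, measurable_fun setT (T e).
Hypothesis uL : forall e, L1 mu (u e).
Hypothesis u0 : forall e t, 0 <= u e t.
Hypothesis us : forall e t, u e t != 0 -> 0 <= t <= T0.
Hypothesis uT : forall e t, u e t != 0 -> t + tau <= T e t.
Hypothesis ud : forall e t, tail e = d -> u e t = 0.
Hypothesis rL : forall i, L1 mu (r i).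
Hypothesis r0 : forall i t, 0 <= r i t.
Hypothesis cb : forall i e, bm (c i e).
Hypothesis cC : forall i e t, 0 <= c i e t <= Cc.
Hypothesis WCu : forall beta : V -> R -> R, (forall v, bm (beta v)) -> (forall t, beta d t = 0) ->
  \sum_e II mu (fun t => u e t * beta (tail e) t) =
  II mu (fun t => (\sum_i r i t) * beta s t) + \sum_e II mu (fun t => u e t * beta (head e) (T e t)).

(** [N.+1] is the length bound that [flow_decomposition] produces for [K] equal to [N]; alive walks
    satisfy it as well, by [alive_size]. *)
Let ws := walks tail head d N.+1 s.
Local Notation Xi := (seq E -> I -> R -> R).

(* [xi w i t] is the fraction of the inflow of commodity [i] at time [t] that takes
   walk [w]; restricting to alive walks bounds their size. *)
Definition fractions (xi : Xi) := [/\
  forall w i, measurable_fun setT (xi w i) /\ forall t, 0 <= xi w i t <= 1,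
  forall i t, \sum_(w <- ws) xi w i t <= 1,
  forall w i t, xi w i t != 0 -> alive T u w t != 0 &
  forall i, II mu (fun t => r i t * (1 - \sum_(w <- ws) xi w i t)) = 0].

Definition assign (xi : Xi) (b : I -> E -> R -> R) : R :=
  \sum_i \sum_(w <- ws) II mu (fun t => r i t * xi w i t * pathsum T (b i) w t).

Let xiB (xi : Xi) := forall w i, measurable_fun setT (xi w i) /\ forall t, 0 <= xi w i t <= 1.

Let bm_xi xi w i : xiB xi -> bm (xi w i).
Proof. by move=> /(_ w i)[m h]; exact: bm_bnd m h. Qed.

Let L1_xi xi w i : xiB xi -> L1 mu (fun t => r i t * xi w i t).
Proof. by move=> /bm_xi h; apply: (L1M (rL i)); exact: h. Qed.

Let L1_xib xi w i b : xiB xi -> (forall e, bm (b e)) ->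
  L1 mu (fun t => r i t * xi w i t * pathsum T b w t).
Proof. by move=> h hb; apply: L1M; [exact: L1_xi|exact: bm_pathsum]. Qed.

Let atoms (xi : Xi) : seq ((R -> R) * seq E) :=
  flatten [seq [seq ((fun t => r i t * xi w i t), w) | w <- ws] | i <- index_enum I].

Let load_atoms_xi xi b : load T (atoms xi) b = assign xi (fun=> b).
Proof.
rewrite /load /atoms big_flatten/= big_map; apply: eq_bigr => i _.
by rewrite big_map.
Qed.

Let ok_atoms xi : xiB xi -> load_ok (atoms xi).
Proof.
move=> h; apply: forall_flatten => i; elim: ws => [|w l IH] /=; constructor => //=.
split; first exact: L1_xi.
by move=> t; rewrite mulr_ge0//; have [_ /(_ t)/andP[]] := h w i.
Qed.

Lemma assign_linear xi (k : R) b1 b2 : xiB xi -> (forall i e, bm (b1 i e)) -> (forall i e, bm (b2 i e)) ->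
  assign xi (fun i e x => b1 i e x + k * b2 i e x) = assign xi b1 + k * assign xi b2.
Proof.
move=> h h1 h2; rewrite /assign mulr_sumr -big_split/=; apply: eq_bigr => i _.
rewrite mulr_sumr -big_split/=; apply: eq_bigr => w _.
have i1 := L1_xib w i h (h1 i); have i2 := L1_xib w i h (h2 i).
rewrite -IIZ// -IID//; last exact: L1Z.
by apply: eq_II => t; rewrite pathsumD pathsumZ; ring.
Qed.

Lemma assign_mono xi1 xi2 b1 b2 : xiB xi1 -> xiB xi2 ->
  (forall i e, bm (b1 i e)) -> (forall i e, bm (b2 i e)) ->
  (forall i w t, w \in ws -> xi1 w i t * pathsum T (b1 i) w t <= xi2 w i t * pathsum T (b2 i) w t) ->
  assign xi1 b1 <= assign xi2 b2.
Proof.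
move=> h1 h2 hb1 hb2 h; apply: ler_sum => i _; rewrite big_seq [leRHS]big_seq.
apply: ler_sum => w hw; apply: le_II; [exact: L1_xib|exact: L1_xib|] => t.
by rewrite -!mulrA ler_wpM2l// h.
Qed.

Lemma assign_mix xi1 xi2 xi (k1 k2 : R) b : xiB xi1 -> xiB xi2 -> (forall i e, bm (b i e)) ->
  (forall w i t, w \in ws -> xi w i t = k1 * xi1 w i t + k2 * xi2 w i t) ->
  assign xi b = k1 * assign xi1 b + k2 * assign xi2 b.
Proof.
move=> h1 h2 hb h; rewrite /assign !mulr_sumr -big_split/=; apply: eq_bigr => i _.
rewrite !mulr_sumr -big_split/= big_seq [RHS]big_seq; apply: eq_bigr => w hw.
have i1 := L1_xib w i h1 (hb i); have i2 := L1_xib w i h2 (hb i).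
rewrite -!IIZ// -IID; [|exact: L1Z..].
by apply: eq_II => t; rewrite h//; ring.
Qed.

Definition feasible xi := fractions xi /\
  forall b, (forall e, bm (b e)) -> assign xi (fun=> b) = \sum_e II mu (fun t => u e t * b e t).

Definition cost xi := assign xi c.

Let rho t := \sum_i r i t.
Let rhoL : L1 mu rho. Proof. by apply: L1_sum => i _; exact: rL. Qed.
Let rho0 t : 0 <= rho t. Proof. exact: sumr_ge0. Qed.

Let hN1 : T0 < N.+1%:R * tau.
Proof. by apply: lt_le_trans hN _; rewrite ler_pM2r// ler_nat. Qed.

(** All commodities are routed by the same shares of the aggregate flow [u], which is possible
    because they have the same source and destination. *)
Lemma feasible_nonempty : exists xi, feasible xi.
Proof.
pose q := split tail u.
have bq e : bm (q e) by exact: bm_split.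
have bP w : bm (pathprod T q w) by exact: bm_pathprod.
have q0 e t : 0 <= q e t by exact: split_ge0.
have q1 e t : q e t <= 1 by exact: split_le1.
have p01 w t : 0 <= pathprod T q w t <= 1 by apply: pathprod_le1 => e x; rewrite q0 q1.
exists (fun w _ => pathprod T q w); split; first split.
- by move=> w i; split => //; exact: bm_meas.
- by move=> i t; exact: (reach_le1 head T u0 ud N.+1 s t).
- move=> w i t; apply: pathprod_neq0 => e x h.
  by have := split_neq0 h => /negPf ->; rewrite oner_neq0.
- have [h _] := reach_source_head mT uL u0 us uT ud rho0 WCu hN1.
  have n0 t : 0 <= 1 - reach tail head d T u N.+1 s t by rewrite subr_ge0 reach_le1.
  have b1 : bm (fun t => 1 - reach tail head d T u N.+1 s t).
    by apply: bmB; [exact: bm_cst|exact: bm_reach].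
  move: h; rewrite (eq_II (mu := mu) (g := fun t => \sum_i r i t * (1 - reach tail head d T u N.+1 s t))); last first.
    by move=> t; rewrite mulr_suml.
  rewrite II_sum; last by move=> i _; exact: L1M.
  move=> /eqP; rewrite psumr_eq0; last by move=> i _; apply: II_ge0 => t; rewrite mulr_ge0.
  by move=> /allP h i; have := h i (mem_index_enum _) => /implyP/(_ isT)/eqP.
move=> b hb.
rewrite (flow_decomposition mT uL u0 us uT ud rhoL rho0 WCu hN hb).
rewrite /assign exchange_big/=; apply: eq_bigr => w _.
rewrite -II_sum; last first.
  by move=> i _; apply: L1M; [apply: L1M => //; exact: bP|exact: bm_pathsum].
by apply: eq_II => t; rewrite /rho !mulr_suml.
Qed.

Lemma walk_size w : w \in ws -> (size w)%:R <= N.+1%:R :> R.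
Proof. by rewrite mem_walks => /andP[_]; rewrite ler_nat. Qed.

(** A bound for the cost of any walk in [ws]. It becomes the constant of the exact penalty and hence
    the bound on the tolls given by duality. *)
Let c00 := N.+1%:R * `|Cc|.

Let pathcost_le i w t : w \in ws -> pathsum T (c i) w t <= c00.
Proof.
move=> hw; apply: le_trans (pathsum_le_size T w t (C := `|Cc|) _) _.
  by move=> e x; have /andP[_ h] := cC i e x; apply: le_trans h (ler_norm _).
by rewrite ler_wpM2r//; exact: walk_size.
Qed.

(* [x] is the load of [xi] and [ups] the target load, both relative to [m]. Scaling
   the flow at each edge down by [eta = min 1 (ups / x)] brings the load below the target. *)
Lemma repair (m : {finite_measure set R -> \bar R}) (ups x : E -> R -> R) xi :
  (forall e, measurable_fun setT (ups e)) -> (forall e t, 0 <= ups e t <= 1) ->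
  (forall e, measurable_fun setT (x e)) -> (forall e t, 0 <= x e t <= 1) ->
  (forall b, (forall e, bm (b e)) ->
     \sum_e II mu (fun t => u e t * b e t) = \sum_e II m (fun t => ups e t * b e t)) ->
  fractions xi ->
  (forall b, (forall e, bm (b e)) -> assign xi (fun=> b) = \sum_e II m (fun t => x e t * b e t)) ->
  exists2 xi', feasible xi' &
    cost xi' <= cost xi + c00 * \sum_e II m (fun t => Num.max 0 (x e t - ups e t)).
Proof.
move=> mups ups01 mx x01 upsE fxi xE; have [xi1 xi2 xi3 xi4] := fxi.
have bups e : bm (ups e) by exact: bm_bnd (mups e) (ups01 e).
have bx e : bm (x e) by exact: bm_bnd (mx e) (x01 e).
(* Where [x] vanishes the quotient is 0; this is harmless, since [eta] matters only through its
   product with [x]. *)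
pose eta e t := Num.min 1 (ups e t * (x e t) `^ (-1)).
have x0 e t : 0 <= x e t by case/andP: (x01 e t).
have U0 e t : 0 <= ups e t by case/andP: (ups01 e t).
have eta01 e t : 0 <= eta e t <= 1.
  by rewrite /eta le_min ler01 ge_min lexx/= andbT mulr_ge0// powR_ge0.
have meta e : measurable_fun setT (eta e).
  apply: measurable_minr => //; apply: measurable_funM => //.
  exact: (measurableT_comp (measurable_powR (-1 : R)) (mx e)).
have beta_ e : bm (eta e) by exact: bm_bnd (meta e) (eta01 e).
have eta_x e t : x e t * eta e t <= ups e t.
  rewrite /eta powR_inv1//; have [->|xn] := eqVneq (x e t) 0; first by rewrite mul0r.
  have xp : 0 < x e t by rewrite lt_neqAle eq_sym xn x0.
  rewrite mulrC -ler_pdivlMr// ge_min; apply/orP; right; exact: lexx.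
have eta_x' e t : x e t * (1 - eta e t) = Num.max 0 (x e t - ups e t).
  rewrite /eta powR_inv1//; have [->|xn] := eqVneq (x e t) 0.
    by rewrite mul0r max_l// sub0r oppr_le0.
  have xp : 0 < x e t by rewrite lt_neqAle eq_sym xn x0.
  have [h|h] := leP 1 (ups e t / x e t).
    by rewrite subrr mulr0 max_l// subr_le0; move: h; rewrite ler_pdivlMr// mul1r.
  by rewrite max_r; [field|rewrite subr_ge0; move: h; rewrite ltr_pdivrMr// mul1r => /ltW].
pose xa : Xi := fun w i t => xi w i t * pathprod T eta w t.
have bPe w : bm (pathprod T eta w) by exact: bm_pathprod.
have P01 w t : 0 <= pathprod T eta w t <= 1 by exact: pathprod_le1.
have xaB : xiB xa.
  move=> w i; split; first by apply: bm_meas; apply: bmM => //; exact: bm_xi.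
  move=> t; have [_ /(_ t)/andP[h1 h2]] := xi1 w i; have /andP[h3 h4] := P01 w t.
  by rewrite mulr_ge0// mulr_ile1.
have xa_le w i t : xa w i t <= xi w i t.
  have [_ /(_ t)/andP[h1 h2]] := xi1 w i; have /andP[h3 h4] := P01 w t.
  by rewrite ler_piMr.
have b0 : forall e, bm (fun t => 1 - eta e t) by move=> e; apply: bmB => //; exact: bm_cst.
have xa_load b : (forall e, bm (b e)) -> (forall e t, 0 <= b e t) ->
    assign xa (fun=> b) <= \sum_e II mu (fun t => u e t * b e t).
  move=> hb hb0; have bb e : bm (fun t => eta e t * b e t) by exact: bmM.
  apply: (@le_trans _ _ (assign xi (fun _ e t => eta e t * b e t))).
    apply: assign_mono => // i w t _; rewrite /xa -mulrA ler_wpM2l//.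
      by have [_ /(_ t)/andP[]] := xi1 w i.
    exact: pathprod_pathsum.
  rewrite xE// upsE//; apply: ler_sum => e _; apply: le_II.
  - by apply: L1_fin; exact: bmM.
  - by apply: L1_fin; exact: bmM.
  - by move=> t; rewrite mulrA ler_wpM2r.
have [|f [mf f01 fE]] := @load_density_lebesgue _ _ T mT u (atoms xa) (ok_atoms xaB) uL u0.
  move=> e A mA; rewrite load_atoms_xi.
  have bA e' : bm (fun x => ((e' == e)%:R * \1_A x : R)).
    by apply: bmM; [exact: bm_cst|exact: bm_indic].
  apply: le_trans (xa_load _ bA _) _; first by move=> e' t; rewrite mulr_ge0// indicE.
  rewrite (bigD1 e)//= big1 ?addr0.
    apply: le_II => [||t]; [by apply: L1M => //; exact: bA|by apply: L1M => //; exact: bm_indic|].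
    by rewrite eqxx mul1r.
  move=> e' /negPf h; rewrite -[RHS](II0 mu); apply: eq_II => t.
  by rewrite h mul0r mulr0.
have {}fE b : (forall e, bm (b e)) -> assign xa (fun=> b) = \sum_e II mu (fun t => u e t * f e t * b e t).
  by move=> hb; rewrite -load_atoms_xi fE.
have bf e : bm (f e) by exact: bm_bnd (mf e) (f01 e).
(* [f] is the density of the thinned load relative to [u], so [z] is the part of the target that is
   still missing. *)
pose z e t := u e t * (1 - f e t).
have zL e : L1 mu (z e) by apply: L1M => //; apply: bmB; [exact: bm_cst|exact: bf].
have z0 e t : 0 <= z e t by rewrite mulr_ge0// subr_ge0; case/andP: (f01 e t).
have zu e t : z e t != 0 -> u e t != 0 by apply: contra_neq => h; rewrite /z h mul0r.
have zs e t : z e t != 0 -> 0 <= t <= T0 by move/zu/us.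
have zT e t : z e t != 0 -> t + tau <= T e t by move/zu/uT.
have zd e t : tail e = d -> z e t = 0 by move=> h; rewrite /z ud// mul0r.
pose rem i t := r i t * (1 - \sum_(w <- ws) xa w i t).
have sxa i t : \sum_(w <- ws) xa w i t <= 1.
  by apply: le_trans (xi2 i t); apply: ler_sum => w _.
have rem0 i t : 0 <= rem i t by rewrite mulr_ge0// subr_ge0.
have bsxa i : bm (fun t => 1 - \sum_(w <- ws) xa w i t).
  by apply: bmB; [exact: bm_cst|apply: bm_sum => w _; exact: bm_xi].
have remL i : L1 mu (rem i) by exact: (L1M (rL i) (bsxa i)).
pose rh t := \sum_i rem i t.
have rhL : L1 mu rh by apply: L1_sum => i _; exact: remL.
have rh0 t : 0 <= rh t by exact: sumr_ge0.
have zE b : (forall e, bm (b e)) -> \sum_e II mu (fun t => z e t * b e t) =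
    \sum_e II mu (fun t => u e t * b e t) - assign xa (fun=> b).
  move=> hb; rewrite fE// -sumrB; apply: eq_bigr => e _.
  rewrite -IIB.
  - by apply: eq_II => t; rewrite /z; ring.
  - exact: (L1M (uL e) (hb e)).
  - exact: (L1M (L1M (uL e) (bf e)) (hb e)).
(* Along each walk the test function telescopes to its value at the source, so the thinned load is
   conserved with its own inflow; subtracting from [WCu] leaves conservation for [z] with inflow
   [rh]. *)
have WCz beta : (forall v, bm (beta v)) -> (forall t, beta d t = 0) ->
    \sum_e II mu (fun t => z e t * beta (tail e) t) =
    II mu (fun t => rh t * beta s t) + \sum_e II mu (fun t => z e t * beta (head e) (T e t)).
  move=> hb bd.
  have hbT e : bm (fun t => beta (head e) (T e t)) by exact: (bm_comp (hb (head e)) (mT e)).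
  rewrite (zE (fun e => beta (tail e)))// (zE (fun e t => beta (head e) (T e t)))// WCu//.
  have -> : II mu (fun t => rh t * beta s t) = II mu (fun t => (\sum_i r i t) * beta s t) -
      \sum_i \sum_(w <- ws) II mu (fun t => r i t * xa w i t * beta s t).
    have L1s i w : L1 mu (fun t => r i t * xa w i t * beta s t) by exact: (L1M (L1_xi w i xaB) (hb s)).
    under eq_bigr do rewrite -II_sum//.
    rewrite -II_sum; last by move=> i _; apply: L1_sum => w _; exact: L1s.
    rewrite -IIB; [|exact: (L1M rhoL (hb s))|by apply: L1_sum => i _; apply: L1_sum => w _; exact: L1s].
    apply: eq_II => t; rewrite /rh /rem !mulr_suml -sumrB; apply: eq_bigr => i _.
    by rewrite mulrBr mulr1 mulrBl mulr_sumr mulr_suml.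
  have -> : assign xa (fun _ e => beta (tail e)) =
      \sum_i \sum_(w <- ws) II mu (fun t => r i t * xa w i t * beta s t) +
      assign xa (fun _ e t => beta (head e) (T e t)).
    rewrite /assign -big_split/=; apply: eq_bigr => i _.
    rewrite -big_split/= big_seq [RHS]big_seq; apply: eq_bigr => w.
    rewrite mem_walks => /andP[hw _].
    rewrite -IID; [|exact: (L1M (L1_xi w i xaB) (hb s))|by apply: L1_xib].
    apply: eq_II => t; have := pathsum_telescope T beta t hw.
    by rewrite bd addr0 => ->; rewrite mulrDr.
  ring.
pose q := split tail z.
have bq e : bm (q e) by exact: bm_split.
have bP w : bm (pathprod T q w) by exact: bm_pathprod.
have q0 e t : 0 <= q e t by exact: split_ge0.
have q1 e t : q e t <= 1 by exact: split_le1.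
have p01 w t : 0 <= pathprod T q w t <= 1 by apply: pathprod_le1 => e t'; rewrite q0 q1.
(* The unassigned inflow of every commodity follows the decomposition of the aggregate remainder
   [z]. *)
pose xr : Xi := fun w i t => (1 - \sum_(w <- ws) xa w i t) * pathprod T q w t.
have xrB : xiB xr.
  move=> w i; split; first by apply: bm_meas; exact: bmM.
  move=> t; have /andP[h3 h4] := p01 w t.
  have h5 : 0 <= 1 - \sum_(w <- ws) xa w i t by rewrite subr_ge0.
  rewrite mulr_ge0// mulr_ile1// gerBl; apply: sumr_ge0 => w' _.
  by have [_ /(_ t)/andP[]] := xaB w' i.
have [zreach _] := reach_source_head mT zL z0 zs zT zd rh0 WCz hN1.
have reach1 t : reach tail head d T z N.+1 s t <= 1 by exact: reach_le1.
have sxr i t : \sum_(w <- ws) xr w i t =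
    (1 - \sum_(w <- ws) xa w i t) * reach tail head d T z N.+1 s t by rewrite -mulr_sumr.
(* The indicator of [ws] keeps the fractions at most 1 outside [ws], where the bound on their sum
   says nothing. *)
pose xn : Xi := fun w i t => (w \in ws)%:R * (xa w i t + xr w i t).
have sxn i t : \sum_(w <- ws) xn w i t = \sum_(w <- ws) xa w i t + \sum_(w <- ws) xr w i t.
  rewrite -big_split/= big_seq [RHS]big_seq; apply: eq_bigr => w hw.
  by rewrite /xn hw mul1r.
have sxn1 i t : \sum_(w <- ws) xn w i t <= 1.
  rewrite sxn sxr -lerBrDl ler_piMr// subr_ge0//.
have xn0 w i t : 0 <= xn w i t.
  have [_ /(_ t)/andP[h1 _]] := xaB w i; have [_ /(_ t)/andP[h2 _]] := xrB w i.
  by rewrite mulr_ge0// addr_ge0.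
have fn : fractions xn.
  split => //.
  - move=> w i; split.
      apply: bm_meas; apply: bmM; first exact: bm_cst.
      by apply: bmD; exact: bm_xi.
    move=> t; rewrite xn0/=; have [hw|hw] := boolP (w \in ws); last first.
      by rewrite /xn (negPf hw) mul0r.
    apply: le_trans (sxn1 i t); rewrite (big_rem w)//= lerDl.
    by apply: sumr_ge0 => w' _.
  - move=> w i t; rewrite /xn mulf_eq0 negb_or => /andP[_] h.
    have [h1|h1] := eqVneq (xa w i t) 0.
      move: h; rewrite h1 add0r /xr mulf_eq0 negb_or => /andP[_].
      by apply: pathprod_neq0 => e t' /split_neq0 /zu /negPf ->; rewrite oner_neq0.
    by apply: (xi3 w i t); move: h1; rewrite /xa mulf_eq0 negb_or => /andP[].
  - move=> i.
    have Li j : L1 mu (fun t => rem j t * (1 - reach tail head d T z N.+1 s t)).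
      by apply: L1M => //; apply: bmB; [exact: bm_cst|exact: bm_reach].
    have ge j t : 0 <= rem j t * (1 - reach tail head d T z N.+1 s t).
      by rewrite mulr_ge0// subr_ge0.
    move: zreach; rewrite (eq_II (mu := mu) (g := fun t => \sum_i rem i t * (1 - reach tail head d T z N.+1 s t))); last first.
      by move=> t; rewrite mulr_suml.
    rewrite II_sum// => /eqP; rewrite psumr_eq0; last by move=> j _; exact: II_ge0.
    move=> /allP/(_ i (mem_index_enum _))/implyP/(_ isT)/eqP h; rewrite -[RHS]h.
    by apply: eq_II => t; rewrite sxn sxr /rem; ring.
have xnE b : (forall i e, bm (b i e)) -> assign xn b = assign xa b + assign xr b.
  move=> hb; rewrite (@assign_mix xa xr xn 1 1)// ?mul1r// => w i t hw.
  by rewrite /xn hw !mul1r.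
exists xn.
  split => // b hb; rewrite xnE//.
  have := flow_decomposition mT zL z0 zs zT zd rhL rh0 WCz hN hb.
  rewrite zE// => /eqP; rewrite subr_eq addrC => /eqP ->; congr (_ + _).
  rewrite /assign exchange_big/=; apply: eq_bigr => w _.
  rewrite -II_sum; last by move=> i _; exact: L1_xib.
  apply: eq_II => t; rewrite /rh !mulr_suml; apply: eq_bigr => i _.
  by rewrite /rem /xr; ring.
rewrite /cost xnE//; apply: lerD.
  apply: assign_mono => // i w t _; rewrite ler_wpM2r//.
  by apply: pathsum_ge0 => e t'; case/andP: (cC i e t').
(* The mass removed by thinning is bounded through [one_sub_pathprod] by the load of [xi] against
   [1 - eta], which is the integral of the overload. *)
have irh : II mu rh <= \sum_e II m (fun t => Num.max 0 (x e t - ups e t)).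
  rewrite II_sum//.
  have -> : \sum_e II m (fun t => Num.max 0 (x e t - ups e t)) =
     \sum_e II m (fun t => x e t * (1 - eta e t)).
    by apply: eq_bigr => e _; apply: eq_II => t; rewrite eta_x'.
  rewrite -(xE (fun e t => 1 - eta e t))//; apply: ler_sum => i _.
  have -> : II mu (rem i) = II mu (rem i) - II mu (fun t => r i t * (1 - \sum_(w <- ws) xi w i t)).
    by rewrite xi4 subr0.
  have Lxi : L1 mu (fun t => r i t * (1 - \sum_(w <- ws) xi w i t)).
    by apply: L1M => //; apply: bmB; [exact: bm_cst|apply: bm_sum => w _; exact: bm_xi].
  rewrite -IIB// -II_sum; last by move=> w _; exact: L1_xib.
  apply: le_II; [exact: L1B|by apply: L1_sum => w _; exact: L1_xib|] => t.
  rewrite /rem -mulrBr (_ : 1 - \sum_(w <- ws) xa w i t - (1 - \sum_(w <- ws) xi w i t) =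
    \sum_(w <- ws) (xi w i t - xa w i t)); last by rewrite sumrB; ring.
  rewrite mulr_sumr.
  apply: ler_sum => w _; rewrite -mulrA ler_wpM2l//.
  have [_ /(_ t)/andP[h1 _]] := xi1 w i.
  rewrite /xa -{1}[xi w i t]mulr1 -mulrBr ler_wpM2l//.
  exact: one_sub_pathprod.
have c000 : 0 <= c00 by rewrite mulr_ge0.
apply: le_trans (ler_wpM2l c000 irh).
rewrite -IIZ// /assign exchange_big/=.
have Lr w i : L1 mu (fun t => r i t * xr w i t * pathsum T (c i) w t) by exact: L1_xib.
under eq_bigr do rewrite -II_sum//.
rewrite -II_sum; last by move=> w _; apply: L1_sum => i _; exact: Lr.
apply: le_II.
- by apply: L1_sum => w _; apply: L1_sum => i _; exact: Lr.
- exact: L1Z.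
move=> t; rewrite exchange_big/= /rh mulr_sumr; apply: ler_sum => i _.
apply: (@le_trans _ _ (\sum_(w <- ws) c00 * (rem i t * pathprod T q w t))).
  rewrite big_seq [leRHS]big_seq; apply: ler_sum => w hw.
  rewrite [X in _ <= X]mulrC /xr mulrA -/(rem i t) ler_wpM2l//; last exact: pathcost_le.
  by rewrite mulr_ge0//; case/andP: (p01 w t).
by rewrite -mulr_sumr ler_wpM2l// -mulr_sumr ler_piMr//; exact: reach1.
Qed.

Lemma fractions_mix xi1 xi2 (k1 k2 : R) : 0 <= k1 -> 0 <= k2 -> k1 + k2 = 1 ->
  fractions xi1 -> fractions xi2 -> fractions (fun w i t => k1 * xi1 w i t + k2 * xi2 w i t).
Proof.
move=> h1 h2 h12 [a1 a2 a3 a4] [b1 b2 b3 b4].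
have sE i t : \sum_(w <- ws) (k1 * xi1 w i t + k2 * xi2 w i t) =
    k1 * (\sum_(w <- ws) xi1 w i t) + k2 * (\sum_(w <- ws) xi2 w i t).
  by rewrite big_split/= !mulr_sumr.
have le1 (x y : R) : x <= 1 -> y <= 1 -> k1 * x + k2 * y <= 1.
  move=> x1 y1; rewrite -h12 -[leRHS]/(k1 + k2) lerD//.
    by rewrite ler_piMr.
  by rewrite ler_piMr.
have bs xi i : xiB xi -> bm (fun t => 1 - \sum_(w <- ws) xi w i t).
  by move=> h; apply: bmB; [exact: bm_cst|apply: bm_sum => w _; exact: bm_xi].
split.
- move=> w i; split.
    apply: bm_meas; apply: bmD; (apply: bmM; [exact: bm_cst|exact: bm_xi]).
  move=> t; have [_ /(_ t)/andP[x0 x1]] := a1 w i; have [_ /(_ t)/andP[y0 y1]] := b1 w i.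
  by rewrite addr_ge0 ?mulr_ge0//=; exact: le1.
- by move=> i t; rewrite sE; apply: le1.
- move=> w i t; have [->|n1 _] := eqVneq (xi1 w i t) 0; last exact: a3 n1.
  by rewrite mulr0 add0r mulf_eq0 negb_or => /andP[_]; exact: b3.
- move=> i; have i1 := L1M (rL i) (bs _ i a1); have i2 := L1M (rL i) (bs _ i b1).
  transitivity (k1 * II mu (fun t => r i t * (1 - \sum_(w <- ws) xi1 w i t)) +
      k2 * II mu (fun t => r i t * (1 - \sum_(w <- ws) xi2 w i t))).
    rewrite -!IIZ// -IID; [|exact: L1Z..].
    by apply: eq_II => t /=; rewrite sE -{1}h12; ring.
  by rewrite a4 b4 !mulr0 addr0.
Qed.

Section Limit.
Variables (F : nat -> Xi) (xi : Xi).
Hypothesis FB : forall n, xiB (F n).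
Hypothesis xB : xiB xi.
Hypothesis cvF : forall i w, w \in ws ->
  {ae mu, forall t, r i t * F n w i t @[n --> \oo] --> r i t * xi w i t}.

Lemma assign_cvg b : (forall i e, bm (b i e)) -> assign (F n) b @[n --> \oo] --> assign xi b.
Proof.
move=> hb; apply: cvg_sumr => i _; apply: cvg_sumr => w hw.
have bP := bm_pathsum mT w (hb i).
apply: (@II_cvg _ _ _ mu (fun n t => r i t * F n w i t * pathsum T (b i) w t) _
  (fun t => r i t * `|pathsum T (b i) w t|)).
- by move=> n; apply: (@L1_meas _ _ _ mu); exact: L1_xib.
- by apply: (@L1_meas _ _ _ mu); exact: L1_xib.
- by apply: L1M => //; exact: bm_norm.
- by move: (cvF i hw); apply: ae_mp => t h; apply: cvgM => //; exact: cvg_cst.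
- move=> n t; have [_ /(_ t)/andP[h1 h2]] := FB n w i.
  rewrite !normrM (ger0_norm (r0 _ _)) ler_wpM2r// ger0_norm//.
  by rewrite ler_piMr.
Qed.

Lemma remainder_cvg i : II mu (fun t => r i t * (1 - \sum_(w <- ws) F n w i t)) @[n --> \oo] -->
  II mu (fun t => r i t * (1 - \sum_(w <- ws) xi w i t)).
Proof.
have bs x : xiB x -> bm (fun t => \sum_(w <- ws) x w i t).
  by move=> h; apply: bm_sum => w _; exact: bm_xi.
have EX x : xiB x -> II mu (fun t => r i t * (1 - \sum_(w <- ws) x w i t)) =
    II mu (r i) - \sum_(w <- ws) II mu (fun t => r i t * x w i t).
  move=> h; rewrite -II_sum; last by move=> w _; exact: L1_xi.
  rewrite -IIB//; last by apply: L1_sum => w _; exact: L1_xi.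
  by apply: eq_II => t; rewrite mulrBr mulr1 mulr_sumr.
rewrite EX//; under eq_fun do rewrite EX//.
apply: cvgB; first exact: cvg_cst.
apply: cvg_sumr => w hw.
apply: (@II_cvg _ _ _ mu (fun n t => r i t * F n w i t) _ (r i)).
- by move=> n; apply: (@L1_meas _ _ _ mu); exact: L1_xi.
- by apply: (@L1_meas _ _ _ mu); exact: L1_xi.
- exact: rL.
- exact: cvF.
- move=> n t; have [_ /(_ t)/andP[h1 h2]] := FB n w i.
  by rewrite normrM (ger0_norm (r0 _ _)) ger0_norm// ler_piMr.
Qed.

End Limit.

Lemma cost_ge0 xi : fractions xi -> 0 <= cost xi.
Proof.
move=> [h _ _ _]; apply: sumr_ge0 => i _; apply: sumr_ge0 => w _; apply: II_ge0 => t.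
have [_ /(_ t)/andP[h1 _]] := h w i.
rewrite mulr_ge0 ?mulr_ge0//; apply: pathsum_ge0 => e x.
by case/andP: (cC i e x).
Qed.

(** The sets of feasible fractions with cost at most [v + n.+1%:R^-1] are nested, convex and
    nonempty. Load and cost are linear in the fractions, so both pass to an almost everywhere limit
    by dominated convergence. *)
Lemma minimizer : exists2 xi, feasible xi & forall xi', feasible xi' -> cost xi <= cost xi'.
Proof.
pose S := [set x | exists xi, feasible xi /\ x = cost xi].
have hS : has_inf S.
  split; first by have [xi hxi] := feasible_nonempty; exists (cost xi), xi.
  by exists 0 => _ [xi [[h _] ->]]; exact: cost_ge0.
pose v := inf S.
have vle xi : feasible xi -> v <= cost xi by move=> h; apply: ge_inf; [exact: hS.2|exists xi].
pose J := (seq E * I)%type.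
pose sL : seq J := [seq (w, i) | w <- ws, i <- enum I].
have memL w i : ((w, i) \in sL) = (w \in ws).
  apply/allpairsP/idP => [[[w' i'] /= [hw _ [-> _]]] //|hw].
  by exists (w, i); split => //=; rewrite mem_enum.
pose toXi (f : J -> R -> R) : Xi := fun w i => f (w, i).
pose P n f := feasible (toXi f) /\ cost (toXi f) <= v + n.+1%:R^-1.
(* The measure with density [rho] is finite, unlike Lebesgue measure on the line, and it disregards
   only times without inflow. *)
have [|m [mA mI]] := @atoms_int_measure _ _ _ _ _ mu [:: (rho, id : R -> R)].
  by constructor; [exact: atom_id|constructor].
have [F [A [f [PF mAA mA0 [mf cv z]]]]] : exists (F : nat -> J -> R -> R) (A : set R) (f : J -> R -> R),
  [/\ forall n, P n (F n), measurable A, m (~` A) = 0%E &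
    [/\ forall j, j \in sL -> measurable_fun setT (f j),
      forall x, A x -> forall j, j \in sL -> F ^~ j ^~ x @ \oo --> f j x &
      forall x, ~ A x -> forall j, f j x = 0]].
  apply: (@nested_convex_cvg _ _ _ m J sL P 1).
  - move=> n g [h1 h2]; split => //; apply: le_trans h2 _.
    by rewrite lerD2l lef_pV2 ?posrE// ler_nat.
  - move=> n g1 g2 [[f1 l1] c1] [[f2 l2] c2].
    have [x1 _ _ _] := f1; have [x2 _ _ _] := f2.
    have mixE b : (forall i e, bm (b i e)) ->
        assign (toXi (fun j x => 2^-1 * g1 j x + 2^-1 * g2 j x)) b =
        2^-1 * assign (toXi g1) b + 2^-1 * assign (toXi g2) b.
      by move=> hb; apply: assign_mix.
    split; last by rewrite /cost mixE//; move: c1 c2; rewrite /cost; set k := _^-1; lra.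
    split; first by apply: fractions_mix => //; lra.
    by move=> b hb; rewrite mixE// l1// l2//; lra.
  - move=> n; have e0 : 0 < n.+1%:R^-1 :> R by rewrite invr_gt0.
    have [_ [xi [hxi ->]] hlt] := inf_adherent e0 hS.
    by exists (fun j => xi j.1 j.2); split => //; exact: ltW.
  - by move=> n g [[[h _ _ _] _] _] [w i]; exact: h.
have aeA : {ae mu, forall t, rho t * \1_(~` A) t = 0}.
  have mnA : measurable (~` A) by exact: measurableC.
  apply: II_eq0_ae.
  - by apply: L1M => //; exact: bm_indic.
  - by move=> t; rewrite mulr_ge0// indicE.
  - by have := mA _ mnA; rewrite mA0 /atoms_int big_seq1 => /(congr1 fine) /= <-.
(* Nothing is known of the limit outside [ws], so it is replaced by 0 there. *)
pose xi : Xi := fun w i t => if w \in ws then f (w, i) t else 0.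
have lim w i t : w \in ws -> A t -> F n (w, i) t @[n --> \oo] --> xi w i t.
  by move=> hw At; rewrite /xi hw; apply: cv => //; rewrite memL.
have dead w i t : ~ A t -> xi w i t = 0 by move=> nA; rewrite /xi z//; case: ifP.
have FX n : fractions (toXi (F n)) by have [[]] := PF n.
have FB n : xiB (toXi (F n)) by have [] := FX n.
have xi01 w i t : 0 <= xi w i t <= 1.
  have [hw|hw] := boolP (w \in ws); last by rewrite /xi (negPf hw) lexx ler01.
  have [At|/dead->] := pselect (A t); last by rewrite lexx ler01.
  have h := lim w i t hw At.
  have hc : cvgn (fun n => F n (w, i) t) by apply/cvg_ex; exists (xi w i t).
  rewrite -(cvg_lim (@Rhausdorff R) h); apply/andP; split.
    by apply: limr_ge => //; apply: nearW => n; have [_ /(_ t)/andP[]] := FB n w i.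
  by apply: limr_le => //; apply: nearW => n; have [_ /(_ t)/andP[]] := FB n w i.
have xB : xiB xi.
  move=> w i; split => //; have [hw|hw] := boolP (w \in ws).
    rewrite (_ : xi w i = f (w, i)); last by apply/funext => t; rewrite /xi hw.
    by apply: mf; rewrite memL.
  rewrite (_ : xi w i = fun=> 0); first exact: measurable_cst.
  by apply/funext => t; rewrite /xi (negPf hw).
have cvF i w : w \in ws -> {ae mu, forall t, r i t * toXi (F n) w i t @[n --> \oo] --> r i t * xi w i t}.
  move=> hw; move: aeA; apply: ae_mp => t /eqP.
  rewrite mulf_eq0 => /orP[/eqP h|]; last first.
    rewrite indicE; case: (boolP (t \in _)) => //; first by rewrite oner_eq0.
    rewrite notin_setE /= => /contrapT At _.
    by apply: cvgM; [exact: cvg_cst|exact: lim].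
  have -> : r i t = 0.
    apply/eqP; rewrite eq_le r0 andbT -h /rho (bigD1 i)//= lerDl.
    exact: sumr_ge0.
  by rewrite mul0r; under eq_fun do rewrite mul0r; exact: cvg_cst.
have fx : feasible xi.
  split.
    split => //.
    - move=> i t; have [At|nA] := pselect (A t); last first.
        by rewrite big1// => w _; exact: dead.
      have h : (\sum_(w <- ws) F n (w, i) t) @[n --> \oo] --> \sum_(w <- ws) xi w i t.
        by apply: cvg_sumr => w hw; exact: lim.
      rewrite -(cvg_lim (@Rhausdorff R) h); apply: limr_le; first by apply/cvg_ex; eexists; exact: h.
      by apply: nearW => n; have [_ h2 _ _] := FX n; exact: h2.
    - move=> w i t; apply: contraNN => /eqP al.
      have [hw|hw] := boolP (w \in ws); last by rewrite /xi (negPf hw).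
      have [At|/dead->//] := pselect (A t).
      have h := lim w i t hw At.
      rewrite -(cvg_lim (@Rhausdorff R) h).
      rewrite (_ : (fun n => _) = fun=> 0) ?lim_cst//.
      apply/funext => n; have [_ _ h3 _] := FX n.
      by apply/eqP/negPn/negP => /(h3 w i t); rewrite al eqxx.
    - move=> i; have h := @remainder_cvg (fun n => toXi (F n)) xi FB xB cvF i.
      rewrite -(cvg_lim (@Rhausdorff R) h) (_ : (fun n => _) = fun=> 0) ?lim_cst//.
      by apply/funext => n; have [_ _ _ ->] := FX n.
  move=> b hb.
  have h := @assign_cvg (fun n => toXi (F n)) xi FB xB cvF (fun=> b) (fun _ => hb).
  rewrite -(cvg_lim (@Rhausdorff R) h).
  rewrite (_ : (fun n => _) = fun=> \sum_e II mu (fun t => u e t * b e t)) ?lim_cst//.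
  by apply/funext => n; have [[_ ->]] := PF n.
exists xi => // xi' /vle; apply: le_trans.
have h := @assign_cvg (fun n => toXi (F n)) xi FB xB cvF c cb.
have h2 : v + n.+1%:R^-1 @[n --> \oo] --> v + 0.
  by apply: cvgD; [exact: cvg_cst|exact: cvg_harmonic].
rewrite addr0 in h2; rewrite /cost -(cvg_lim (@Rhausdorff R) h) -(cvg_lim (@Rhausdorff R) h2).
apply: ler_lim; [by apply/cvg_ex; eexists; exact: h|by apply/cvg_ex; eexists; exact: h2|].
by apply: nearW => n; have [_] := PF n.
Qed.

Let bAl w : bm (alive T u w).
Proof.
apply: bm_pathprod => // e.
rewrite (_ : (fun x => _) = fun x => \1_(u e @^-1` (~` [set 0])) x).
  apply: bm_indic; rewrite -[X in measurable X]setTI; apply: (L1_meas (uL e)) => //.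
  exact: measurableC.
apply/funext => x; rewrite indicE; congr ((nat_of_bool _)%:R).
by apply/idP/idP => [h|]; [apply/mem_set => /=; exact/eqP|move/set_mem => /= /eqP].
Qed.

Let al01 w t : 0 <= alive T u w t <= 1.
Proof. by rewrite alive01; case: (_ != 0); rewrite ?lexx ?ler01. Qed.

Let aliveXi : Xi := fun w _ t => alive T u w t.

Let alB : xiB aliveXi.
Proof. by move=> w i; split; [exact: (bm_meas (bAl w))|exact: al01]. Qed.

Let frac_alive xi w i t : fractions xi -> xi w i t <= aliveXi w i t.
Proof.
move=> [h1 _ h3 _]; have [_ /(_ t)/andP[x0 x1]] := h1 w i.
have [->|/h3 al] := eqVneq (xi w i t) 0; first by case/andP: (al01 w t).
by rewrite /aliveXi alive01 al.
Qed.

(* The total load of all alive walks dominates the load of every assignment. *)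
Lemma reference_measure : exists m : {finite_measure set R -> \bar R},
  forall xi, fractions xi -> exists x : E -> R -> R,
   [/\ forall e, measurable_fun setT (x e), forall e t, 0 <= x e t <= 1 &
    forall b, (forall e, bm (b e)) -> assign xi (fun=> b) = \sum_e II m (fun t => x e t * b e t)].
Proof.
pose sA := flatten [seq load_atoms T (atoms aliveXi) e | e <- index_enum E].
have okA : load_ok (atoms aliveXi) by exact: ok_atoms.
have [|m [mA _]] := @atoms_int_measure _ _ _ _ _ mu sA.
  by apply: forall_flatten => e; exact: load_atoms_ok.
have bdel e b : bm b -> forall e', bm (fun t => ((e' == e)%:R * b t : R)).
  by move=> hb e'; apply: bmM => //; exact: bm_cst.
have pE b : bm b -> atoms_int mu sA b = \sum_e assign aliveXi (fun _ e' t => (e' == e)%:R * b t).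
  move=> hb; rewrite /atoms_int /sA big_flatten/= big_map; apply: eq_bigr => e _.
  by rewrite -load_atoms_xi -(atoms_int_load_atoms mT e okA hb).
exists m => xi fxi; have [xB _ _ _] := fxi.
have [|f [mf f01 fE]] := @load_density _ _ T mT (fun=> m) (atoms xi) (ok_atoms xB).
  move=> e A mAA; have bA : bm (fun t : R => \1_A t : R) by exact: bm_indic.
  rewrite mA// lee_fin pE// load_atoms_xi (bigD1 e)//=.
  have nn e' : 0 <= assign aliveXi (fun _ e0 t => (e0 == e')%:R * \1_A t).
    apply: sumr_ge0 => i _; apply: sumr_ge0 => w _; apply: II_ge0 => t.
    rewrite mulr_ge0 ?mulr_ge0//; first by case/andP: (al01 w t).
    by apply: pathsum_ge0 => e0 t0; rewrite mulr_ge0// indicE.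
  rewrite -[leLHS]addr0; apply: lerD; last by apply: sumr_ge0 => e' _.
  apply: assign_mono => //; [by move=> _; exact: bdel|by move=> _; exact: bdel|].
  move=> i w t _; apply: ler_wpM2r; last exact: frac_alive.
  by apply: pathsum_ge0 => e0 t0; rewrite mulr_ge0// indicE.
exists f; split => // b hb.
by rewrite -load_atoms_xi fE.
Qed.

(** Duality is applied to pairs of a cost and a load residual relative to the reference measure. The
    penalty hypothesis is [repair] followed by the optimality of [xs]; as the target is also the
    load of [xs], the multiplier inequality says that [xs] minimises the tolled cost. *)
Lemma optimal_tolls xs : feasible xs -> (forall xi', feasible xi' -> cost xs <= cost xi') ->
  exists p : E -> R -> R, [/\ forall e, bm (p e), forall e t, 0 <= p e t <= c00 &
    forall xi, fractions xi ->
      assign xs (fun i e t => c i e t + p e t) <= assign xi (fun i e t => c i e t + p e t)].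
Proof.
move=> fxs opt; have [m hm] := reference_measure.
have [fs lxs] := fxs; have [ups [mups ups01 upsE]] := hm _ fs.
pose Q (cc : R) (y : E -> R -> R) := exists (xi : Xi) (x : E -> R -> R), [/\ fractions xi,
  forall e, measurable_fun setT (x e) /\ forall t, 0 <= x e t <= 1,
  forall b, (forall e, bm (b e)) -> assign xi (fun=> b) = \sum_e II m (fun t => x e t * b e t),
  cc = cost xi & y = fun e t => x e t - ups e t].
have c000 : 0 <= c00 by rewrite mulr_ge0.
have bups e : bm (ups e) by exact: bm_bnd (mups e) (ups01 e).
have [|||cc y|p [hp pE]] := @duality _ _ _ m E Q (cost xs) c00 c000.
- move=> cc _ [xi [x [h1 h2 h3 h4 ->]]] e; have [mx x01] := h2 e; split.
    exact: measurable_funB.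
  move=> t; have := x01 t; have := ups01 e t; rewrite ler_norml; lra.
- move=> _ _ _ _ t [xi1 [x1 [f1 h1 l1 -> ->]]] [xi2 [x2 [f2 h2 l2 -> ->]]] /andP[t0 t1].
  have B1 : xiB xi1 by case: f1. have B2 : xiB xi2 by case: f2.
  have b1 e : bm (x1 e) by have [hh1 hh2] := h1 e; exact: bm_bnd hh1 hh2.
  have b2 e : bm (x2 e) by have [hh1 hh2] := h2 e; exact: bm_bnd hh1 hh2.
  exists (fun w i x => (1 - t) * xi1 w i x + t * xi2 w i x).
  exists (fun e x => (1 - t) * x1 e x + t * x2 e x); split.
  + by apply: fractions_mix => //; lra.
  + move=> e; split; first by apply: bm_meas; apply: bmD; (apply: bmM => //; exact: bm_cst).
    by move=> x; have [_ /(_ x)] := h1 e; have [_ /(_ x)] := h2 e; nra.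
  + move=> b hb; rewrite (@assign_mix xi1 xi2 _ (1 - t) t)// l1// l2//.
    rewrite !mulr_sumr -big_split/=; apply: eq_bigr => e _.
    have i1 : L1 m (fun x => x1 e x * b e x) by apply: L1_fin; exact: bmM.
    have i2 : L1 m (fun x => x2 e x * b e x) by apply: L1_fin; exact: bmM.
    rewrite -!IIZ// -IID; [|exact: L1Z..].
    by apply: eq_II => x; ring.
  + by rewrite /cost [RHS](@assign_mix xi1 xi2 _ (1 - t) t).
  + by apply/funext => e; apply/funext => x; ring.
- by exists (cost xs), (fun e t => ups e t - ups e t), xs, ups; split.
- move=> [xi [x [h1 h2 h3 -> ->]]].
  have mx e : measurable_fun setT (x e) by have [] := h2 e.
  have x01 e t : 0 <= x e t <= 1 by have [_] := h2 e.
  have uE b : (forall e, bm (b e)) ->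
      \sum_e II mu (fun t => u e t * b e t) = \sum_e II m (fun t => ups e t * b e t).
    by move=> hb; rewrite -lxs// upsE.
  have [xi' fxi' le'] := repair mups ups01 mx x01 uE h1 h3.
  exact: le_trans (opt _ fxi') le'.
have bp e : bm (p e) by have [hh1 hh2] := hp e; exact: bm_bnd hh1 hh2.
exists p; split => //; first by move=> e t; have [_] := hp e.
move=> xi fxi; have [x [mx x01 xE]] := hm _ fxi.
have bx e : bm (x e) by exact: bm_bnd (mx e) (x01 e).
have xsB : xiB xs by case: fs.
have xiB' : xiB xi by case: fxi.
have splitE xi0 : xiB xi0 -> assign xi0 (fun i e t => c i e t + p e t) = cost xi0 + assign xi0 (fun=> p).
  move=> hB; have := @assign_linear xi0 1 c (fun=> p) hB cb (fun _ => bp).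
  rewrite mul1r => <-; congr assign.
  by apply/funext => i; apply/funext => e; apply/funext => t; rewrite mul1r.
rewrite !splitE//.
have := pE (cost xi) (fun e t => x e t - ups e t).
have -> : \sum_e II m (fun t => p e t * (x e t - ups e t)) = assign xi (fun=> p) - assign xs (fun=> p).
  rewrite xE// upsE// -sumrB; apply: eq_bigr => e _; rewrite -IIB.
  - by apply: eq_II => t; ring.
  - by apply: L1_fin; exact: bmM.
  - by apply: L1_fin; exact: bmM.
have h : Q (cost xi) (fun e t => x e t - ups e t) by exists xi, x; split.
by move=> /(_ h); lra.
Qed.

(** Exchange argument: flow may be moved from [w] to [w'] at times when [w'] is alive and strictly
    cheaper. Minimality makes the nonnegative saving integrate to 0, so it vanishes almost
    everywhere. *)
Lemma swap_optimal xs (c' : I -> E -> R -> R) i w w' : (forall i e, bm (c' i e)) ->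
  fractions xs -> (forall xi, fractions xi -> assign xs c' <= assign xi c') ->
  w \in ws -> w' \in ws ->
  {ae mu, forall t, 0 < r i t * xs w i t -> alive T u w' t != 0 ->
    pathsum T (c' i) w t <= pathsum T (c' i) w' t}.
Proof.
move=> bc' fxs opt hw hw'; have [xB x2 x3 x4] := fxs.
have [ww|ww] := eqVneq w w'; first by subst w'; apply: aeW => t _ _.
pose Pw := pathsum T (c' i) w; pose Pw' := pathsum T (c' i) w'.
have bPw : bm Pw by exact: bm_pathsum.
have bPw' : bm Pw' by exact: bm_pathsum.
pose B := [set t | Pw' t < Pw t].
have mB : measurable B.
  rewrite -[B]setTI (_ : B = (fun t => Pw t - Pw' t) @^-1` `]0, +oo[%classic).
    exact: (bm_meas (bmB bPw bPw')).
  by apply/seteqP; split => t /=; rewrite in_itv/= andbT subr_gt0.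
(* Indicator of the times at which the move is both allowed and profitable. *)
pose S t := alive T u w' t * \1_B t.
have bS : bm S by apply: bmM => //; exact: bm_indic.
have S01 t : 0 <= S t <= 1.
  have /andP[a0 a1] := al01 w' t; rewrite /S indicE.
  by case: (_ \in _); rewrite ?mulr1 ?mulr0 ?a0 ?a1 ?lexx ?ler01.
(* Sign of the transfer: +1 on [w'], -1 on [w], for commodity [i] only. *)
pose k v j : R := (j == i)%:R * ((v == w')%:R - (v == w)%:R).
pose D t := xs w i t * S t.
have xw0 t : 0 <= xs w i t <= 1 by have [_ /(_ t)] := xB w i.
have bD : bm D by apply: bmM => //; exact: bm_xi.
have D0 t : 0 <= D t by have /andP[a _] := xw0 t; have /andP[b _] := S01 t; rewrite mulr_ge0.
have Dle t : D t <= xs w i t by have /andP[a _] := xw0 t; have /andP[_ b] := S01 t; rewrite ler_piMr.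
pose xn : Xi := fun v j t => xs v j t + k v j * D t.
have pick v (F : seq E -> R) : v \in ws -> \sum_(v0 <- ws) (v0 == v)%:R * F v0 = F v.
  move=> hv; rewrite (bigD1_seq v)//=; last exact: uniq_walks.
  by rewrite eqxx mul1r big1 ?addr0// => v0 /negPf ->; rewrite mul0r.
have sumk j (F : seq E -> R) : \sum_(v <- ws) k v j * F v = (j == i)%:R * (F w' - F w).
  rewrite -[F w'](pick w')// -[F w in RHS](pick w)// -sumrB mulr_sumr.
  by apply: eq_bigr => v _; rewrite /k; ring.
have sumxn j t : \sum_(v <- ws) xn v j t = \sum_(v <- ws) xs v j t.
  rewrite big_split/= (sumk j (fun=> D t)) subrr mulr0 addr0//.
have xn0 v j t : 0 <= xn v j t.
  have [_ /(_ t)/andP[a _]] := xB v j; rewrite /xn /k.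
  have [ji|ji] := eqVneq j i; last by rewrite mul0r mul0r addr0.
  have [vw|vw] := eqVneq v w.
    by rewrite vw (negPf ww) mul1r sub0r mulN1r subr_ge0 ji Dle.
  by rewrite subr0 mul1r addr_ge0// mulr_ge0.
have bk v j : bm (fun t => k v j * D t) by apply: bmM => //; exact: bm_cst.
have fxn : fractions xn.
  split.
  - move=> v j; split; first by apply: bm_meas; apply: bmD; [exact: bm_xi|exact: bk].
    move=> t; rewrite xn0/=; have [hv|hv] := boolP (v \in ws).
      apply: le_trans (x2 j t); rewrite -sumxn (big_rem v)//= lerDl.
      by apply: sumr_ge0 => v' _.
    have [vw|_] := eqVneq v w; first by rewrite vw hw in hv.
    rewrite /xn /k; have [vw|vw] := eqVneq v w'; first by rewrite vw hw' in hv.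
    have [vw2|vw2] := eqVneq v w; first by rewrite vw2 hw in hv.
    by rewrite subrr mulr0 mul0r addr0; have [_ /(_ t)/andP[]] := xB v j.
  - by move=> j t; rewrite sumxn.
  - move=> v j t; have [h|h _] := eqVneq (xs v j t) 0; last exact: x3 h.
    have [vw|vw] := eqVneq v w'.
      rewrite /xn h add0r mulf_eq0 negb_or => /andP[_].
      by rewrite /D mulf_eq0 negb_or => /andP[_]; rewrite /S mulf_eq0 negb_or vw => /andP[].
    rewrite /xn h add0r /k (negPf vw) sub0r.
    have [vw2|vw2] := eqVneq v w; last by rewrite oppr0 mulr0 mul0r eqxx.
    have [ji|ji] := eqVneq j i; last by rewrite mul0r mul0r eqxx.
    by rewrite /D -vw2 -ji h mul0r mulr0 eqxx.
  - move=> j; rewrite -[RHS](x4 j); apply: eq_II => t; by rewrite sumxn.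
have := opt _ fxn.
have Lx v j := L1_xib v j xB (bc' j).
have LD v j : L1 mu (fun t => r j t * D t * pathsum T (c' j) v t).
  by apply: L1M; [apply: L1M|exact: bm_pathsum].
have -> : assign xn c' = assign xs c' + II mu (fun t => r i t * D t * (Pw' t - Pw t)).
  rewrite /assign.
  under eq_bigr => j _.
    under eq_bigr => v _.
      rewrite (eq_II (mu := mu) (g := fun t => r j t * xs v j t * pathsum T (c' j) v t +
        k v j * (r j t * D t * pathsum T (c' j) v t))); last by move=> t; rewrite /xn; ring.
      rewrite IID//; last exact: L1Z.
      rewrite IIZ//.
      over.
    rewrite big_split/= (sumk j (fun v => II mu (fun t => r j t * D t * pathsum T (c' j) v t))).
    over.
  rewrite big_split/=; congr (_ + _).
  rewrite (bigD1 i)//= eqxx mul1r big1 ?addr0; last by move=> j /negPf ->; rewrite mul0r.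
  rewrite -IIB//; apply: eq_II => t; rewrite /Pw /Pw'; ring.
rewrite lerDl => ge0.
have Ln : L1 mu (fun t => r i t * D t * (Pw t - Pw' t)).
  by apply: L1M; [apply: L1M|apply: bmB].
have nn t : 0 <= r i t * D t * (Pw t - Pw' t).
  rewrite /D /S indicE; have [tB|tB] := boolP (t \in B); last by rewrite !mulr0 mul0r.
  have /andP[a0 _] := al01 w' t; have /andP[b0 _] := xw0 t.
  rewrite mulr1 !mulr_ge0// subr_ge0; move: tB; rewrite inE /B /=; exact: ltW.
have z0 : II mu (fun t => r i t * D t * (Pw t - Pw' t)) = 0.
  apply: le0_II_eq0 => //; rewrite -oppr_ge0 -mulN1r -IIZ//.
  rewrite (eq_II (mu := mu) (g := fun t => r i t * D t * (Pw' t - Pw t)))// => t; ring.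
move: (II_eq0_ae Ln nn z0); apply: ae_mp => t h hr al.
rewrite leNgt; apply/negP => lt.
move: h; rewrite /D /S indicE mem_set// mulr1 mulrA => /eqP.
by rewrite mulf_eq0 subr_eq0 (gt_eqF lt) orbF mulf_eq0 (gt_eqF hr) (negPf al).
Qed.

(** [swap_optimal] compares only with alive walks; the dead ones, which include all long walks, are
    priced out by an additional toll. *)
Lemma tolls_exist : exists (p : E -> R -> R) (xi : Xi),
  [/\ forall e, bm (p e), forall e t, 0 <= p e t, feasible xi &
   {ae mu, forall t, forall w i w', w \in ws -> 0 < r i t * xi w i t ->
      is_walk_from tail head s d w' ->
      pathsum T (fun e x => c i e x + p e x) w t <= pathsum T (fun e x => c i e x + p e x) w' t}].
Proof.
have [xs fxs opt] := minimizer.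
have [p [bp p01 hp]] := optimal_tolls fxs opt.
have [fs _] := fxs.
pose M := N.+1%:R * (`|Cc| + c00).
have c000 : 0 <= c00 by rewrite mulr_ge0.
have M0 : 0 <= M by rewrite mulr_ge0// addr_ge0.
(* The extra toll [M] is charged only where [u] vanishes. Alive walks do not pay it, and a dead walk
   pays it at least once, which already exceeds or equals the cost under [c + p] of any walk in
   [ws]. *)
pose p' e t := p e t + M * (1 - (u e t != 0)%:R).
have bu e : bm (fun t => ((u e t != 0)%:R : R)).
  have := bAl [:: e]; rewrite /alive /=.
  by rewrite (_ : (fun t => _ * 1) = fun t => (u e t != 0)%:R)//; apply/funext => t; rewrite mulr1.
have bp' e : bm (p' e).
  by apply: bmD => //; apply: bmM; [exact: bm_cst|apply: bmB; [exact: bm_cst|exact: bu]].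
have p'0 e t : 0 <= p' e t.
  have /andP[h _] := p01 e t; rewrite addr_ge0// mulr_ge0//.
  by case: (_ != 0); rewrite ?subrr ?subr0.
exists p', xs; split => //.
pose c' i e t := c i e t + p e t.
have bc' i e : bm (c' i e) by exact: bmD.
have ae1 : {ae mu, forall t, forall w, w \in ws -> forall w', w' \in ws -> forall i, i \in enum I ->
    0 < r i t * xs w i t -> alive T u w' t != 0 -> pathsum T (c' i) w t <= pathsum T (c' i) w' t}.
  apply: ae_all_seq => w hw; apply: ae_all_seq => w' hw'; apply: ae_all_seq => i _.
  exact: swap_optimal.
move: ae1; apply: ae_mp => t h w i w' hw hr hw'.
have [_ _ x3 _] := fs.
have alw : alive T u w t != 0.
  by apply: (x3 w i t); apply: contraTneq hr => ->; rewrite mulr0 ltxx.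
have same v : alive T u v t != 0 ->
    pathsum T (fun e x => c i e x + p' e x) v t = pathsum T (c' i) v t.
  by apply: eq_pathsum_alive => e x h0; rewrite /c' /p' h0 subrr mulr0 addr0.
rewrite same//; have [al|al] := eqVneq (alive T u w' t) 0.
  have le1 : pathsum T (c' i) w t <= M.
    apply: le_trans (pathsum_le_size T w t (C := `|Cc| + c00) _) _.
      move=> e x; have /andP[_ h1] := cC i e x; have /andP[_ h2] := p01 e x.
      by rewrite lerD// (le_trans h1)// ler_norm.
    by rewrite ler_wpM2r ?addr_ge0//; exact: walk_size.
  apply: le_trans le1 _; apply: (dead_pathsum _ _ al).
    by move=> e x; rewrite addr_ge0//; case/andP: (cC i e x).
  move=> e x ue; rewrite /p' ue eqxx subr0 mulr1 addrA lerDr addr_ge0//.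
    by case/andP: (cC i e x).
  by case/andP: (p01 e x).
rewrite same//; apply: h => //; last by rewrite mem_enum.
(* By [alive_size] a nonempty alive walk has at most [N] edges, so it belongs to [ws]. *)
rewrite mem_walks hw'/=; have [->//|wn] := eqVneq w' [::].
have [t0 ht] := alive_size (ltW tau0) us uT wn al.
have : (size w').-1%:R * tau < N%:R * tau by apply: le_lt_trans hN; move: ht; lra.
by rewrite ltr_pM2r// ltr_nat; case: (size w') => //= n /ltnW.
Qed.

End LP.

(** * First-in-first-out routing *)

Section Indicators.
Context (R : realType).

Lemma bm_le (F : R -> R) (t : R) : measurable_fun setT F ->
  bm (fun x => ((F x <= t)%R%:R : R)).
Proof.
move=> mF; rewrite (_ : (fun _ => _) = fun x => \1_(F @^-1` `]-oo, t]%classic) x).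
  by apply: bm_indic; rewrite -[X in measurable X]setTI; exact: mF.
apply/funext => x; rewrite indicE; congr ((nat_of_bool _)%:R).
by apply/idP/idP => [h|]; [apply/mem_set; rewrite /= in_itv|move/set_mem; rewrite /= in_itv].
Qed.

Lemma bm_le_id (t : R) : bm (fun x : R => ((x <= t)%R%:R : R)).
Proof. exact: (@bm_le id). Qed.

End Indicators.

(** * Change of variable by the cumulative flow *)

Section TimeChange.
Context (R : realType).
Local Notation mu := (@lebesgue_measure R).
Variable (tf : R).
Hypothesis tf0 : 0 <= tf.
Implicit Types n f : R -> R.

Definition density_on f :=
  [/\ L1 mu f, forall t, 0 <= f t & forall t, f t != 0 -> 0 <= t <= tf].

Definition cum f t := II mu (fun x => f x * (x <= t)%R%:R).

Lemma cum_L1 f t : density_on f -> L1 mu (fun x => f x * (x <= t)%R%:R).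
Proof. by move=> [h _ _]; apply: L1M => //; exact: bm_le_id. Qed.

Lemma cum_ge0 f t : density_on f -> 0 <= cum f t.
Proof. by move=> [_ h _]; apply: II_ge0 => x; rewrite mulr_ge0. Qed.

Lemma cum_mono f s t : density_on f -> s <= t -> cum f s <= cum f t.
Proof.
move=> hf st; have [_ h _] := hf; apply: le_II; [exact: cum_L1..|] => x.
by rewrite ler_wpM2l// ler_nat; case: (leP x s) => // /le_trans ->.
Qed.

Lemma cum_ge_tf f t : density_on f -> tf <= t -> cum f t = II mu f.
Proof.
move=> [_ _ h] tft; apply: eq_II => x; have [->|/h/andP[_ h1]] := eqVneq (f x) 0.
  by rewrite mul0r.
by rewrite (le_trans h1 tft) mulr1.
Qed.

Lemma cum_le_II f t : density_on f -> cum f t <= II mu f.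
Proof.
move=> hf; have [hL h _] := hf; apply: le_II => //; first exact: cum_L1.
by move=> x; rewrite ler_piMr// lern1 leq_b1.
Qed.

Lemma cum_lt0 f t : density_on f -> t < 0 -> cum f t = 0.
Proof.
move=> [_ _ h] t0; rewrite -[RHS](II0 mu); apply: eq_II => x.
have [->|/h/andP[h1 _]] := eqVneq (f x) 0; first by rewrite mul0r.
by rewrite leNgt (lt_le_trans t0 h1) mulr0.
Qed.

Lemma cum_itv f t : density_on f -> cum f t = \int[mu]_(x in `[0, t]) f x.
Proof.
move=> [_ _ h]; rewrite Rintegral_mkcond; apply: eq_II => x.
rewrite patchE mem_setE in_itv/=.
have [->|/h/andP[h1 _]] := eqVneq (f x) 0; first by rewrite mul0r if_same.
by rewrite h1/=; case: ifP => _; rewrite ?mulr1 ?mulr0.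
Qed.

Lemma cum_at0 f : density_on f -> cum f 0 = 0.
Proof. by move=> hf; rewrite cum_itv// set_itv1 Rintegral_set1. Qed.

Lemma cum_IVT f x : density_on f -> 0 <= x <= II mu f -> exists2 c, 0 <= c <= tf & cum f c = x.
Proof.
move=> hf /andP[x0 x1].
have cont : {within `[0, tf], continuous (cum f)}.
  rewrite (_ : cum f = fun t => \int[mu]_(x in `[0, t]) f x).
    apply: parameterized_integral_continuous => //.
    by have [hL _ _] := hf; exact: (integrableS measurableT).
  by apply/funext => t; exact: cum_itv.
have := @IVT _ _ 0 tf x tf0 cont.
rewrite (cum_at0 hf) (cum_ge_tf hf (lexx _)) min_l ?max_r ?(le_trans x0 x1)//.
by rewrite x0 x1 => /(_ isT)[c]; rewrite in_itv/=; exists c.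
Qed.

Lemma cum_measurable f : density_on f -> measurable_fun setT (cum f).
Proof. by move=> hf; apply: nondecreasing_measurable => // s t st; exact: cum_mono. Qed.

Definition interval_density (x : R) : R -> R := fun y => \1_(`[0, x]%classic) y.

Lemma L1_interval x : L1 mu (interval_density x).
Proof. exact: integrable_indic_itv. Qed.

Lemma II_interval x : 0 <= x -> II mu (interval_density x) = x.
Proof.
move=> x0; rewrite /II /Rintegral /interval_density integral_indic//= setIT lebesgue_measure_itv/= lte_fin.
have [->|xn] := eqVneq x 0; first by rewrite ltxx.
by rewrite lt_neqAle eq_sym xn x0/= oppr0 addr0.
Qed.

(** Continuity of [cum f] makes it attain every level. Where it is flat at height [x] the sublevel
    set exceeds an initial segment, so the upper bound is obtained from slightly higher levels
    [y]. *)
Lemma time_change_le f x : density_on f -> 0 <= x <= II mu f ->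
  II mu (fun t => f t * (cum f t <= x)%R%:R) = x.
Proof.
move=> hf hx; have [hL h0 hs] := hf; have [c c01 cx] := cum_IVT hf hx.
have mN := cum_measurable hf.
have LN y : L1 mu (fun t => f t * (cum f t <= y)%R%:R) by apply: L1M => //; exact: bm_le.
apply/eqP; rewrite eq_le; apply/andP; split; last first.
  rewrite -{1}cx; apply: le_II => //; first exact: cum_L1.
  move=> t; rewrite ler_wpM2l// ler_nat; case: (leP t c) => // /(cum_mono hf).
  by rewrite cx => ->.
have [xI|xI] := eqVneq x (II mu f).
  rewrite {2}xI; apply: le_II => // t; rewrite ler_piMr//.
  by rewrite lern1 leq_b1.
apply/ler_addgt0Pr => e e0.
pose y := Num.min (x + e) (II mu f).
have /andP[x0 x1] := hx.
have xy : x < y by rewrite /y lt_min ltrDl e0 lt_neqAle xI.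
have hy : 0 <= y <= II mu f by rewrite (le_trans x0 (ltW xy)) /y ge_min lexx orbT.
have [c' _ cy] := cum_IVT hf hy.
apply: (@le_trans _ _ y); last by rewrite /y ge_min lexx.
rewrite -cy; apply: le_II => //; first exact: cum_L1.
move=> t; rewrite ler_wpM2l// ler_nat; case: (leP t c') => //; first by case: (_ <= x).
move=> /ltW/(cum_mono hf); rewrite cy => h.
by rewrite leNgt (lt_le_trans xy h).
Qed.

(* Probability integral transform: the density [f] pushed forward by its own
   cumulative function is Lebesgue measure on [0, II f]. *)
Lemma time_change f psi : density_on f -> bm psi ->
  II mu (fun t => f t * psi (cum f t)) = II mu (fun x => interval_density (II mu f) x * psi x).
Proof.
move=> hf hpsi; have [hL h0 hs] := hf.
have I0 : 0 <= II mu f by exact: II_ge0.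
have i0 x : 0 <= interval_density (II mu f) x by rewrite /interval_density indicE.
have mN := cum_measurable hf.
have E (s : (R -> R) * (R -> R)) (b : R -> R) : atoms_int mu [:: s] b = II mu (fun x => s.1 x * b (s.2 x)) by rewrite /atoms_int big_seq1.
rewrite -(E (f, cum f)) -(E (interval_density (II mu f), id : R -> R)).
apply: push_ext => //.
- by constructor; [split|constructor].
- by constructor; [apply: atom_id => //; exact: L1_interval|constructor].
- rewrite !E/= (eq_II (mu := mu) (g := f)); last by move=> x; rewrite mulr1.
  rewrite (eq_II (mu := mu) (f := fun x => _ * 1) (g := interval_density (II mu f))); last by move=> x; rewrite mulr1.
  by rewrite II_interval.
move=> t; rewrite !E/=.
have [t0|t0] := ltP t 0.
  rewrite (eq_II (mu := mu) (g := fun=> 0)); last first.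
    by move=> x; rewrite leNgt (lt_le_trans t0 (cum_ge0 _ hf)) mulr0.
  rewrite II0 -[LHS](II0 mu); apply: eq_II => x.
  rewrite /interval_density indicE mem_setE in_itv/=.
  case: (leP 0 x) => x0; last by rewrite mul0r.
  by rewrite [x <= t]leNgt (lt_le_trans t0 x0) mulr0.
have [t1|t1] := leP t (II mu f).
  rewrite time_change_le ?t0// -{1}(II_interval t0); apply: eq_II => x.
  rewrite /interval_density !indicE !mem_setE !in_itv/=.
  case: (leP 0 x) => _ /=; last by rewrite mul0r.
  case: (leP x t) => xt; last by rewrite mulr0.
  by rewrite (le_trans xt t1) mulr1.
transitivity (II mu f).
  by apply: eq_II => x; rewrite (le_trans (cum_le_II _ hf) (ltW t1)) mulr1.
rewrite -{1}(II_interval I0); apply: eq_II => x.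
rewrite /interval_density indicE mem_setE in_itv/=.
case: (leP 0 x) => _ /=; last by rewrite mul0r.
case: (leP x (II mu f)) => h; last by rewrite mul0r.
by rewrite (le_trans h (ltW t1)) mulr1.
Qed.

(** The conditions [s <= t] and [cum f s <= cum f t] differ only on a set without mass for [f],
    which reduces the claim to [time_change] with a truncated [psi]. *)
Lemma time_change_cum f psi t : density_on f -> bm psi ->
  II mu (fun s => f s * psi (cum f s) * (s <= t)%R%:R) =
  II mu (fun x => interval_density (cum f t) x * psi x).
Proof.
move=> hf hpsi; have [hL h0 hs] := hf; have mN := cum_measurable hf.
have bpsi : bm (fun s => psi (cum f s)) by exact: bm_comp.
have bN y : bm (fun s => ((cum f s <= y)%R%:R : R)) by exact: bm_le.
have Nt : 0 <= cum f t <= II mu f by rewrite cum_ge0// cum_le_II.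
have ae0 : {ae mu, forall s, f s * ((cum f s <= cum f t)%R%:R - (s <= t)%R%:R) = 0}.
  apply: II_eq0_ae.
  - by apply: L1M => //; apply: bmB; [exact: bN|exact: bm_le_id].
  - move=> s; rewrite mulr_ge0// subr_ge0 ler_nat.
    by case: (leP s t) => // /(cum_mono hf) ->.
  rewrite (eq_II (mu := mu) (g := fun s => f s * (cum f s <= cum f t)%R%:R - f s * (s <= t)%R%:R)); last first.
    by move=> s; ring.
  rewrite IIB; [|exact: (L1M hL (bN _))|exact: cum_L1].
  by rewrite time_change_le// subrr.
transitivity (II mu (fun s => f s * (psi (cum f s) * (cum f s <= cum f t)%R%:R))).
  apply: ae_eq_II.
  - by apply: L1M; [exact: (L1M hL bpsi)|exact: bm_le_id].
  - by apply: L1M => //; exact: (bmM bpsi (bN _)).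
  move: ae0; apply: ae_mp => s /eqP; rewrite mulf_eq0 => /orP[/eqP ->|]; first by rewrite !mul0r.
  by rewrite subr_eq0 => /eqP ->; rewrite mulrA.
rewrite (@time_change f (fun x => psi x * (x <= cum f t)%R%:R))//; last first.
  by apply: bmM => //; exact: bm_le_id.
apply: eq_II => x; rewrite /interval_density !indicE !mem_setE !in_itv/=.
case: (leP 0 x) => x0; last by rewrite !mul0r.
case: (leP x (cum f t)) => h /=; last by rewrite !mulr0 mul0r.
have /andP[_ N1] := Nt.
by rewrite (le_trans h N1) mulr1.
Qed.

End TimeChange.

Section ClampCompare.
Context (R : realType).
Local Notation mu := (@lebesgue_measure R).
Variable (tf : R).
Hypothesis tf0 : 0 < tf.

(** Truncation to the horizon, needed because arrivals are compared only up to [tf] and travel times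
    are specified only on [[0, tf]]. *)
Definition clamp (y : R) := Num.max 0 (Num.min tf y).

Lemma clamp_itv y : 0 <= clamp y <= tf.
Proof. by rewrite /clamp le_max lexx/= ge_max (ltW tf0)/= ge_min lexx. Qed.

Lemma clamp_id y : 0 <= y <= tf -> clamp y = y.
Proof. by move=> /andP[h1 h2]; rewrite /clamp (min_r h2) max_r. Qed.

Lemma clamp_mono x y : x <= y -> clamp x <= clamp y.
Proof.
move=> xy; rewrite /clamp ge_max !le_max lexx/=; apply/orP; right.
by rewrite le_min !ge_min lexx xy orbT.
Qed.

Lemma clamp_sub_mono x y : x <= y -> x - clamp x <= y - clamp y.
Proof.
move=> xy; rewrite /clamp; case: (leP tf x) => hx; case: (leP tf y) => hy;
  rewrite ?(max_r (ltW tf0)); try lra; rewrite /Num.max; do ?case: ifPn; rewrite -?leNgt => *; lra.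
Qed.

Lemma bm_clamp (X : R -> R) : measurable_fun setT X -> bm (fun x => clamp (X x)).
Proof.
move=> mX; apply: (@bm_bnd _ _ _ _ tf); last by move=> x; exact: clamp_itv.
by apply: measurable_maxr => //; exact: measurable_minr.
Qed.

Let stair (del : R) n (y : R) := \sum_(k < n) del * (1 - (y <= k%:R * del)%R%:R).

Let stairP del n y : 0 < del -> 0 <= y ->
  [/\ Num.min y (n%:R * del) <= stair del n y, stair del n y <= n%:R * del &
      stair del n y <= y + del].
Proof.
move=> d0 y0; elim: n => [|n [h1 h2 h3]].
  by rewrite /stair big_ord0 mul0r min_r// lexx addr_ge0// ltW.
rewrite /stair big_ord_recr/= -/(stair del n y) -natr1 mulrDl mul1r.
case: (leP y (n%:R * del)) => hy.
  rewrite subrr mulr0 addr0; rewrite min_l in h1 => //.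
  rewrite min_l; last by lra.
  by split => //; lra.
rewrite subr0 mulr1; rewrite min_r in h1; last exact: ltW.
by split; [rewrite ge_min; apply/orP; right; lra|lra|lra].
Qed.

(* Stochastic dominance, with the staircase functions as intermediate test functions. *)
Lemma clamp_compare (f1 f2 X1 X2 : R -> R) : density_on tf f1 -> density_on tf f2 ->
  measurable_fun setT X1 -> measurable_fun setT X2 ->
  (forall x, f1 x != 0 -> 0 <= X1 x) -> (forall x, f2 x != 0 -> 0 <= X2 x) ->
  II mu f1 = II mu f2 ->
  (forall t, 0 <= t <= tf ->
    II mu (fun x => f2 x * (X2 x <= t)%R%:R) <= II mu (fun x => f1 x * (X1 x <= t)%R%:R)) ->
  II mu (fun x => f1 x * clamp (X1 x)) <= II mu (fun x => f2 x * clamp (X2 x)).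
Proof.
move=> [L1f1 f10 s1] [L1f2 f20 s2] m1 m2 p1 p2 tot dom.
have stairE (f X : R -> R) (del : R) n : L1 mu f -> measurable_fun setT X ->
    II mu (fun x => f x * stair del n (X x)) =
    \sum_(k < n) del * (II mu f - II mu (fun x => f x * (X x <= k%:R * del)%R%:R)).
  move=> Lf mX.
  have Lk (k : R) : L1 mu (fun x => f x * (X x <= k)%R%:R) by apply: L1M => //; exact: bm_le.
  rewrite (eq_II (mu := mu) (g := fun x => \sum_(k < n) del * (f x - f x * (X x <= k%:R * del)%R%:R))); last first.
    by move=> x; rewrite /stair mulr_sumr; apply: eq_bigr => k _; ring.
  rewrite II_sum; last by move=> k _; apply: L1Z; exact: L1B.
  by apply: eq_bigr => k _; rewrite IIZ ?IIB//; exact: L1B.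
have bst (X : R -> R) (del : R) n : measurable_fun setT X -> bm (fun x => stair del n (X x)).
  move=> mX; apply: bm_sum => k _; apply: bmM; first exact: bm_cst.
  by apply: bmB; [exact: bm_cst|exact: bm_le].
apply/ler_addgt0Pr => e e0.
have M0 : 0 <= II mu f2 by exact: II_ge0.
(* The mesh is so fine that the staircase error, [del] per unit of mass, is at most [e] in total. *)
pose n := (Num.truncn (tf * II mu f2 / e)).+1.
have n0 : 0 < n%:R :> R by rewrite ltr0n.
pose del := tf / n%:R.
have d0 : 0 < del by rewrite divr_gt0.
have nd : n%:R * del = tf by rewrite /del mulrC divfK// gt_eqF.
have small : del * II mu f2 <= e.
  have /andP[_ h] := truncn_itv (divr_ge0 (mulr_ge0 (ltW tf0) M0) (ltW e0)).
  move: h; rewrite -/n ltr_pdivrMr// => h.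
  by rewrite /del mulrAC ler_pdivrMr// [e * _]mulrC ltW.
have cl y : 0 <= y -> clamp y = Num.min y (n%:R * del).
  by move=> y0; rewrite nd /clamp minC max_r// le_min y0 ltW.
apply: (@le_trans _ _ (II mu (fun x => f1 x * stair del n (X1 x)))).
  apply: le_II => [||x]; [by apply: L1M => //; exact: bm_clamp|by apply: L1M => //; exact: bst|].
  have [->|/p1 h] := eqVneq (f1 x) 0; first by rewrite !mul0r.
  by rewrite ler_wpM2l// cl//; have [] := stairP n d0 h.
apply: (@le_trans _ _ (II mu (fun x => f2 x * stair del n (X2 x)))).
  rewrite !stairE//; apply: ler_sum => k _; rewrite ler_pM2l// tot lerD2l lerN2.
  apply: dom; rewrite mulr_ge0 ?(ltW d0)//= -nd ler_pM2r// ler_nat; exact: ltnW.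
apply: (@le_trans _ _ (II mu (fun x => f2 x * clamp (X2 x) + del * f2 x))).
  apply: le_II => [||x]; first by apply: L1M => //; exact: bst.
    by apply: L1D; [apply: L1M => //; exact: bm_clamp|exact: L1Z].
  have [->|/p2 h] := eqVneq (f2 x) 0; first by rewrite !mul0r mulr0 addr0.
  rewrite mulrC [f2 x * _]mulrC -mulrDl ler_wpM2r// cl//.
  have [_ h2 h3] := stairP n d0 h.
  rewrite /Num.min; case: ifP => _; first exact: h3.
  by rewrite (le_trans h2)// lerDl ltW.
rewrite IID; [|by apply: L1M => //; exact: bm_clamp|exact: L1Z].
by rewrite IIZ// lerD2l.
Qed.

End ClampCompare.

(** * Re-routing a flow in order of arrival *)

Section Fifo.
Context (R : realType) (V E : finType) (tail head : E -> V).
Local Notation mu := (@lebesgue_measure R).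
Variables (s d : V) (tf' tf tau : R).
Hypothesis tf'0 : 0 <= tf'.
Hypothesis tf'f : tf' < tf.
Hypothesis tau0 : 0 < tau.
Local Notation gd := (density_on tf).
Variable TT : E -> (R -> R) -> R -> R.
Hypothesis T1 : forall e f, gd f -> measurable_fun setT (TT e f).
Hypothesis T2 : forall e f t, gd f -> t <= TT e f t.
Hypothesis T3 : forall e f t, gd f -> 0 <= t <= tf' -> t + tau <= TT e f t.
Hypothesis Tm : forall e f x y, gd f -> 0 <= x -> x <= y -> y <= tf -> TT e f x <= TT e f y.
Hypothesis Tb : forall e f, gd f -> bm (fun t => TT e f t - t).
Hypothesis T4 : forall e f, gd f -> exists2 fm, gd fm & forall t, 0 <= t <= tf ->
  II mu (fun x => f x * (TT e f x <= t)%R%:R) = cum fm t.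
Hypothesis T5 : forall e f g, gd f -> gd g -> (forall t, 0 <= t <= tf -> cum g t <= cum f t) ->
  forall t, 0 <= t <= tf ->
  II mu (fun x => g x * (TT e g x <= t)%R%:R) <= II mu (fun x => f x * (TT e f x <= t)%R%:R).
Hypothesis T6 : forall e f g, gd f -> gd g -> (forall t, g t <= f t) ->
  forall t, 0 <= t <= tf -> TT e g t <= TT e f t.
Hypothesis T7 : forall e f g, gd f -> gd g -> {ae mu, forall t, f t = g t} -> TT e f = TT e g.

(** [uu] is the flow to be improved. It is conserved for the exit times [S] of a larger flow, which
    only bound its own exit times from above. *)
Variables (uu : E -> R -> R) (S : E -> R -> R) (rho : R -> R).
Hypothesis ug : forall e, gd (uu e).
Hypothesis us : forall e t, uu e t != 0 -> t <= tf'.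
Hypothesis ud : forall e t, tail e = d -> uu e t = 0.
Hypothesis rg : gd rho.
Hypothesis mS : forall e, measurable_fun setT (S e).
Hypothesis S2 : forall e t, t <= S e t.
Hypothesis Sb : forall e, bm (fun t => S e t - t).
Hypothesis TS : forall e t, 0 <= t <= tf -> TT e (uu e) t <= S e t.
Hypothesis exitS : forall e, II mu (fun t => uu e t * (S e t <= tf)%R%:R) = II mu (uu e).
Hypothesis WCu : forall beta : V -> R -> R, (forall v, bm (beta v)) -> (forall t, beta d t = 0) ->
  \sum_e II mu (fun t => uu e t * beta (tail e) t) =
  II mu (fun t => rho t * beta s t) + \sum_e II mu (fun t => uu e t * beta (head e) (S e t)).

Let tf0 : 0 < tf. Proof. exact: le_lt_trans tf'f. Qed.

Let out e f t := II mu (fun x => f x * (TT e f x <= t)%R%:R).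

Let out_L1 e f t : gd f -> L1 mu (fun x => f x * (TT e f x <= t)%R%:R).
Proof. by move=> hf; have [h _ _] := hf; apply: L1M => //; apply: bm_le; exact: T1. Qed.

Let out_le e f t : gd f -> out e f t <= II mu f.
Proof.
move=> hf; have [h f0 _] := hf; apply: le_II => //; first exact: out_L1.
by move=> x; rewrite ler_piMr// lern1 leq_b1.
Qed.

Let gd_ext f g : (forall t, f t = g t) -> gd f -> gd g.
Proof. by move=> /funext ->. Qed.

Let gd_sum (s' : seq E) (P : pred E) (f : E -> R -> R) : (forall e, P e -> gd (f e)) ->
  gd (fun t => \sum_(e <- s' | P e) f e t).
Proof.
move=> h; split.
- by apply: L1_sum => e /h[].
- by move=> t; apply: sumr_ge0 => e /h[].
- move=> t; apply: contraNT => ht; apply/eqP; rewrite big1// => e /h[_ _ hh].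
  by apply/eqP; apply: contraNT ht => /hh.
Qed.

Let gdD f g : gd f -> gd g -> gd (fun t => f t + g t).
Proof.
move=> [a1 a2 a3] [b1 b2 b3]; split; [exact: L1D|by move=> t; rewrite addr_ge0|].
move=> t; have [->|/a3//] := eqVneq (f t) 0; rewrite add0r; exact: b3.
Qed.

Let gdM f b : gd f -> bm b -> (forall t, 0 <= b t) -> gd (fun t => f t * b t).
Proof.
move=> [a1 a2 a3] hb b0; split; [exact: L1M|by move=> t; rewrite mulr_ge0|].
by move=> t; rewrite mulf_eq0 negb_or => /andP[/a3].
Qed.

Let gd0 : gd (fun=> 0).
Proof. by split => //; [exact: L1_cst0|move=> t; rewrite eqxx]. Qed.

Let through v t := \sum_(e | tail e == v) uu e t.
Let gd_through v : gd (through v). Proof. by apply: gd_sum. Qed.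

Let cum_sum (P : pred E) (f : E -> R -> R) t : (forall e, P e -> gd (f e)) ->
  cum (fun x => \sum_(e | P e) f e x) t = \sum_(e | P e) cum (f e) t.
Proof.
move=> h; rewrite /cum -II_sum; last by move=> e /h he; exact: (cum_L1 _ he).
by apply: eq_II => x; rewrite mulr_suml.
Qed.

Let node v (b : R -> R) : V -> R -> R := fun v' x => (v' == v)%:R * b x.

Let conserve v (b : R -> R) : v != d -> bm b ->
  II mu (fun t => through v t * b t) = (v == s)%:R * II mu (fun t => rho t * b t) +
  \sum_(e | head e == v) II mu (fun t => uu e t * b (S e t)).
Proof.
move=> vd hb; have [rL _ _] := rg.
have L e : L1 mu (fun t => uu e t * b t) by have [h _ _] := ug e; exact: L1M.
have LS e : L1 mu (fun t => uu e t * b (S e t)).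
  by have [h _ _] := ug e; exact: (L1M h (bm_comp hb (mS e))).
have bN v' : bm (node v b v') by apply: bmM; [exact: bm_cst|exact: hb].
have nd t : node v b d t = 0 by rewrite /node eq_sym (negPf vd) mul0r.
have := WCu bN nd.
have -> : \sum_e II mu (fun t => uu e t * node v b (tail e) t) = II mu (fun t => through v t * b t).
  rewrite [RHS](eq_II (mu := mu) (g := fun t => \sum_(e | tail e == v) uu e t * b t)); last first.
    by move=> t; rewrite mulr_suml.
  rewrite II_sum// [RHS]big_mkcond/=; apply: eq_bigr => e _; rewrite /node.
  case: eqP => _; first by apply: eq_II => t; rewrite mul1r.
  by rewrite -[RHS](II0 mu); apply: eq_II => t; rewrite mul0r mulr0.
move=> ->; congr (_ + _).
  rewrite -IIZ; last exact: L1M.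
  by apply: eq_II => t; rewrite /node eq_sym mulrCA.
rewrite big_mkcond [RHS]big_mkcond/=; apply: eq_bigr => e _; rewrite /node.
case: eqP => _; first by apply: eq_II => t; rewrite mul1r.
by rewrite -[RHS](II0 mu); apply: eq_II => t; rewrite mul0r mulr0.
Qed.

(* [phi e x] is the share of edge [e] in the [x]-th unit of flow passing through its tail. *)
Let routing : exists phi : E -> R -> R, [/\ forall e, bm (phi e), forall e x, 0 <= phi e x <= 1,
  forall e t, cum (uu e) t = II mu (fun x => interval_density (cum (through (tail e)) t) x * phi e x) &
  forall v x, 0 <= x <= II mu (through v) ->
    \sum_(e | tail e == v) II mu (fun y => interval_density x y * phi e y) = x].
Proof.
have mN v : measurable_fun setT (cum (through v)) by apply: cum_measurable.
have E1 (p : (R -> R) * (R -> R)) (b : R -> R) : atoms_int mu [:: p] b = II mu (fun x => p.1 x * b (p.2 x)).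
  by rewrite /atoms_int big_seq1.
have H e : exists phi : R -> R, [/\ measurable_fun setT phi, forall x, 0 <= phi x <= 1 &
    forall b, bm b -> II mu (fun t => uu e t * b (cum (through (tail e)) t)) =
      II mu (fun t => through (tail e) t * (phi (cum (through (tail e)) t) * b (cum (through (tail e)) t)))].
  have okU : List.Forall (atom_ok mu) [:: (uu e, cum (through (tail e)))].
    by have [h1 h2 _] := ug e; constructor; [apply: And3; [exact: h1|exact: h2|exact: mN]|constructor].
  have okN : List.Forall (atom_ok mu) [:: (through (tail e), cum (through (tail e)))].
    by have [h1 h2 _] := gd_through (tail e); constructor; [apply: And3; [exact: h1|exact: h2|exact: mN]|constructor].
  (* Both measures are images under the cumulative flow through the tail, so the density is a
     function of the rank of arrival and can be reused when the same units arrive earlier. *)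
  have [A mA|phi [mp p01 pE]] := push_density okU okN.
  - rewrite !E1/=.
    have bA : bm (fun t => \1_A (cum (through (tail e)) t) : R) by apply: bm_comp => //; exact: bm_indic.
    apply: le_II.
    + by have [h _ _] := ug e; exact: L1M.
    + by have [h _ _] := gd_through (tail e); exact: L1M.
    move=> t; rewrite ler_wpM2r ?indicE// /through (bigD1 e)//= lerDl sumr_ge0// => e' _.
    by have [_ h _] := ug e'.
  by exists phi; split => // b hb; have := pE b hb; rewrite !E1.
have [phi hphi] := choice H.
have bphi e : bm (phi e) by have [m p _] := hphi e; exact: bm_bnd m p.
exists phi; split => //; first by move=> e; have [] := hphi e.
- move=> e t; set N := cum (through (tail e)).
  have [_ _ pE] := hphi e; have [uL u0 _] := ug e; have gN := gd_through (tail e).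
  have bt : bm (fun x : R => ((x <= N t)%R%:R : R)) by exact: bm_le_id.
  have bNt : bm (fun s : R => ((N s <= N t)%R%:R : R)) by apply: bm_le; exact: mN.
  have ule x : uu e x <= through (tail e) x.
    by rewrite /through (bigD1 e)//= lerDl sumr_ge0// => e' _; have [_ h _] := ug e'.
  transitivity (II mu (fun x => uu e x * (N x <= N t)%R%:R)).
    (* Times after [t] at the same cumulative level carry no flow, so a condition on time can be
       replaced by one on rank. *)
    have ae0 : {ae mu, forall x, through (tail e) x * ((N x <= N t)%R%:R - (x <= t)%R%:R) = 0}.
      have [tL t0 _] := gN.
      apply: II_eq0_ae.
      - by apply: L1M => //; apply: bmB => //; exact: bm_le_id.
      - move=> x; rewrite mulr_ge0// subr_ge0 ler_nat.
        by case: (leP x t) => // /(cum_mono gN) ->.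
      rewrite (eq_II (mu := mu) (g := fun x => through (tail e) x * (N x <= N t)%R%:R -
         through (tail e) x * (x <= t)%R%:R)); last by move=> x; ring.
      rewrite IIB; [|exact: L1M|exact: (cum_L1 _ gN)].
      rewrite (time_change_le (ltW tf0) gN) ?subrr//.
      by rewrite (cum_ge0 _ gN) (cum_le_II _ gN).
    apply: ae_eq_II; [exact: (cum_L1 _ (ug e))|exact: L1M|].
    move: ae0; apply: ae_mp => x /eqP; rewrite mulf_eq0 subr_eq0 => /orP[/eqP h|/eqP -> //].
    have -> : uu e x = 0 by apply/eqP; rewrite eq_le u0 andbT -h.
    by rewrite !mul0r.
  rewrite (pE (fun x : R => (x <= N t)%R%:R))//.
  rewrite (@time_change _ _ (ltW tf0) (through (tail e)) (fun x => phi e x * (x <= N t)%R%:R) gN); last exact: bmM.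
  apply: eq_II => x; rewrite /interval_density !indicE !mem_setE !in_itv/= -/N.
  case: (leP 0 x) => x0; last by rewrite !mul0r.
  case: (leP x (N t)) => h /=; last by rewrite !mulr0 mul0r.
  by rewrite (le_trans h (cum_le_II _ gN)) mulr1.
- move=> v x hx; have gN := gd_through v; have [tL t0 _] := gN.
  have bx : bm (fun y : R => ((y <= x)%R%:R : R)) by exact: bm_le_id.
  have /andP[x0 x1] := hx.
  have h e : tail e == v -> II mu (fun y => interval_density x y * phi e y) =
      II mu (fun t => uu e t * (cum (through v) t <= x)%R%:R).
    move=> /eqP ev; have [_ _ pE] := hphi e.
    have := pE (fun y : R => (y <= x)%R%:R) bx; rewrite ev => ->.
    rewrite (@time_change _ _ (ltW tf0) (through v) (fun y => phi e y * (y <= x)%R%:R) gN); last exact: bmM.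
    apply: eq_II => y; rewrite /interval_density !indicE !mem_setE !in_itv/=.
    case: (leP 0 y) => y0; last by rewrite !mul0r.
    case: (leP y x) => hy /=; last by rewrite !mulr0 mul0r.
    by rewrite (le_trans hy x1) mulr1.
  rewrite (eq_bigr _ h) -II_sum; last first.
    by move=> e _; have [hL _ _] := ug e; apply: L1M => //; apply: bm_le; exact: mN.
  rewrite -[RHS](time_change_le (ltW tf0) gN hx); apply: eq_II => t.
  by rewrite /through mulr_suml.
Qed.

(* By (i) and (ii) for the flow cut at [t0], later inflow cannot change earlier outflow. *)
Let causality e a b t0 : gd a -> gd b -> t0 < tf' -> (forall t, t <= t0 -> cum a t = cum b t) ->
  forall t, 0 <= t <= tf -> t <= t0 + tau -> out e a t = out e b t.
Proof.
move=> ga gb t0f hab.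
pose cut (f : R -> R) := fun x : R => f x * (x <= t0)%R%:R.
have gcut f : gd f -> gd (cut f).
  by move=> gf; apply: gdM => //; exact: bm_le_id.
have cut_le f t : gd f -> cut f t <= f t.
  by move=> [_ h _]; rewrite ler_piMr// lern1 leq_b1.
have cumcut f t : gd f -> cum (cut f) t = cum f (Num.min t t0).
  move=> gf; apply: eq_II => x; rewrite /cut -mulrA; congr (_ * _).
  by rewrite le_min; case: (leP x t); case: (leP x t0); rewrite ?mulr1 ?mulr0.
have outcut f : gd f -> forall t, 0 <= t <= tf -> t <= t0 + tau -> out e (cut f) t = out e f t.
  move=> gf t ht tt0; have gc := gcut _ gf; apply/eqP; rewrite eq_le; apply/andP; split.
    by apply: T5 => // t' _; rewrite cumcut//; apply: (cum_mono gf); rewrite ge_min lexx.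
  apply: le_II; [exact: out_L1|exact: out_L1|] => x.
  have [fx f0 fs] := gf.
  have [f0x|fn] := eqVneq (f x) 0; first by rewrite /cut f0x !mul0r.
  have /andP[x0 x1] := fs _ fn.
  rewrite /cut -mulrA ler_wpM2l//.
  case: (leP (TT e f x) t) => hT /=; last by rewrite mulr_ge0.
  have xt0 : x <= t0.
    rewrite leNgt; apply/negP => lt; have [xf|xf] := leP x tf'.
      have := T3 e gf (t := x); rewrite x0 xf => /(_ isT); lra.
    (* The minimal travel time is assumed only up to [tf']; a later entry is compared with an entry
       at [tf'] by monotonicity. *)
    have h1 := T3 e gf (t := tf'); rewrite tf'0 lexx in h1.
    have := h1 isT; have := Tm e gf tf'0 (ltW xf) x1; lra.
  rewrite xt0 mul1r (le_trans _ hT)//; apply: T6 => //; last by rewrite x0 x1.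
  by move=> y; exact: cut_le.
move=> t ht tt0; rewrite -(outcut _ ga)// -(outcut _ gb)//.
have half f g : gd f -> gd g -> (forall t, t <= t0 -> cum f t = cum g t) ->
    out e (cut f) t <= out e (cut g) t.
  move=> gf gg h; apply: T5 => //; [exact: gcut|exact: gcut|] => t' _.
  by rewrite !cumcut// h// ge_min lexx orbT.
by apply/eqP; rewrite eq_le !half// => t' /hab.
Qed.

(** The invariant of the iteration: every edge is entered no later than by [uu], with no more mass
    in total. Together these force equal masses. *)
Let good (g : E -> R -> R) := [/\ forall e, gd (g e),
  forall e t, cum (uu e) t <= cum (g e) t & forall e, II mu (g e) <= II mu (uu e)].

Let arrivals (g : E -> R -> R) v t :=
  (v == s)%:R * cum rho t + \sum_(e | head e == v) out e (g e) t.

Let arrivals_eq g g' v t : (forall e, out e (g e) t = out e (g' e) t) ->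
  arrivals g v t = arrivals g' v t.
Proof. by move=> h; rewrite /arrivals; congr (_ + _); apply: eq_bigr => e _; exact: h. Qed.

Let out_eq e f g t : gd f -> gd g -> (forall x, cum f x = cum g x) -> 0 <= t <= tf ->
  out e f t = out e g t.
Proof.
move=> gf gg h ht; apply/eqP; rewrite eq_le; apply/andP; split.
  by apply: T5 => // x _; rewrite h.
by apply: T5 => // x _; rewrite h.
Qed.

Let good_total g e : good g -> II mu (g e) = II mu (uu e).
Proof.
move=> [h1 h2 h3]; apply/eqP; rewrite eq_le h3/=.
by rewrite -(cum_ge_tf (h1 e) (lexx _)) -(cum_ge_tf (ug e) (lexx _)).
Qed.

Let cum_uu_late e t : tf' <= t -> cum (uu e) t = II mu (uu e).
Proof.
move=> ht; apply: eq_II => x; have [->|/us h] := eqVneq (uu e x) 0; first by rewrite mul0r.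
by rewrite (le_trans h ht) mulr1.
Qed.

Let good_late g e t : good g -> tf' <= t -> cum (g e) t = II mu (uu e).
Proof.
move=> hg ht; have [h1 h2 h3] := hg; apply/eqP; rewrite eq_le; apply/andP; split.
  by apply: le_trans (h3 e); exact: (cum_le_II _ (h1 e)).
by rewrite -(cum_uu_late e ht).
Qed.

(** Hypothesis (i) compares the outflow of [g] with that of [uu] at its own exit times, and those
    are no later than [S]. *)
Let out_ge g e t : good g -> 0 <= t <= tf ->
  II mu (fun x => uu e x * (S e x <= t)%R%:R) <= out e (g e) t.
Proof.
move=> [h1 h2 h3] ht; have [uL u0 uS] := ug e.
apply: (@le_trans _ _ (out e (uu e) t)); last by apply: T5.
apply: le_II; [by apply: L1M => //; apply: bm_le|exact: out_L1|] => x.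
have [->|/uS hx] := eqVneq (uu e x) 0; first by rewrite !mul0r.
rewrite ler_wpM2l// ler_nat; case: (leP (S e x) t) => // hS.
by rewrite (le_trans (TS e hx) hS).
Qed.

Let through_cum v t : v != d -> cum (through v) t = (v == s)%:R * cum rho t +
  \sum_(e | head e == v) II mu (fun x => uu e x * (S e x <= t)%R%:R).
Proof. by move=> vd; rewrite /cum (conserve vd (bm_le_id t)). Qed.

Let arrivals_ge g v t : good g -> v != d -> 0 <= t <= tf -> cum (through v) t <= arrivals g v t.
Proof.
move=> hg vd ht; rewrite through_cum// lerD2l; apply: ler_sum => e _.
exact: out_ge.
Qed.

Let arrivals_le g v t : good g -> v != d -> 0 <= t <= tf ->
  0 <= arrivals g v t <= II mu (through v).
Proof.
move=> hg vd ht; rewrite (le_trans (cum_ge0 _ (gd_through v)) (arrivals_ge hg vd ht))/=.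
have [h1 h2 h3] := hg.
rewrite -(cum_ge_tf (gd_through v) (lexx tf)) through_cum//; apply: lerD.
  by rewrite ler_wpM2l//; apply: (cum_mono rg); case/andP: ht.
apply: ler_sum => e _; rewrite exitS; apply: le_trans (out_le _ _ (h1 e)) (h3 e).
Qed.

Section Iteration.
Variable phi : E -> R -> R.
Hypothesis bphi : forall e, bm (phi e).
Hypothesis phi01 : forall e x, 0 <= phi e x <= 1.
Hypothesis phi_cum : forall e t,
  cum (uu e) t = II mu (fun x => interval_density (cum (through (tail e)) t) x * phi e x).

Let Fe e x := II mu (fun y => interval_density x y * phi e y).

Let Fe_mono e x y : x <= y -> Fe e x <= Fe e y.
Proof.
move=> xy; apply: le_II; [exact: (L1M (L1_interval _) (bphi e))..|] => z.
rewrite ler_wpM2r//; first by case/andP: (phi01 e z).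
rewrite /interval_density !indicE !mem_setE !in_itv/= ler_nat.
case: (leP 0 z) => //= _; case: (leP z x) => // h.
by rewrite (le_trans h xy).
Qed.

Let routes (g g' : E -> R -> R) := forall e t, tail e != d -> 0 <= t <= tf ->
  cum (g' e) t = Fe e (arrivals g (tail e) t).

(** Arrivals under [g] have densities by [T4]. Distributing them by rank with the shares [phi]
    defines [g'], and [time_change_cum] evaluates its cumulative inflow. As arrivals are at least as
    early as for [uu] and [Fe] is monotone, [g'] is good again. *)
Let step g : good g -> exists2 g', good g' & routes g g'.
Proof.
move=> hg; have [h1 h2 h3] := hg.
have Hfm e : exists fm : R -> R, gd fm /\ forall t, 0 <= t <= tf -> out e (g e) t = cum fm t.
  by have [f gf hf] := T4 e (h1 e); exists f.
have [fm hfm] := choice Hfm.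
have gfm e : gd (fm e) by have [] := hfm e.
pose n v := fun t => (v == s)%:R * rho t + \sum_(e | head e == v) fm e t.
have gn v : gd (n v).
  apply: gdD; last by apply: gd_sum.
  case: (v == s); first by apply: gd_ext rg => t; rewrite mul1r.
  by apply: gd_ext gd0 => t; rewrite mul0r.
have cn v t : 0 <= t <= tf -> cum (n v) t = arrivals g v t.
  move=> ht; have [rL _ _] := rg.
  transitivity (cum (fun t => (v == s)%:R * rho t) t + cum (fun t => \sum_(e | head e == v) fm e t) t).
    rewrite /cum -IID.
    - by apply: eq_II => x; rewrite /n mulrDl.
    - by apply: L1M; [exact: L1Z|exact: bm_le_id].
    - by apply: L1M; [by apply: L1_sum => e _; have [] := gfm e|exact: bm_le_id].
  rewrite cum_sum// /arrivals; congr (_ + _).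
    rewrite /cum -IIZ; last exact: (cum_L1 _ rg).
    by apply: eq_II => x; rewrite mulrA.
  by apply: eq_bigr => e _; have [_ ->] := hfm e.
pose g' e := if tail e == d then (fun=> 0) else fun t => n (tail e) t * phi e (cum (n (tail e)) t).
have bpc e : bm (fun t => phi e (cum (n (tail e)) t)).
  by apply: bm_comp; [exact: bphi|exact: (cum_measurable (gn _))].
have gg' e : gd (g' e).
  rewrite /g'; case: eqP => _; first exact: gd0.
  by apply: gdM => // t; case/andP: (phi01 e (cum (n (tail e)) t)).
have rg' : routes g g'.
  move=> e t ed ht; rewrite /cum /g' (negPf ed).
  rewrite (time_change_cum (ltW tf0) t (gn (tail e)) (bphi e)).
  by rewrite cn.
exists g'; last exact: rg'.
split; first exact: gg'.
  move=> e t; have [ed|ed] := eqVneq (tail e) d.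
    rewrite /g' ed eqxx; apply: le_II; [exact: (cum_L1 _ (ug e))|exact: (cum_L1 _ gd0)|] => x.
    by rewrite ud.
  have key t' : 0 <= t' <= tf -> cum (uu e) t' <= cum (g' e) t'.
    by move=> ht; rewrite rg'// phi_cum; apply: Fe_mono; exact: arrivals_ge.
  have [t0|t0] := ltP t 0; first by rewrite !(@cum_lt0 _ tf).
  have [t1|t1] := leP t tf; first by apply: key; rewrite t0 t1.
  rewrite (cum_ge_tf (ug e) (ltW t1)) (cum_ge_tf (gg' e) (ltW t1)).
  rewrite -(cum_ge_tf (ug e) (lexx _)) -(cum_ge_tf (gg' e) (lexx _)).
  by apply: key; rewrite lexx ltW.
move=> e; have [ed|ed] := eqVneq (tail e) d.
  rewrite /g' ed eqxx II0; apply: II_ge0 => t; by have [_ h _] := ug e.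
have tt : 0 <= tf <= tf by rewrite lexx ltW.
rewrite -(cum_ge_tf (gg' e) (lexx _)) rg'// -(cum_ge_tf (ug e) (lexx _)) phi_cum.
apply: Fe_mono; rewrite (cum_ge_tf (gd_through _) (lexx _)).
by have /andP[] := arrivals_le hg ed tt.
Qed.

Let good_uu : good uu. Proof. by split. Qed.

(** By [causality] each step determines the flow for a further time [tau]. Past [tf'] there is
    nothing left to determine, since all the mass of a good flow has entered. *)
Let iterate n : exists g g', [/\ good g, good g', routes g g' &
  forall e t, t <= n%:R * tau -> cum (g e) t = cum (g' e) t].
Proof.
elim: n => [|n [g [g' [hg hg' rgg' eqc]]]].
  have [g' hg' rg'] := step good_uu.
  exists uu, g'; split => // e t; rewrite mul0r => t0; have [gg' _ _] := hg'.
  have [->|tn] := eqVneq t 0; first by rewrite !(@cum_at0 _ tf).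
  by rewrite !(@cum_lt0 _ tf)// lt_neqAle tn.
have [g'' hg'' rg''] := step hg'.
exists g', g''; split => // e t ht.
have [g1 _ _] := hg; have [g1' _ _] := hg'; have [g1'' _ _] := hg''.
have outE e' t' : 0 <= t' <= tf -> t' <= n%:R * tau + tau -> out e' (g e') t' = out e' (g' e') t'.
  have [nf|nf] := ltP (n%:R * tau) tf'.
    by move=> *; apply: (causality _ _ _ nf) => // t'' h; exact: eqc.
  move=> h _.
  have all x : cum (g e') x = cum (g' e') x.
    have [xf|xf] := leP x tf'; first by apply: eqc; exact: le_trans nf.
    by rewrite !good_late// ltW.
  exact: out_eq.
have [ed|ed] := eqVneq (tail e) d.
  have z f : good f -> cum (f e) t = 0.
    move=> hf; have [gf _ lf] := hf; apply/eqP; rewrite eq_le (cum_ge0 _ (gf e)) andbT.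
    apply: le_trans (cum_le_II _ (gf e)) (le_trans (lf e) _).
    rewrite -(II0 mu); apply: le_II; [by have [] := ug e|exact: L1_cst0|].
    by move=> x; rewrite ud.
  by rewrite !z.
have key t' : 0 <= t' <= tf -> t' <= n.+1%:R * tau -> cum (g' e) t' = cum (g'' e) t'.
  move=> h1; rewrite -natr1 mulrDl mul1r => h2; rewrite (rgg' e t' ed h1) (rg'' e t' ed h1).
  by rewrite (@arrivals_eq g g')// => e'; exact: outE.
have [t0|t0] := ltP t 0; first by rewrite !(@cum_lt0 _ tf).
have [t1|t1] := leP t tf; first by apply: key; rewrite ?t0 ?t1.
by rewrite !good_late// ltW// (lt_trans tf'f t1).
Qed.

(** Once [n%:R * tau] reaches [tf'], two successive iterates have equal cumulative inflows, hence
    equal outflows, and the second is a fixed point. *)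
Lemma fifo_fixpoint : exists2 g, good g & forall e t, tail e != d -> 0 <= t <= tf ->
  cum (g e) t = II mu (fun y => interval_density (arrivals g (tail e) t) y * phi e y).
Proof.
pose n := (Num.truncn (tf' / tau)).+1.
have hn : tf' <= n%:R * tau.
  have /andP[_ h] := truncn_itv (divr_ge0 tf'0 (ltW tau0)).
  by rewrite -ler_pdivrMr// ltW.
have [g [g' [hg hg' rgg' eqc]]] := iterate n.
exists g'; first exact: hg'.
move=> e t ed ht; rewrite (rgg' e t ed ht).
have [g1 _ _] := hg; have [g1' _ _] := hg'.
have all e' x : cum (g e') x = cum (g' e') x.
  have [xf|xf] := leP x tf'; first by apply: eqc; exact: le_trans hn.
  by rewrite !good_late// ltW.
by rewrite (@arrivals_eq g g')// => e'; exact: out_eq.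
Qed.

End Iteration.

Let conserved : exists2 g, good g & forall v t, v != d -> 0 <= t <= tf ->
  \sum_(e | tail e == v) cum (g e) t = arrivals g v t.
Proof.
have [phi [h1 h2 h3 h4]] := routing.
have [g hg hr] := fifo_fixpoint h1 h2 h3.
exists g; first exact: hg.
move=> v t vd ht.
rewrite (eq_bigr (fun e => II mu (fun y => interval_density (arrivals g v t) y * phi e y))).
  by apply: h4; exact: arrivals_le.
by move=> e /eqP ev; rewrite hr ?ev.
Qed.

(** Testing conservation with the clock time at nodes other than [d] telescopes total travel time
    into arrival times at [d] minus departure times. This is why dominance of the arrivals at [d]
    suffices to compare costs; clamping keeps the test function bounded. *)
Let cost_eq (z X : E -> R -> R) : (forall e, gd (z e)) -> (forall e t, tail e = d -> z e t = 0) ->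
  (forall e, measurable_fun setT (X e)) ->
  (forall beta : V -> R -> R, (forall v, bm (beta v)) -> (forall t, beta d t = 0) ->
    \sum_e II mu (fun t => z e t * beta (tail e) t) =
    II mu (fun t => rho t * beta s t) + \sum_e II mu (fun t => z e t * beta (head e) (X e t))) ->
  \sum_e II mu (fun t => z e t * (clamp tf (X e t) - clamp tf t)) =
  \sum_(e | head e == d) II mu (fun t => z e t * clamp tf (X e t)) -
  II mu (fun t => rho t * ((s != d)%:R * clamp tf t)).
Proof.
move=> gz zd mX WC.
have bcl : bm (clamp tf) by apply: (@bm_clamp _ _ tf0 id).
have bX e : bm (fun t => clamp tf (X e t)) by exact: (bm_clamp tf0 (mX e)).
pose beta v t := (v != d)%:R * clamp tf t.
have bb v : bm (beta v) by apply: bmM; [exact: bm_cst|exact: bcl].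
have bd t : beta d t = 0 by rewrite /beta eqxx mul0r.
have L e : L1 mu (fun t => z e t * clamp tf t) by have [h _ _] := gz e; exact: (L1M h bcl).
have LX e : L1 mu (fun t => z e t * clamp tf (X e t)) by have [h _ _] := gz e; exact: (L1M h (bX e)).
have := WC beta bb bd.
have -> : \sum_e II mu (fun t => z e t * beta (tail e) t) = \sum_e II mu (fun t => z e t * clamp tf t).
  apply: eq_bigr => e _; apply: eq_II => t; rewrite /beta.
  by have [/zd ->|_] := eqVneq (tail e) d; rewrite ?mul0r// mul1r.
have -> : \sum_e II mu (fun t => z e t * beta (head e) (X e t)) =
    \sum_e II mu (fun t => z e t * clamp tf (X e t)) -
    \sum_(e | head e == d) II mu (fun t => z e t * clamp tf (X e t)).
  rewrite [in X in _ - X]big_mkcond -sumrB; apply: eq_bigr => e _; rewrite /beta.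
  case: eqP => _ /=; last by rewrite subr0; apply: eq_II => t; rewrite mul1r.
  by rewrite subrr -[RHS](II0 mu); apply: eq_II => t; rewrite mul0r mulr0.
have -> : \sum_e II mu (fun t => z e t * (clamp tf (X e t) - clamp tf t)) =
    \sum_e II mu (fun t => z e t * clamp tf (X e t)) - \sum_e II mu (fun t => z e t * clamp tf t).
  rewrite -sumrB; apply: eq_bigr => e _; rewrite -IIB//.
  by apply: eq_II => t; rewrite mulrBr.
rewrite /beta; lra.
Qed.

Let exit_ae (z X : R -> R) : gd z -> measurable_fun setT X ->
  II mu (fun t => z t * (X t <= tf)%R%:R) = II mu z ->
  {ae mu, forall t, z t != 0 -> X t <= tf}.
Proof.
move=> [zL z0 zs] mX h.
have bX : bm (fun t : R => ((X t <= tf)%R%:R : R)) by exact: bm_le.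
have ae0 : {ae mu, forall t, z t * (1 - (X t <= tf)%R%:R) = 0}.
  apply: II_eq0_ae.
  - by apply: L1M => //; apply: bmB; [exact: bm_cst|exact: bX].
  - by move=> t; rewrite mulr_ge0// subr_ge0 lern1 leq_b1.
  rewrite (eq_II (mu := mu) (g := fun t => z t - z t * (X t <= tf)%R%:R)); last by move=> t; ring.
  by rewrite IIB// ?h ?subrr//; exact: L1M.
move: ae0; apply: ae_mp => t /eqP; rewrite mulf_eq0 => /orP[->//|].
by case: (X t <= tf) => //; rewrite subr0 oner_eq0.
Qed.

Let cost_clamp (z X : R -> R) : gd z -> measurable_fun setT X -> (forall t, t <= X t) -> bm (fun t => X t - t) ->
  II mu (fun t => z t * (X t <= tf)%R%:R) = II mu z ->
  II mu (fun t => z t * (X t - t)) = II mu (fun t => z t * (clamp tf (X t) - clamp tf t)).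
Proof.
move=> gz mX X2 bX hX; have [zL z0 zs] := gz.
have bcl : bm (clamp tf) by apply: (@bm_clamp _ _ tf0 id).
apply: ae_eq_II.
- exact: L1M.
- by apply: L1M => //; apply: bmB; [exact: bm_clamp|exact: bcl].
move: (exit_ae gz mX hX); apply: ae_mp => t h.
have [->|zn] := eqVneq (z t) 0; first by rewrite !mul0r.
have ht := zs _ zn; have /andP[t0 _] := ht.
by rewrite !clamp_id// (le_trans t0 (X2 t)) h.
Qed.

Lemma improved_flow : exists g : E -> R -> R, [/\ forall e, gd (g e),
  forall e t, g e t != 0 -> t <= tf', forall e t, tail e = d -> g e t = 0,
  forall beta : V -> R -> R, (forall v, bm (beta v)) -> (forall t, beta d t = 0) ->
    \sum_e II mu (fun t => g e t * beta (tail e) t) =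
    II mu (fun t => rho t * beta s t) +
    \sum_e II mu (fun t => g e t * beta (head e) (TT e (g e) t)) &
  \sum_e II mu (fun t => g e t * (TT e (g e) t - t)) <=
  \sum_e II mu (fun t => uu e t * (S e t - t))].
Proof.
have [g0 hg0 hc0] := conserved; have [gg0 _ _] := hg0.
(* Cutting at [tf'] and on the edges leaving [d] removes only a null set and makes both properties
   hold at every point. *)
pose g e := fun t => g0 e t * ((t <= tf')%R%:R * (tail e != d)%:R).
have bcut e : bm (fun t : R => ((t <= tf')%R%:R * (tail e != d)%:R : R)).
  by apply: bmM; [exact: bm_le_id|exact: bm_cst].
have gg e : gd (g e) by apply: gdM => // t; rewrite mulr_ge0.
have aeg e : {ae mu, forall t, g e t = g0 e t}.
  have [L0 p0 s0] := gg0 e; have [L1g p1 s1] := gg e.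
  have le0 t : 0 <= g0 e t - g e t.
    by rewrite subr_ge0 ler_piMr// mulr_ile1// lern1 leq_b1.
  have : {ae mu, forall t, g0 e t - g e t = 0}.
    apply: II_eq0_ae => //; first exact: L1B.
    rewrite IIB//; apply/eqP; rewrite subr_eq0; apply/eqP.
    have [ed|ed] := eqVneq (tail e) d.
      have -> : II mu (g e) = 0.
        by rewrite -[RHS](II0 mu); apply: eq_II => t; rewrite /g ed eqxx !mulr0.
      rewrite good_total// -[RHS](II0 mu); apply: eq_II => t; exact: ud.
    rewrite good_total// -(good_late e hg0 (lexx tf')).
    by apply: eq_II => t; rewrite /g ed mulr1.
  by apply: ae_mp => t /eqP; rewrite subr_eq0 => /eqP.
have IIg e (b : R -> R) : bm b -> II mu (fun t => g0 e t * b t) = II mu (fun t => g e t * b t).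
  move=> hb; have [L0 p0 s0] := gg0 e; have [L1g p1 s1] := gg e.
  apply: ae_eq_II; [exact: L1M|exact: L1M|].
  by move: (aeg e); apply: ae_mp => t ->.
have TTg e : TT e (g e) = TT e (g0 e) by apply: T7.
have mT e : measurable_fun setT (TT e (g e)) by exact: T1.
have outE e t : out e (g0 e) t = II mu (fun x => g e x * (TT e (g e) x <= t)%R%:R).
  by rewrite /out -TTg IIg//; exact: bm_le.
have totE e : II mu (g e) = II mu (uu e).
  rewrite -(good_total e hg0); apply: ae_eq_II; [by have [] := gg e|by have [] := gg0 e|exact: aeg].
have cumE e t : cum (g0 e) t = cum (g e) t by rewrite /cum IIg//; exact: bm_le_id.
have tt : 0 <= tf <= tf by rewrite lexx ltW.
have exit e : II mu (fun x => g e x * (TT e (g e) x <= tf)%R%:R) = II mu (g e).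
  apply/eqP; rewrite eq_le -outE; apply/andP; split.
    by rewrite outE; exact: out_le.
  by rewrite totE -exitS; exact: out_ge.
exists g; have WCg : forall beta : V -> R -> R, (forall v, bm (beta v)) -> (forall t, beta d t = 0) ->
    \sum_e II mu (fun t => g e t * beta (tail e) t) =
    II mu (fun t => rho t * beta s t) +
    \sum_e II mu (fun t => g e t * beta (head e) (TT e (g e) t)).
  move=> beta hb bd.
  (* At a node the cumulative flows in and out agree up to [tf], and all flow has left its edges by
     then; equality on half-lines extends to every test function by [push_ext]. *)
  have nodeE v (b : R -> R) : v != d -> bm b ->
      \sum_(e | tail e == v) II mu (fun t => g e t * b t) =
      (v == s)%:R * II mu (fun t => rho t * b t) +
      \sum_(e | head e == v) II mu (fun t => g e t * b (TT e (g e) t)).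
    move=> vd hbb.
    pose s1 := [seq (g e, id : R -> R) | e <- enum E & tail e == v].
    pose s2 := ((fun t => (v == s)%:R * rho t), id : R -> R) ::
       [seq (g e, TT e (g e)) | e <- enum E & head e == v].
    have p1 b' : atoms_int mu s1 b' = \sum_(e | tail e == v) II mu (fun t => g e t * b' t).
      by rewrite /atoms_int big_map big_filter big_enum_cond.
    have p2 b' : bm b' -> atoms_int mu s2 b' = (v == s)%:R * II mu (fun t => rho t * b' t) +
      \sum_(e | head e == v) II mu (fun t => g e t * b' (TT e (g e) t)).
      move=> hb'; rewrite atoms_int_cons /atoms_int big_map big_filter big_enum_cond/=; congr (_ + _).
      rewrite -IIZ; last by have [h _ _] := rg; exact: L1M.
      by apply: eq_II => t; rewrite mulrA.
    have ok1 : List.Forall (atom_ok mu) s1.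
      rewrite /s1; elim: [seq e <- enum E | _] => [|e l IH] /=; first by constructor.
      by constructor => //; apply: atom_id; have [] := gg e.
    have ok2 : List.Forall (atom_ok mu) s2.
      have [h1 h2 h3] := rg; constructor.
        apply: atom_id; first exact: L1Z.
        by move=> t; rewrite mulr_ge0.
      elim: [seq e <- enum E | _] => [|e l IH] /=; first by constructor.
      have [g1 g2 g3] := gg e.
      by constructor => //; apply: And3; [exact: g1|exact: g2|exact: mT].
    have b1 : bm (fun _ : R => 1 : R) by exact: bm_cst.
    have bt t : bm (fun x : R => ((x <= t)%R%:R : R)) by exact: bm_le_id.
    have conE t : 0 <= t <= tf -> atoms_int mu s1 (fun x => (x <= t)%R%:R) = atoms_int mu s2 (fun x => (x <= t)%R%:R).
      move=> ht; rewrite p1 p2//.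
      transitivity (\sum_(e | tail e == v) cum (g0 e) t); first by apply: eq_bigr => e _; rewrite cumE.
      rewrite hc0// /arrivals; congr (_ + _); apply: eq_bigr => e _.
      by rewrite outE.
    have tot : atoms_int mu s1 (fun=> 1) = atoms_int mu s1 (fun x => (x <= tf)%R%:R).
      rewrite !p1; apply: eq_bigr => e _; rewrite -[RHS]/(cum (g e) tf) (cum_ge_tf (gg e) (lexx _)).
      by apply: eq_II => t; rewrite mulr1.
    have tot2 : atoms_int mu s2 (fun=> 1) = atoms_int mu s2 (fun x => (x <= tf)%R%:R).
      rewrite !p2//; congr (_ * _ + _).
        rewrite -[RHS]/(cum rho tf) (cum_ge_tf rg (lexx _)); by apply: eq_II => t; rewrite mulr1.
      apply: eq_bigr => e _; rewrite exit; by apply: eq_II => t; rewrite mulr1.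
    have E12 : atoms_int mu s1 b = atoms_int mu s2 b.
      apply: push_ext => //; first by rewrite tot tot2 conE.
      move=> t; have [t0|t0] := ltP t 0.
        rewrite p1 p2// big1; last by move=> e _; exact: (cum_lt0 (gg e)).
        rewrite -/(cum rho t) (cum_lt0 rg t0) mulr0 add0r big1// => e _.
        rewrite -[RHS](II0 mu); apply: eq_II => x; have [_ _ h3] := gg e.
        have [->|/h3/andP[x0 _]] := eqVneq (g e x) 0; first by rewrite mul0r.
        by rewrite leNgt (lt_le_trans t0 (le_trans x0 (T2 e x (gg e)))) mulr0.
      have [t1|t1] := leP t tf; first by apply: conE; rewrite t0.
      transitivity (atoms_int mu s1 (fun=> 1)).
        rewrite !p1; apply: eq_bigr => e _; rewrite -[LHS]/(cum (g e) t) (cum_ge_tf (gg e) (ltW t1)).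
        by apply: eq_II => x; rewrite mulr1.
      rewrite tot conE// -tot2 !p2//; congr (_ * _ + _).
        rewrite -[RHS]/(cum rho t) (cum_ge_tf rg (ltW t1)); by apply: eq_II => x; rewrite mulr1.
      apply: eq_bigr => e _.
      transitivity (II mu (g e)); first by apply: eq_II => x; rewrite mulr1.
      have [L0 p0 _] := gg e.
      apply/eqP; rewrite eq_le; apply/andP; split; last exact: out_le.
      rewrite -{1}exit; apply: le_II; [exact: out_L1|exact: out_L1|] => x.
      rewrite ler_wpM2l// ler_nat; case: (leP (TT e (g e) x) tf) => // h.
      by rewrite (le_trans h (ltW t1)).
    by rewrite -p1 E12 p2.
  have bT e : bm (fun t => beta (head e) (TT e (g e) t)) by exact: (bm_comp (hb _) (mT e)).
  transitivity (\sum_(v | v != d) \sum_(e | tail e == v) II mu (fun t => g e t * beta v t)).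
    rewrite (exchange_big_dep predT)//=; apply: eq_bigr => e _.
    have [ed|ed] := eqVneq (tail e) d.
      rewrite big1 => [|v /andP[vd /eqP ev]]; last by rewrite -ev ed eqxx in vd.
      by rewrite -[RHS](II0 mu); apply: eq_II => t; rewrite ed bd mulr0.
    rewrite (bigD1 (tail e))/= ?ed ?eqxx// big1 ?addr0// => v /andP[/andP[_ /eqP ->]].
    by rewrite eqxx.
  rewrite (eq_bigr _ (fun v vd => nodeE v (beta v) vd (hb v))) big_split/=; congr (_ + _).
    have [sd|sd] := eqVneq s d.
      rewrite big1 => [|v vd]; last by rewrite sd (negPf vd) mul0r.
      by rewrite -[LHS](II0 mu); apply: eq_II => t; rewrite sd bd mulr0.
    rewrite (bigD1 s)//= eqxx mul1r big1 ?addr0// => v /andP[_ /negPf ->].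
    by rewrite mul0r.
  rewrite (exchange_big_dep predT)//=; apply: eq_bigr => e _.
  have [ed|ed] := eqVneq (head e) d.
    rewrite big1 => [|v /andP[vd /eqP ev]]; last by rewrite -ev ed eqxx in vd.
    by rewrite -[LHS](II0 mu); apply: eq_II => t; rewrite ed bd mulr0.
  rewrite (bigD1 (head e))/= ?ed ?eqxx// big1 ?addr0// => v /andP[/andP[_ /eqP ->]].
  by rewrite eqxx.
have gd_d e t : tail e = d -> g e t = 0 by move=> ed; rewrite /g ed eqxx !mulr0.
split => //.
  move=> e t; rewrite /g; case: (leP t tf') => //.
  by rewrite mul0r mulr0 eqxx.
have -> : \sum_e II mu (fun t => g e t * (TT e (g e) t - t)) =
    \sum_e II mu (fun t => g e t * (clamp tf (TT e (g e) t) - clamp tf t)).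
  by apply: eq_bigr => e _; apply: cost_clamp => //; [move=> t; exact: T2|exact: Tb].
have -> : \sum_e II mu (fun t => uu e t * (S e t - t)) =
    \sum_e II mu (fun t => uu e t * (clamp tf (S e t) - clamp tf t)).
  by apply: eq_bigr => e _; exact: cost_clamp.
rewrite (cost_eq (X := fun e => TT e (g e)) gg gd_d mT WCg) (cost_eq ug ud mS WCu).
(* The departure terms coincide, so only arrivals at [d] remain, and [out_ge] orders them edge by
   edge. *)
rewrite lerD2r; apply: ler_sum => e _; apply: (clamp_compare tf0) => //.
- move=> x zn; have [_ _ h] := gg e; have /andP[x0 _] := h x zn.
  exact: le_trans x0 (T2 e x (gg e)).
- by move=> x zn; have [_ _ h] := ug e; have /andP[x0 _] := h x zn; exact: le_trans x0 (S2 e x).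
- by move=> t ht; rewrite -outE; exact: out_ge.
Qed.

End Fifo.

(** * Equilibria and system optimal flows *)

Section Horizon.
Context (R : realType).
Local Notation mu := (@lebesgue_measure R).
Variable (tf : R).
Hypothesis tf0 : 0 < tf.
Implicit Types f g F G : R -> R.

Definition on_horizon f (x : R) : R := if 0 <= x <= tf then f x else 0.

Lemma on_horizonE f x : Hset tf x -> on_horizon f x = f x.
Proof. by rewrite /on_horizon /Hset/= => ->. Qed.

Lemma on_horizon_id f : density_on tf f -> on_horizon f = f.
Proof.
move=> [_ _ h]; apply/funext => x; rewrite /on_horizon; case: ifPn => // hx.
by apply/esym/eqP; apply: contraNT hx => /h.
Qed.

Lemma HsetE : Hset tf = `[0, tf]%classic :> set R.
Proof. by apply/seteqP; split => x; rewrite /Hset/= in_itv. Qed.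

Lemma measurable_Hset : measurable (Hset tf : set R).
Proof. by rewrite HsetE. Qed.

Lemma integral_supp (A : set R) f g : (forall x, A x -> f x = g x) -> (forall x, ~ A x -> g x = 0) ->
  (\int[mu]_(x in A) (f x)%:E = \int[mu]_x (g x)%:E)%E.
Proof.
move=> h1 h2; rewrite integral_mkcond; apply: eq_integral => x _; rewrite patchE.
by case: ifPn => [/set_mem/h1 -> //|/negP h]; rewrite h2// => hA; apply: h; exact: mem_set.
Qed.

Lemma Lplus_density f : Lplus tf f -> density_on tf (on_horizon f).
Proof.
move=> [mf [f0 if_]]; split.
- rewrite /L1; have := (integrable_mkcond (mu := mu) (EFin \o f) measurable_Hset).1 if_.
  congr (_.-integrable _ _); apply/funext => x /=; rewrite patchE /on_horizon.
  have -> : (x \in Hset tf) = (0 <= x <= tf) by apply/idP/idP => [/set_mem//|h]; exact: mem_set.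
  by case: ifP.
- by move=> t; rewrite /on_horizon; case: ifP => // /f0.
- by move=> t; rewrite /on_horizon; case: ifP => //; rewrite eqxx.
Qed.

Lemma density_Lplus f : density_on tf f -> Lplus tf f.
Proof.
move=> [h1 h2 h3]; split; first by apply: measurable_funTS; exact: L1_meas h1.
split; first by move=> t _.
by apply: integrableS h1 => //; exact: measurable_Hset.
Qed.

Lemma aeeq_horizon f g : aeeq tf f g -> {ae mu, forall t, on_horizon f t = on_horizon g t}.
Proof. by apply: ae_mp => t h; rewrite /on_horizon; case: ifP => // /h. Qed.

Lemma aeeq_on_horizon f : aeeq tf f (on_horizon f).
Proof. by apply: aeW => t ht; rewrite on_horizonE. Qed.

Lemma aeeq_sym f g : aeeq tf f g -> aeeq tf g f.
Proof. by apply: ae_mp => t h ht; rewrite h. Qed.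

Lemma aeeq_trans f g (k : R -> R) : aeeq tf f g -> aeeq tf g k -> aeeq tf f k.
Proof. by move=> h1 h2; move: (ae_and h1 h2); apply: ae_mp => t [a b] ht; rewrite a// b. Qed.

Lemma int0E f t : Lplus tf f -> Hset tf t -> int0 t f = (cum (on_horizon f) t)%:E.
Proof.
move=> /Lplus_density hf /andP[_ tt]; rewrite /cum -(II_EFin (cum_L1 t hf)).
apply: integral_supp => x /=.
  by move=> /andP[x0 xt]; rewrite xt mulr1 on_horizonE// /Hset/= x0 (le_trans xt tt).
move=> h; rewrite /on_horizon; case: ifP => [/andP[x0 x1]|]; last by rewrite mul0r.
by case: (leP x t) => xt; [exfalso; apply: h; rewrite x0|rewrite mulr0].
Qed.

Lemma int_preE f F G t : Lplus tf f -> measurable_fun setT G ->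
  (forall x, Hset tf x -> f x != 0 -> F x = G x /\ 0 <= G x) ->
  int_pre tf F t f = (II mu (fun x => on_horizon f x * (G x <= t)%R%:R))%:E.
Proof.
move=> /Lplus_density hf mG h; rewrite -II_EFin; last first.
  by have [h1 _ _] := hf; apply: L1M => //; exact: bm_le.
rewrite /int_pre; apply: integral_supp => x /=.
  move=> [hx /andP[F0 Ft]]; rewrite on_horizonE//.
  have [->|/(h x hx)[<- _]] := eqVneq (f x) 0; first by rewrite mul0r.
  by rewrite Ft mulr1.
move=> hn; rewrite /on_horizon; case: ifP => hx; last by rewrite mul0r.
have [->|/(h x hx)[FG G0]] := eqVneq (f x) 0; first by rewrite mul0r.
case: (leP (G x) t) => Gt; last by rewrite mulr0.
by exfalso; apply: hn; rewrite FG G0.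
Qed.

Lemma integral_horizon f : Lplus tf f ->
  (\int[mu]_(x in Hset tf) (f x)%:E = (II mu (on_horizon f))%:E)%E.
Proof.
move=> /Lplus_density[h _ _]; rewrite -II_EFin//; apply: integral_supp => x hx.
  by rewrite on_horizonE.
by rewrite /on_horizon; case: ifP.
Qed.

End Horizon.

Section FiniteEsum.
Context (R : realType) (J : choiceType).

Lemma esum_finite (A : set J) (L : seq J) (a : J -> \bar R) : uniq L ->
  (forall j, j \in L -> A j) -> (forall j, A j -> (0 <= a j)%E) ->
  (forall j, A j -> j \notin L -> a j = 0%E) ->
  (\esum_(j in A) a j = \sum_(j <- L) a j)%E.
Proof.
move=> uL LA a0 aL.
have -> : (\sum_(j <- L) a j = \esum_(j in [set` L]) a j)%E.
  rewrite esum_fset; [by rewrite fsbig_seq|exact: finite_seq|].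
  by move=> j /set_mem hj; apply: a0; exact: LA.
rewrite esum_mkcond [RHS]esum_mkcond; apply: eq_esum => j _.
rewrite mem_setE; case: ifPn => [/set_mem hj|hj]; case: ifPn => // hL.
  exact: aL.
by move: hj; rewrite notin_setE => /(_ (LA _ hL)).
Qed.

End FiniteEsum.

Section WalkBridge.
Context (R : realType) (E : finType).
Local Notation mu := (@lebesgue_measure R).
Variables (tf : R) (DD : (E -> R -> R) -> E -> R -> R) (g : E -> R -> R) (T : E -> R -> R).
Hypothesis TE : forall e y, Hset tf y -> T e y = Tt DD g e y.

Lemma Aw_pathend w j x : (j <= size w)%N -> (forall k, (k < j)%N -> Hset tf (Aw DD g w k x)) ->
  Aw DD g w j x = pathend T (take j w) x.
Proof.
elim: w j x => [|e w IH] [|j] x //= jw h.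
rewrite TE; last exact: (h 0).
by apply: IH => // k kj; exact: (h k.+1).
Qed.

(** Counterpart of [Aw_pathend] with the horizon condition on [pathend], for use when aliveness
    rather than assumption (3) keeps the walk in the horizon. *)
Lemma pathend_Aw w j x : (j <= size w)%N -> (forall k, (k < j)%N -> Hset tf (pathend T (take k w) x)) ->
  Aw DD g w j x = pathend T (take j w) x.
Proof.
elim: w j x => [|e w IH] [|j] x //= jw h.
have hx : Hset tf x by exact: (h 0).
rewrite -TE//.
by apply: IH => // k kj; exact: (h k.+1).
Qed.

Lemma pathsum_edge (e : E) (b : R -> R) w x :
  pathsum T (fun e' y => (e' == e)%:R * b y) w x =
  \sum_(j < size w | nth e w j == e) b (pathend T (take j w) x).
Proof.
rewrite big_mkcond; elim: w x => [|e' w IH] x; first by rewrite big_ord0.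
rewrite /= big_ord_recl/= IH; congr (_ + _).
by case: eqP; rewrite ?mul1r ?mul0r.
Qed.

Lemma pathend_ge w x : (forall e y, y <= T e y) -> x <= pathend T w x.
Proof.
by move=> hT; elim: w x => [|e w IH] x //=; exact: le_trans (hT e x) (IH _).
Qed.

Lemma pathend_meas w : (forall e, measurable_fun setT (T e)) -> measurable_fun setT (pathend T w).
Proof.
move=> mT; elim: w => [|e w IH] /=; first exact: measurable_id.
exact: (measurableT_comp IH (mT e)).
Qed.

Lemma edge_term (e : E) w f t : Lplus tf f -> (forall e, measurable_fun setT (T e)) ->
  (forall e y, y <= T e y) ->
  (forall x, Hset tf x -> f x != 0 -> forall j, (j < size w)%N ->
    Aw DD g w j x = pathend T (take j w) x) ->
  (\sum_(j < size w | nth e w j == e) int_pre tf (Aw DD g w j) t f =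
   (II mu (fun x => on_horizon tf f x *
      pathsum T (fun e' y => (e' == e)%:R * (y <= t)%R%:R) w x))%:E)%E.
Proof.
move=> hf mT hT h.
rewrite (eq_bigr (fun j : 'I__ => (II mu (fun x => on_horizon tf f x * (pathend T (take j w) x <= t)%R%:R))%:E)); last first.
  move=> j _; apply: int_preE => //; first exact: pathend_meas.
  move=> x hx fx; split; first exact: h.
  by apply: le_trans (pathend_ge _ _ hT); case/andP: hx.
rewrite sumEFin -II_sum; last first.
  move=> j _; have [h1 _ _] := Lplus_density hf; apply: L1M => //.
  by apply: bm_le; exact: pathend_meas.
congr EFin; apply: eq_II => x; rewrite -mulr_sumr; congr (_ * _).
by rewrite pathsum_edge.
Qed.

End WalkBridge.

Section TollBridge.
Context (R : realType) (E : finType).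
Variables (tf : R) (D : E -> (R -> R) -> R -> R) (g : E -> R -> R) (T : E -> R -> R).
Hypothesis TE : forall e y, Hset tf y -> T e y = Tt (Dstd D) g e y.

Lemma tollw_pathsum p w x : (forall k, (k <= size w)%N -> Hset tf (Aw (Dstd D) g w k x)) ->
  tollw p D g w x = pathsum T p w x.
Proof.
elim: w x => [//|e w IH] x /= h; rewrite TE; last exact: (h 0).
by rewrite IH// => k kw; exact: (h k.+1).
Qed.

Lemma Aw_Du (u : E -> R -> R) w j x : Aw (Du D u) g w j x = Aw (Dstd D) u w j x.
Proof. by elim: w j x => [|e w IH] [|j] x //=. Qed.

End TollBridge.

Section CumUnique.
Context (R : realType).
Local Notation mu := (@lebesgue_measure R).
Variable (tf : R).
Hypothesis tf0 : 0 <= tf.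

Lemma II_cum_eq (f g b : R -> R) : density_on tf f -> density_on tf g ->
  (forall t, 0 <= t <= tf -> cum f t = cum g t) -> bm b ->
  II mu (fun t => f t * b t) = II mu (fun t => g t * b t).
Proof.
move=> gf gg h hb; have [Lf f0 _] := gf; have [Lg g0 _] := gg.
have E (k : R -> R) (b' : R -> R) : atoms_int mu [:: (k, id : R -> R)] b' = II mu (fun x => k x * b' x).
  by rewrite /atoms_int big_seq1.
have tt : 0 <= tf <= tf by rewrite tf0 lexx.
rewrite -!E; apply: push_ext => //.
- by constructor; [exact: atom_id|constructor].
- by constructor; [exact: atom_id|constructor].
- rewrite !E (eq_II (mu := mu) (g := f)); last by move=> x; rewrite mulr1.
  rewrite (eq_II (mu := mu) (f := fun x => _ * 1) (g := g)); last by move=> x; rewrite mulr1.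
  by rewrite -(cum_ge_tf gf (lexx _)) -(cum_ge_tf gg (lexx _)) h.
move=> t; rewrite !E -/(cum f t) -/(cum g t).
have [t0|t0] := ltP t 0; first by rewrite !(@cum_lt0 _ tf).
have [t1|/ltW t1] := leP t tf; first by rewrite h// t0.
by rewrite (cum_ge_tf gf t1) (cum_ge_tf gg t1) -(cum_ge_tf gf (lexx _)) -(cum_ge_tf gg (lexx _)) h.
Qed.

Lemma ae_cum_eq (f g : R -> R) : density_on tf f -> density_on tf g ->
  (forall t, 0 <= t <= tf -> cum f t = cum g t) -> {ae mu, forall t, f t = g t}.
Proof.
move=> gf gg h; have [Lf f0 _] := gf; have [Lg g0 _] := gg.
(* [b] is the sign of [f - g], so that the tested difference is its absolute value. *)
pose b t : R := 2 * (g t - f t <= 0)%R%:R - 1.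
have hb : bm b.
  apply: bmB; last exact: bm_cst.
  apply: bmM; first exact: bm_cst.
  by apply: bm_le; apply: measurable_funB; exact: (@L1_meas _ _ _ mu).
have : {ae mu, forall t, (f t - g t) * b t = 0}.
  apply: II_eq0_ae; first by apply: L1M => //; exact: L1B.
    move=> t; rewrite /b; case: (leP (g t - f t) 0) => hle; rewrite ?mulr1n ?mulr0n; nra.
  rewrite (eq_II (mu := mu) (g := fun t => f t * b t - g t * b t)); last by move=> t; ring.
  by rewrite IIB ?(II_cum_eq gf gg h hb) ?subrr//; [exact: (L1M Lf hb)|exact: (L1M Lg hb)].
apply: ae_mp => t /eqP; rewrite mulf_eq0 => /orP[|].
  by rewrite subr_eq0 => /eqP.
by rewrite /b; case: (leP (g t - f t) 0) => _; rewrite ?mulr1n ?mulr0n => /eqP; lra.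
Qed.

End CumUnique.

Section EsumTermwise.
Context (R : realType) (J : choiceType).

(** The sums are equal and finite, so no single term can be strictly smaller. *)
Lemma esum_eq_termwise (A : set J) (a b : J -> \bar R) (c : R) :
  (forall j, A j -> (0 <= a j)%E) -> (forall j, A j -> (a j <= b j)%E) ->
  (\esum_(j in A) a j = c%:E)%E -> (\esum_(j in A) b j = c%:E)%E ->
  forall j, A j -> a j = b j.
Proof.
move=> a0 ab sa sb j Aj.
have b0 k : A k -> (0 <= b k)%E by move=> Ak; apply: le_trans (a0 _ Ak) (ab _ Ak).
have AJ : A `&` [set j] = [set j] by apply/seteqP; split => [k []//|k /= ->].
move: sa sb; rewrite (esumID [set j])// [in X in _ -> X -> _](esumID [set j])// !AJ.
rewrite !esum_set1 ?a0 ?b0// => sa sb.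
have X0 : (0 <= \esum_(i in A `&` ~` [set j]) a i)%E by apply: esum_ge0 => k [/a0].
have XY : (\esum_(i in A `&` ~` [set j]) a i <= \esum_(i in A `&` ~` [set j]) b i)%E.
  by apply: le_esum => k [/ab].
move: sa sb X0 XY (ab _ Aj) (a0 _ Aj).
case: (a j) (b j) => [x| |] [y| |] //; case: (esum _ _) => [X| |] //; case: (esum _ _) => [Y| |] //=.
rewrite -!EFinD => -[sx] [sy]; rewrite !lee_fin => X0 XY xy _; congr EFin; lra.
Qed.

End EsumTermwise.

Section VisitedPoints.
Context (R : realType) (E : finType) (T : E -> R -> R) (tf : R).

Lemma eq_pathsum_visited (b1 b2 : E -> R -> R) w x :
  (forall k, (k <= size w)%N -> Hset tf (pathend T (take k w) x)) ->
  (forall e y, Hset tf y -> Hset tf (T e y) -> b1 e y = b2 e y) ->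
  pathsum T b1 w x = pathsum T b2 w x.
Proof.
move=> + hb; elim: w x => [//|e w IH] x h /=; rewrite IH; last by move=> k; exact: (h k.+1).
by rewrite hb//; [exact: (h 0)|have := h 1 isT; rewrite /= take0].
Qed.

End VisitedPoints.

(** * Conservation for loads and walks cut at the destination *)

Section LoadConservation.
Context (R : realType) (V E : finType) (tail head : E -> V).
Local Notation mu := (@lebesgue_measure R).
Variables (s d : V) (T : E -> R -> R).
Hypothesis mT : forall e, measurable_fun setT (T e).
Implicit Type hs : seq ((R -> R) * seq E).

Lemma load_mass hs (b : R -> R) : load_ok hs -> bm b ->
  L1 mu (fun t => (\sum_(p <- hs) p.1 t) * b t) /\
  \sum_(p <- hs) II mu (fun t => p.1 t * b t) = II mu (fun t => (\sum_(p <- hs) p.1 t) * b t).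
Proof.
move=> + hb; elim: hs => [_|p hs IH /load_ok_cons[h1 h2 /IH[L IHs]]].
  have E0 : (fun t => (\sum_(p <- [::] : seq ((R -> R) * seq E)) p.1 t) * b t) = fun=> 0.
    by apply/funext => t; rewrite big_nil mul0r.
  by rewrite E0; split; [exact: L1_cst0|rewrite big_nil II0].
have E1 : (fun t => (\sum_(q <- p :: hs) q.1 t) * b t) =
    fun t => p.1 t * b t + (\sum_(q <- hs) q.1 t) * b t.
  by apply/funext => t; rewrite big_cons mulrDl.
have Lp := L1M h1 hb.
by rewrite E1 big_cons IHs IID//; split => //; exact: L1D.
Qed.

Lemma load_conservation hs (z : E -> R -> R) (rho : R -> R) : load_ok hs ->
  (forall p, p \in map snd hs -> is_walk_from tail head s d p) -> L1 mu rho ->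
  {ae mu, forall t, \sum_(p <- hs) p.1 t = rho t} ->
  (forall b, (forall e, bm (b e)) -> load T hs b = \sum_e II mu (fun t => z e t * b e t)) ->
  forall beta : V -> R -> R, (forall v, bm (beta v)) -> (forall t, beta d t = 0) ->
  \sum_e II mu (fun t => z e t * beta (tail e) t) =
  II mu (fun t => rho t * beta s t) + \sum_e II mu (fun t => z e t * beta (head e) (T e t)).
Proof.
move=> ok hw rL hr hload beta hb bd.
have bT e : bm (fun t => beta (head e) (T e t)) by exact: bm_comp.
rewrite -(hload (fun e => beta (tail e)))// -(hload (fun e t => beta (head e) (T e t)))//.
have [LS <-] : L1 mu (fun t => (\sum_(p <- hs) p.1 t) * beta s t) /\
    \sum_(p <- hs) II mu (fun t => p.1 t * beta s t) = II mu (fun t => rho t * beta s t).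
  have [L ->] := load_mass ok (hb s); split => //.
  by apply: ae_eq_II => //; [exact: (L1M rL (hb s))|move: hr; apply: ae_mp => t ->].
elim: hs ok hw {hr hload LS} => [|p hs IH] ok hw; first by rewrite /load !big_nil addr0.
have [h1 h2 h3] := load_ok_cons ok.
rewrite !load_cons big_cons IH//; last by move=> q hq; apply: hw; rewrite /= inE hq orbT.
rewrite addrACA; congr (_ + _).
rewrite -IID; [|exact: (L1M h1 (hb s))|exact: L1_pathsum].
apply: eq_II => t; rewrite -mulrDr; congr (_ * _).
have := pathsum_telescope T beta t (hw p.2 (mem_head _ _)).
by rewrite bd addr0.
Qed.

Fixpoint first_visit (v : V) (w : seq E) : seq E :=
  if v == d then [::] else if w is e :: w' then e :: first_visit (head e) w' else [::].

Lemma first_visit_walk v w : is_walk_from tail head v d w -> is_walk_from tail head v d (first_visit v w).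
Proof.
elim: w v => [|e w IH] v /=; first by case: ifP.
by move=> /andP[ev /IH hw]; case: ifP => //= _; rewrite ev.
Qed.

Lemma first_visit_le (b : E -> R -> R) v w t : (forall e t, 0 <= b e t) ->
  pathsum T b (first_visit v w) t <= pathsum T b w t.
Proof.
move=> b0; elim: w v t => [|e w IH] v t /=; first by case: ifP.
by case: ifP => _ /=; [rewrite addr_ge0// pathsum_ge0|rewrite lerD2l].
Qed.

Lemma first_visit_tail (b : E -> R -> R) v w t : is_walk_from tail head v d w ->
  pathsum T b (first_visit v w) t =
  pathsum T (fun e x => (tail e != d)%:R * b e x) (first_visit v w) t.
Proof.
elim: w v t => [|e w IH] v t /=; first by case: ifP.
move=> /andP[/eqP ev /IH hw]; case: ifP => //= vd.
by rewrite ev vd/= mul1r hw.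
Qed.

End LoadConservation.

(** * Exit times of the network and realisation of assignments *)

Section Network.
Context (R : realType) (V E I : finType) (tail head : E -> V) (src dst : I -> V).
Local Notation mu := (@lebesgue_measure R).
Variables (tf' tf tau : R) (gamma : I -> R) (r : I -> R -> R) (D : E -> (R -> R) -> R -> R).
Variables (l : (seq E * I -> R -> R) -> E -> R -> R)
  (lu : (E -> R -> R) -> (seq E * I -> R -> R) -> E -> R -> R).
Hypothesis tf'0 : 0 <= tf'.
Hypothesis tf'f : tf' < tf.
Hypothesis tau0 : 0 < tau.
Hypothesis gamma0 : forall i, 0 < gamma i.
Hypothesis Hr : forall i, Lplus tf (r i).
Hypothesis HD0 : forall e f t, Lplus tf f -> Hset tf t -> 0 <= D e f t.
Hypothesis HDwd : forall e f f', Lplus tf f -> Lplus tf f' -> aeeq tf f f' ->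
  forall t, Hset tf t -> D e f t = D e f' t.
Hypothesis Hl : l_spec tail head src dst tf' tf r (Dstd D) l.
Hypothesis Hlu : forall u : E -> R -> R, (forall e, Lplus tf (u e)) ->
  l_spec tail head src dst tf' tf r (Du D u) (lu u).
Hypothesis A1 : forall e f, Lplus tf f ->
       abs_cont 0 tf (D e f) /\
       nondecr_on (Hset tf) (fun t => t + D e f t) /\
       (forall t : R, 0 <= t <= tf' -> tau <= D e f t) /\
       exists fm, Lplus tf fm /\
         forall t, Hset tf t -> int_pre tf (fun x => x + D e f x) t f = int0 t fm.
Hypothesis A3 : forall h, Lam tail head src dst tf' tf r (Dstd D) h ->
     forall w, isW tail head src dst w -> forall j, (j <= size w.1)%N ->
     forall t, Hset tf t -> Hset tf (Aw (Dstd D) (l h) w.1 j t).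
Hypothesis A4 : forall u : E -> R -> R, (forall e, Lplus tf (u e)) ->
     (forall e, supported_on tf' tf (u e)) ->
     forall h, Lam tail head src dst tf' tf r (Du D u) h ->
     (forall e, aeeq tf (lu u h e) (u e)) ->
     forall e, aeeq tf (l h e) (u e).
Variables (s d : V) (N : nat).
Hypothesis hN : tf' < N%:R * tau.
Hypothesis Hsd : forall i, src i = s /\ dst i = d.
Hypothesis Hi : forall e f ft, Lplus tf f -> Lplus tf ft ->
     (forall t, Hset tf t -> (int0 t ft <= int0 t f)%E) ->
     forall t, Hset tf t ->
       (int_pre tf (fun x : R => (x + D e ft x)%R) t ft <=
        int_pre tf (fun x : R => (x + D e f x)%R) t f)%E.
Hypothesis Hii : forall e f ft, Lplus tf f -> Lplus tf ft -> aele tf ft f ->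
     forall t, Hset tf t -> D e ft t <= D e f t.

Local Notation gd := (density_on tf).
Local Notation nf := (on_horizon tf).
Local Notation ws := (walks tail head d N.+1 s).
Local Notation rr := (fun i => on_horizon tf (r i)).
Local Notation LamD := (Lam tail head src dst tf' tf r (Dstd D)).

Let tf0 : 0 < tf. Proof. exact: le_lt_trans tf'0 tf'f. Qed.
Let gdL f : gd f -> Lplus tf f. Proof. exact: density_Lplus. Qed.

(* The travel times are unspecified outside the horizon; clamping makes the exit time
   a monotone function on the whole line. *)
Definition exit_time e f (t : R) : R := t + D e f (clamp tf t).

Local Notation TT := exit_time.

Lemma exit_timeE e f t : Hset tf t -> exit_time e f t = t + D e f t.
Proof. by move=> ht; rewrite /exit_time clamp_id. Qed.

Lemma exit_time_meas e f : Lplus tf f -> measurable_fun setT (exit_time e f).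
Proof.
move=> hf; have [_ [mono _]] := A1 e hf.
rewrite (_ : exit_time e f = fun t => (t - clamp tf t) + (clamp tf t + D e f (clamp tf t))); last first.
  by apply/funext => t; rewrite /exit_time; ring.
apply: measurable_funD; apply: nondecreasing_measurable => // x y xy; first exact: clamp_sub_mono.
by apply: mono; [exact: clamp_itv|exact: clamp_itv|exact: clamp_mono].
Qed.

Lemma exit_time_ge e f t : Lplus tf f -> t <= exit_time e f t.
Proof. by move=> hf; rewrite lerDl HD0//; exact: clamp_itv. Qed.

Lemma exit_time_tau e f t : Lplus tf f -> 0 <= t <= tf' -> t + tau <= exit_time e f t.
Proof.
move=> hf ht; have [_ [_ [h _]]] := A1 e hf; have /andP[t0 t1] := ht.
by rewrite exit_timeE ?lerD2l ?h// /Hset/= t0 (le_trans t1)// ltW.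
Qed.

Lemma exit_time_mono e f x y : Lplus tf f -> 0 <= x -> x <= y -> y <= tf ->
  exit_time e f x <= exit_time e f y.
Proof.
move=> hf x0 xy yf; have [_ [mono _]] := A1 e hf.
have hx : Hset tf x by rewrite /Hset/= x0 (le_trans xy).
have hy : Hset tf y by rewrite /Hset/= yf (le_trans x0).
by rewrite !exit_timeE//; exact: mono.
Qed.

Lemma exit_time_bm e f : Lplus tf f -> bm (fun t => exit_time e f t - t).
Proof.
move=> hf; have [_ [mono _]] := A1 e hf.
apply: (@bm_bnd _ _ _ _ (tf + D e f tf)).
  by apply: measurable_funB => //; exact: exit_time_meas.
move=> t; rewrite /exit_time addrAC subrr add0r; have hc := clamp_itv tf0 t.
rewrite HD0//; have /andP[c0 c1] := hc.
have ht : Hset tf tf by rewrite /Hset/= lexx ltW.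
by have := mono _ _ hc ht c1; lra.
Qed.

Lemma int_pre_exit e f t : gd f ->
  int_pre tf (fun x => x + D e f x) t f = (II mu (fun x => f x * (exit_time e f x <= t)%R%:R))%:E.
Proof.
move=> gf; have hf := gdL gf.
rewrite (int_preE t hf (exit_time_meas e hf)) ?on_horizon_id// => x hx _.
by rewrite exit_timeE//; split=> //; rewrite addr_ge0 ?HD0//; case/andP: hx.
Qed.

Lemma exit_time_out e f : gd f -> exists2 fm, gd fm & forall t, 0 <= t <= tf ->
  II mu (fun x => f x * (exit_time e f x <= t)%R%:R) = cum fm t.
Proof.
move=> gf; have [_ [_ [_ [fm [hm h]]]]] := A1 e (gdL gf).
exists (on_horizon tf fm); first exact: Lplus_density.
by move=> t ht; have := h t ht; rewrite int_pre_exit// (int0E hm)// => -[].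
Qed.

Lemma exit_time_cum e f g : gd f -> gd g -> (forall t, 0 <= t <= tf -> cum g t <= cum f t) ->
  forall t, 0 <= t <= tf ->
  II mu (fun x => g x * (exit_time e g x <= t)%R%:R) <= II mu (fun x => f x * (exit_time e f x <= t)%R%:R).
Proof.
move=> gf gg h t ht; have := @Hi e f g (gdL gf) (gdL gg) _ t ht.
rewrite !int_pre_exit// lee_fin; apply => t' ht'.
by rewrite !(@int0E _ tf) ?on_horizon_id// ?lee_fin ?h//; exact: gdL.
Qed.

Lemma exit_time_le e f g : gd f -> gd g -> (forall t, g t <= f t) ->
  forall t, 0 <= t <= tf -> exit_time e g t <= exit_time e f t.
Proof.
move=> gf gg h t ht; rewrite !exit_timeE// lerD2l; apply: Hii => //; [exact: gdL|exact: gdL|].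
by apply: aeW => x _.
Qed.

Lemma exit_time_aeeq e f g : Lplus tf f -> Lplus tf g -> aeeq tf f g -> exit_time e f = exit_time e g.
Proof.
move=> hf hg h; apply/funext => t; rewrite /exit_time; congr (_ + _).
by apply: HDwd => //; exact: clamp_itv.
Qed.

Lemma exit_time_ext e f g : gd f -> gd g -> {ae mu, forall t, f t = g t} ->
  exit_time e f = exit_time e g.
Proof.
move=> gf gg h; apply: exit_time_aeeq; [exact: gdL|exact: gdL|].
by move: h; apply: ae_mp => t ->.
Qed.

Definition assignment_flow (xi : seq E -> I -> R -> R) (p : seq E * I) : R -> R :=
  if p.1 \in ws then fun t => on_horizon tf (r p.2) t * xi p.1 p.2 t else fun=> 0.

Lemma isW_single w i : isW tail head src dst (w, i) = is_walk_from tail head s d w.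
Proof. by rewrite /isW /=; have [-> ->] := Hsd i. Qed.

Lemma isW_ws w i : w \in ws -> isW tail head src dst (w, i).
Proof. by rewrite mem_walks isW_single => /andP[]. Qed.

Lemma density_on0 : gd (fun=> 0).
Proof. by split => // [|t]; [exact: L1_cst0|rewrite eqxx]. Qed.

Let pairs := [seq (w, i) | w <- ws, i <- enum I].

Lemma uniq_pairs : uniq pairs.
Proof.
by apply: allpairs_uniq => //; [exact: uniq_walks|exact: enum_uniq|move=> [? ?] [? ?] _ _ [-> ->]].
Qed.

Lemma mem_pairs w i : ((w, i) \in pairs) = (w \in ws).
Proof.
apply/allpairsP/idP => [[[w' i'] /= [h _ [-> _]]]//|h].
by exists (w, i); split => //; rewrite mem_enum.
Qed.

Lemma alive_pathend (T : E -> R -> R) (g : E -> R -> R) w t :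
  (forall e t, g e t != 0 -> 0 <= t <= tf') -> alive T g w t != 0 ->
  forall k, (k < size w)%N -> Hset tf (pathend T (take k w) t).
Proof.
move=> gs; rewrite /alive; elim: w t => [//|e w IH] t /=.
rewrite mulf_eq0 negb_or => /andP[h1 h2] [|k] /= kw; last exact: IH.
have /gs/andP[t0 t1] : g e t != 0 by move: h1; case: (g e t != 0) => //; rewrite eqxx.
by rewrite /Hset/= t0 (le_trans t1)// ltW.
Qed.

Lemma realize (g : E -> R -> R) xi : (forall e, gd (g e)) ->
  (forall e t, g e t != 0 -> t <= tf') ->
  feasible tail head s d (fun e => TT e (g e)) g rr N xi ->
  Lam tail head src dst tf' tf r (Dstd D) (assignment_flow xi) /\
  forall e, aeeq tf (l (assignment_flow xi) e) (g e).
Proof.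
move=> gg gs [[x1 x2 x3 x4] hload].
pose T e := TT e (g e).
have gL e : Lplus tf (g e) by exact: density_Lplus.
have mT e : measurable_fun setT (T e) by exact: (exit_time_meas e (gL e)).
have geT e y : y <= T e y by exact: (exit_time_ge _ _ (gL e)).
have TE e y : Hset tf y -> T e y = Tt (Dstd D) g e y by exact: exit_timeE.
have gs' e t : g e t != 0 -> 0 <= t <= tf'.
  by move=> h; have [_ _ /(_ t h)/andP[-> _]] := gg e; rewrite (gs e).
have bxi w i : bm (xi w i) by have [m h] := x1 w i; exact: bm_bnd m h.
have gr i : gd (rr i) by exact: Lplus_density.
have gh p : gd (assignment_flow xi p).
  rewrite /assignment_flow; case: ifP => _; last exact: density_on0.
  have [L0 p0 s0] := gr p.2; split; first exact: (L1M L0 (bxi p.1 p.2)).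
    by move=> t; rewrite mulr_ge0//; have [_ /(_ t)/andP[]] := x1 p.1 p.2.
  by move=> t; rewrite mulf_eq0 negb_or => /andP[/s0].
have hL p : Lplus tf (assignment_flow xi p) by exact: density_Lplus.
have out p : p \notin pairs -> assignment_flow xi p = fun=> 0.
  by case: p => w i; rewrite mem_pairs /assignment_flow /= => /negPf ->.
have isWp p : p \in pairs -> isW tail head src dst p.
  by case: p => w i; rewrite mem_pairs; exact: isW_ws.
have flow : flow_eq tail head src dst tf (Dstd D) (assignment_flow xi) g.
  move=> e t ht.
  rewrite (esum_finite uniq_pairs) //; last 2 first.
  - move=> p _; apply: sume_ge0 => j _; apply: integral_ge0 => x _.
    by rewrite lee_fin; have [_ h _] := gh p; exact: h.
  - move=> p _ /out hp; apply: big1 => j _; rewrite hp /int_pre.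
    by rewrite integral0.
  transitivity ((assign tail head s d T rr N xi (fun _ e' x => (e' == e)%:R * (x <= t)%R%:R))%:E).
    rewrite (hload (fun e' x => (e' == e)%:R * (x <= t)%R%:R)); last first.
      by move=> e'; apply: bmM; [exact: bm_cst|exact: bm_le_id].
    rewrite (@int0E _ tf)// on_horizon_id//; congr EFin.
    rewrite (bigD1 e)//= big1 ?addr0 => [|e' /negPf en].
      by apply: eq_II => x; rewrite eqxx mul1r.
    by rewrite -[RHS](II0 mu); apply: eq_II => x; rewrite en mul0r mulr0.
  rewrite (eq_big_seq (fun p => (II mu (fun x => on_horizon tf (r p.2) x * xi p.1 p.2 x *
      pathsum T (fun e' y => (e' == e)%:R * (y <= t)%R%:R) p.1 x))%:E)); last first.
    move=> [w i] hp /=; rewrite mem_pairs in hp.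
    rewrite (edge_term (T := T))//; last first.
      move=> x hx; rewrite /assignment_flow /= hp => hn j jw.
      have al : alive T g w x != 0.
        by apply: (x3 w i); apply: contraNneq hn => ->; rewrite mulr0.
      apply: (pathend_Aw TE) => //; first exact: ltnW.
      by move=> k kj; apply: (alive_pathend gs' al); exact: ltn_trans jw.
    congr EFin; rewrite on_horizon_id; last exact: gh.
    by rewrite /assignment_flow /= hp.
  rewrite sumEFin /pairs big_allpairs_dep /assign; congr EFin.
  by rewrite [RHS]exchange_big [RHS]big_enum.
have supp e : supported_on tf' tf (g e).
  apply: aeW => t /andP[h _]; apply/eqP; apply: contraTT h => /gs.
  by rewrite -leNgt.
have lam DD : flow_eq tail head src dst tf DD (assignment_flow xi) g ->
    Lam tail head src dst tf' tf r DD (assignment_flow xi).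
  move=> hf; split; first by move=> p _; exact: hL.
  split; first by move=> p np; apply: out; apply: contra np; exact: isWp.
  split.
    rewrite (esum_finite uniq_pairs) //; last 2 first.
    - by move=> p _; apply: integral_ge0 => x _; rewrite lee_fin; have [_ h _] := gh p; exact: h.
    - by move=> p _ /out ->; rewrite integral0.
    rewrite (eq_bigr (fun p => (II mu (on_horizon tf (assignment_flow xi p)))%:E)) ?sumEFin ?ltry//.
    by move=> p _; exact: integral_horizon.
  split; last by exists g.
  move=> i.
  have : {ae mu, forall t, rr i t * (1 - \sum_(w <- ws) xi w i t) = 0}.
    apply: II_eq0_ae => //.
    - have [h _ _] := gr i; apply: (L1M h); apply: bmB; first exact: bm_cst.
      by apply: bm_sum => w _; exact: bxi.
    - by move=> t; have [_ h _] := gr i; rewrite mulr_ge0 ?subr_ge0.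
  apply: ae_mp => t h ht.
  rewrite (@esum_finite _ _ _ [seq (w, i) | w <- ws]).
  - rewrite big_map sumEFin; congr EFin.
    rewrite (eq_big_seq (fun w => rr i t * xi w i t)).
      by rewrite -mulr_sumr -[RHS](on_horizonE (r i) ht); move: h; lra.
    by move=> w hw; rewrite /assignment_flow /= hw.
  - by rewrite map_inj_uniq ?uniq_walks// => ? ? [].
  - by move=> _ /mapP[w hw ->]; split => //; exact: isW_ws.
  - by move=> p _; rewrite lee_fin; have [_ h0 _] := gh p; exact: h0.
  - move=> [w i'] [_ /= ->] hn; rewrite out// mem_pairs; apply: contra hn => hw.
    by apply/mapP; exists w.
split; first exact: lam.
have flowu : flow_eq tail head src dst tf (Du D g) (assignment_flow xi) g.
  move=> e t ht; rewrite flow//; apply: eq_esum => p _; apply: eq_bigr => j _.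
  by congr int_pre; apply/funext => x; rewrite Aw_Du.
have lamu := lam _ flowu.
apply: A4 => // e.
(* With frozen travel times the right side of the flow equation does not involve the unknown flow,
   so the flow chosen by [lu] has the cumulative inflow of [g] and agrees with it almost
   everywhere. *)
have [hlu _] := Hlu gL; have [luL [_ lufl]] := hlu _ lamu.
have : {ae mu, forall t, on_horizon tf (lu g (assignment_flow xi) e) t = g e t}.
  apply: (ae_cum_eq (ltW tf0)) => //; first exact: Lplus_density.
  move=> t ht; apply: EFin_inj; rewrite -(@int0E _ tf)// lufl// -(on_horizon_id (gg e)) -(@int0E _ tf)//.
  rewrite flowu//; apply: eq_esum => p _; apply: eq_bigr => j _.
  by congr int_pre; apply/funext => x; rewrite !Aw_Du.
by apply: ae_mp => t h ht; rewrite -h on_horizonE.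
Qed.

(** * Reduction of a flow to finitely many walks *)

Section FiniteSupport.
Variables (h : seq E * I -> R -> R) (gl : E -> R -> R).
Hypothesis hLam : Lam tail head src dst tf' tf r (Dstd D) h.
Hypothesis glL : forall e, Lplus tf (gl e).
Hypothesis gls : forall e, supported_on tf' tf (gl e).
Hypothesis glf : flow_eq tail head src dst tf (Dstd D) h gl.
Hypothesis Aw_horizon : forall w, isW tail head src dst w -> forall j, (j <= size w.1)%N ->
  forall t, Hset tf t -> Hset tf (Aw (Dstd D) gl w.1 j t).

Local Notation pairs := [seq (w, i) | w <- ws, i <- enum I].

(** A representative of the edge flow that vanishes everywhere, not only almost everywhere, outside
    [[0, tf']]. *)
Definition early_part (e : E) (t : R) : R := if 0 <= t <= tf' then gl e t else 0.
Local Notation U := early_part.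
Local Notation T := (fun e => TT e (U e)).

Let early t : 0 <= t <= tf' -> 0 <= t <= tf.
Proof. by move=> /andP[-> h1]; rewrite (le_trans h1)// ltW. Qed.

Lemma early_part_supp e t : U e t != 0 -> 0 <= t <= tf'.
Proof. by rewrite /early_part; case: ifP => //; rewrite eqxx. Qed.

Lemma early_part_density e : gd (U e).
Proof.
have [h1 h2 h3] := Lplus_density (glL e).
have E1 : U e = fun t => nf (gl e) t * (t <= tf')%R%:R.
  apply/funext => t; rewrite /early_part /on_horizon.
  case: (leP 0 t) => t0 /=; last by rewrite mul0r.
  case: (leP t tf') => ht; last by rewrite mulr0.
  by rewrite (le_trans ht (ltW tf'f)) mulr1.
rewrite E1; split; first by apply: (L1M h1); exact: bm_le_id.
  by move=> t; rewrite mulr_ge0.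
by move=> t; rewrite mulf_eq0 negb_or => /andP[/h3].
Qed.

Lemma early_part_aeeq e : aeeq tf (gl e) (U e).
Proof.
move: (gls e); apply: ae_mp => t h1 /andP[t0 t1]; rewrite /early_part t0/=.
by case: (leP t tf') => // h2; rewrite h1// h2.
Qed.

Let UL e : Lplus tf (U e). Proof. by apply: density_Lplus; exact: early_part_density. Qed.

Let mT e : measurable_fun setT (T e).
Proof. exact: (exit_time_meas e (UL e)). Qed.

Let geT e y : y <= T e y.
Proof. exact: (exit_time_ge e y (UL e)). Qed.

Lemma early_part_exit e y : Hset tf y -> T e y = Tt (Dstd D) gl e y.
Proof.
move=> hy; rewrite /Tt /Dstd -(exit_timeE e (gl e) hy).
by congr (_ _); apply/esym; apply: (exit_time_aeeq e (glL e) (UL e) (early_part_aeeq e)).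
Qed.

Lemma visited_on_horizon p x k : isW tail head src dst p -> Hset tf x -> (k <= size p.1)%N ->
  Hset tf (pathend T (take k p.1) x) /\ Aw (Dstd D) gl p.1 k x = pathend T (take k p.1) x.
Proof.
move=> hp hx kp.
have E1 : Aw (Dstd D) gl p.1 k x = pathend T (take k p.1) x.
  apply: (Aw_pathend early_part_exit) => // j jk; apply: Aw_horizon => //.
  by rewrite (leq_trans (ltnW jk)).
by split => //; rewrite -E1; exact: Aw_horizon.
Qed.

Let hL p : isW tail head src dst p -> gd (nf (h p)).
Proof. by move=> hp; apply: Lplus_density; have [h1 _] := hLam; exact: h1. Qed.

Let edge_ind e t := fun (e' : E) (y : R) => (e' == e)%:R * (y <= t)%R%:R : R.

Let bm_edge e t e' : bm (edge_ind e t e').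
Proof. by apply: bmM; [exact: bm_cst|exact: bm_le_id]. Qed.

Lemma cum_early_part e t : Hset tf t -> ((cum (U e) t)%:E =
  \esum_(p in Wset tail head src dst)
    (II mu (fun x => nf (h p) x * pathsum T (edge_ind e t) p.1 x))%:E)%E.
Proof.
move=> ht.
have -> : cum (U e) t = cum (nf (gl e)) t.
  apply: ae_eq_II; [exact: (cum_L1 _ (early_part_density e))|exact: (cum_L1 _ (Lplus_density (glL e)))|].
  move: (early_part_aeeq e); apply: ae_mp => x hx; congr (_ * _).
  rewrite /on_horizon; case: ifP => h1; first by rewrite hx.
  by apply/eqP; apply: contraFT h1 => /early_part_supp/early.
rewrite -(int0E (glL e) ht) glf//; apply: eq_esum => p hp.
have [h1 _] := hLam.
rewrite (edge_term (T := T)) //; first exact: h1.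
by move=> x hx _ j jw; have [] := visited_on_horizon hp hx (ltnW jw).
Qed.

Let edge_L1 p e t : isW tail head src dst p -> L1 mu (fun x => nf (h p) x * pathsum T (edge_ind e t) p.1 x).
Proof. by move=> /hL[h1 _ _]; apply: L1_pathsum. Qed.

(** No flow enters an edge between [tf'] and [tf], so the flow equations at these two times have the
    same value. They are sums of nonnegative terms over walks, hence agree for each walk. *)
Lemma early_arrivals p : isW tail head src dst p ->
  {ae mu, forall x, nf (h p) x != 0 -> pathsum T (fun _ y => 1 - (0 <= y <= tf')%R%:R) p.1 x = 0}.
Proof.
move=> hp; have [h1 h2 h3] := hL hp.
have tt : Hset tf tf by rewrite /Hset/= lexx ltW.
have tt' : Hset tf tf' by rewrite /Hset/= tf'0 ltW.
have p0 e t x : 0 <= pathsum T (edge_ind e t) p.1 x by apply: pathsum_ge0 => e' y; rewrite mulr_ge0.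
have eqe e : II mu (fun x => nf (h p) x * pathsum T (edge_ind e tf') p.1 x) =
    II mu (fun x => nf (h p) x * pathsum T (edge_ind e tf) p.1 x).
  apply: EFin_inj; have := @esum_eq_termwise _ _ (Wset tail head src dst)
    (fun p => (II mu (fun x => nf (h p) x * pathsum T (edge_ind e tf') p.1 x))%:E)
    (fun p => (II mu (fun x => nf (h p) x * pathsum T (edge_ind e tf) p.1 x))%:E) (cum (U e) tf).
  apply => //.
  - move=> q hq; rewrite lee_fin; apply: II_ge0 => x.
    have [_ q0 _] := hL hq; rewrite mulr_ge0//; apply: pathsum_ge0 => e' y.
    by rewrite mulr_ge0.
  - move=> q hq; rewrite lee_fin; apply: le_II; [exact: edge_L1|exact: edge_L1|] => x.
    have [_ q0 _] := hL hq; rewrite ler_wpM2l//; apply: pathsum_le => e' y.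
    rewrite ler_wpM2l// ler_nat; case: (leP y tf') => // hy.
    by rewrite (le_trans hy)// ltW.
  - rewrite -cum_early_part//; congr EFin; apply: eq_II => x.
    have [->|/early_part_supp hx] := eqVneq (U e x) 0; first by rewrite !mul0r.
    by have /andP[_ ->] := hx; have /andP[_ ->] := early hx.
  - by rewrite -cum_early_part.
have ae1 : {ae mu, forall x, forall e, e \in enum E ->
    nf (h p) x * (pathsum T (edge_ind e tf) p.1 x - pathsum T (edge_ind e tf') p.1 x) = 0}.
  apply: ae_all_seq => e _; apply: II_eq0_ae.
  - by apply: (L1M h1); apply: bmB; apply: bm_pathsum.
  - move=> x; rewrite mulr_ge0// subr_ge0; apply: pathsum_le => e' y.
    rewrite ler_wpM2l// ler_nat; case: (leP y tf') => // hy.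
    by rewrite (le_trans hy)// ltW.
  - rewrite (eq_II (mu := mu) (g := fun x => nf (h p) x * pathsum T (edge_ind e tf) p.1 x -
       nf (h p) x * pathsum T (edge_ind e tf') p.1 x)); last by move=> x; ring.
    by rewrite IIB ?eqe ?subrr//; exact: edge_L1.
move: ae1; apply: ae_mp => x hx xn.
have eqx e : pathsum T (edge_ind e tf) p.1 x = pathsum T (edge_ind e tf') p.1 x.
  by have /eqP := hx e (mem_enum _ _); rewrite mulf_eq0 (negPf xn) subr_eq0 => /eqP.
have vis k : (k <= size p.1)%N -> Hset tf (pathend T (take k p.1) x).
  by move=> kp; have [] := visited_on_horizon hp (h3 _ xn) kp.
have tot t : pathsum T (fun _ y => (y <= t)%R%:R) p.1 x = \sum_e pathsum T (edge_ind e t) p.1 x.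
  elim: (p.1) x {hx xn eqx vis} => [|e w IH] x /=; first by rewrite big1.
  rewrite IH big_split/=; congr (_ + _); rewrite (bigD1 e)//= /edge_ind eqxx mul1r big1 ?addr0//.
  by move=> e' /negPf en; rewrite eq_sym en mul0r.
rewrite (@eq_pathsum_visited _ _ _ tf _ (fun _ y => (y <= tf)%R%:R + (-1) * (y <= tf')%R%:R)) //; last first.
  by move=> e y /andP[-> ->] _; rewrite mulN1r.
rewrite (pathsumD T (fun _ y => (y <= tf)%R%:R) (fun _ y => -1 * (y <= tf')%R%:R)).
rewrite (pathsumZ T (-1) (fun _ y => (y <= tf')%R%:R)) !tot.
by rewrite (eq_bigr _ (fun e _ => eqx e)) mulN1r subrr.
Qed.

(** Flow on [p] enters all its edges during [[0, tf']] and spends at least [tau] on each, which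
    bounds the number of edges. *)
Lemma long_walks_unused p : isW tail head src dst p -> p \notin pairs ->
  {ae mu, forall x, nf (h p) x = 0}.
Proof.
move=> hp np; move: (early_arrivals hp); apply: ae_mp => x hx.
apply/eqP; apply: contraNT np => xn; have h0 := hx xn.
have al : alive T (fun _ y => (0 <= y <= tf')%R%:R) p.1 x != 0.
  have := one_sub_pathprod T (q := fun _ y => (((0 <= y <= tf')%R%:R : R) != 0)%:R) p.1 x _.
  rewrite -/(alive T (fun _ y => (0 <= y <= tf')%R%:R) p.1 x) => hh; apply/eqP => al0.
  move: hh; rewrite al0 subr0.
  rewrite (_ : (fun _ _ => 1 - _) = (fun (_ : E) (y : R) => 1 - (0 <= y <= tf')%R%:R)); last first.
    by apply/funext => e; apply/funext => y; case: (0 <= y <= tf'); rewrite ?oner_neq0 ?eqxx.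
  rewrite h0 ler10; move=> hh; have := hh _ => /=; move/(_ _)/negP; apply => //.
  by move=> _ y; rewrite ler0n lern1 leq_b1.
have sz : (size p.1 <= N.+1)%N.
  have [->//|wn] := eqVneq p.1 [::].
  have [] := alive_size (T := T) (u := fun _ y => (0 <= y <= tf')%R%:R) (tau := tau) (T0 := tf') (w := p.1) (t := x) (ltW tau0).
  - by move=> _ y; case: (0 <= y <= tf') => //; rewrite eqxx.
  - move=> e y hy; apply: (exit_time_tau e (UL e)).
    by move: hy; case: (0 <= y <= tf') => //; rewrite eqxx.
  - exact: wn.
  - exact: al.
  move=> x0 hsz.
  have : (size p.1).-1%:R * tau < N%:R * tau by apply: le_lt_trans hN; move: hsz; lra.
  by rewrite ltr_pM2r// ltr_nat; case: (size p.1) => // n /ltnW.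
case: p hp sz {hx xn h0 al} => w i; rewrite isW_single => hp sz.
by rewrite mem_pairs mem_walks hp.
Qed.

Lemma mass_density p : gd (nf (h p)).
Proof.
have [hp|hp] := boolP (isW tail head src dst p); first exact: hL.
have [_ [-> // _]] := hLam.
rewrite (_ : nf _ = fun=> 0); first exact: density_on0.
by apply/funext => x; rewrite /on_horizon if_same.
Qed.

Definition finite_flow : seq ((R -> R) * seq E) := [seq (nf (h p), p.1) | p <- pairs].

Lemma finite_flow_ok : load_ok finite_flow.
Proof.
rewrite /finite_flow; elim: pairs => [|p ps IH]; constructor => //.
by have [h1 h2 _] := mass_density p.
Qed.

Lemma isW_pairs p : p \in pairs -> isW tail head src dst p.
Proof. by case: p => w i; rewrite mem_pairs; exact: isW_ws. Qed.

Lemma finite_flow_walks w : w \in map snd finite_flow -> is_walk_from tail head s d w.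
Proof.
rewrite -map_comp => /mapP[[w' i] /isW_pairs + ->] /=.
by rewrite isW_single.
Qed.

Lemma load_visited b1 b2 : (forall e y, Hset tf y -> Hset tf (T e y) -> b1 e y = b2 e y) ->
  load T finite_flow b1 = load T finite_flow b2.
Proof.
move=> hb; rewrite /load /finite_flow !big_map; apply: eq_big_seq => p hp /=.
apply: eq_II => x; have [->|xn] := eqVneq (nf (h p) x) 0; first by rewrite !mul0r.
have [_ _ h3] := mass_density p; congr (_ * _); apply: (@eq_pathsum_visited _ _ _ tf) => // k kp.
by have [] := visited_on_horizon (isW_pairs hp) (h3 _ xn) kp.
Qed.

Lemma load_cum e t : Hset tf t -> load T finite_flow (edge_ind e t) = cum (U e) t.
Proof.
move=> ht; apply: EFin_inj; rewrite cum_early_part//.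
rewrite (esum_finite (L := pairs)).
- by rewrite sumEFin /load /finite_flow big_map.
- exact: uniq_pairs.
- exact: isW_pairs.
- move=> p hp; rewrite lee_fin; apply: II_ge0 => x; have [_ h2 _] := mass_density p.
  by rewrite mulr_ge0//; apply: pathsum_ge0 => e' y; rewrite mulr_ge0.
- move=> p hp np; congr EFin; rewrite -[RHS](II0 mu); apply: ae_eq_II.
  + exact: edge_L1.
  + exact: L1_cst0.
  + by move: (long_walks_unused hp np); apply: ae_mp => x ->; rewrite mul0r.
Qed.

(** The flow equation is the case of half-lines on one edge, and [push_ext] extends it to bounded
    test functions. *)
Lemma finite_load b : (forall e, bm (b e)) ->
  load T finite_flow b = \sum_e II mu (fun x => U e x * b e x).
Proof.
move=> hb; rewrite (load_edges mT finite_flow_ok hb); apply: eq_bigr => e _.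
have tt : Hset tf tf by rewrite /Hset/= lexx ltW.
have gU := early_part_density e; have [L0 u0 us] := gU.
have E1 (b' : R -> R) : atoms_int mu [:: (U e, id : R -> R)] b' = II mu (fun x => U e x * b' x).
  by rewrite /atoms_int big_seq1.
have b1 : bm (fun _ : R => 1 : R) by exact: bm_cst.
have totE : load T finite_flow (fun e' _ => (e' == e)%:R * 1) = II mu (U e).
  rewrite -(cum_ge_tf gU (lexx _)) -(load_cum e tt); apply: load_visited => e' y /andP[_ hy] _.
  by rewrite /edge_ind hy.
rewrite -(atoms_int_load_atoms mT e finite_flow_ok (hb e)) -E1; apply: push_ext => //.
- exact: (load_atoms_ok mT e finite_flow_ok).
- by constructor; [exact: atom_id|constructor].
- rewrite (atoms_int_load_atoms mT e finite_flow_ok b1) totE E1.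
  by apply: eq_II => x; rewrite mulr1.
move=> t; rewrite (atoms_int_load_atoms mT e finite_flow_ok (bm_le_id t)) E1 -/(cum (U e) t) -/(edge_ind e t).
have [t0|t0] := ltP t 0.
  rewrite (cum_lt0 gU t0) (@load_visited _ (fun _ _ => 0)).
    rewrite /load big1// => p _; rewrite -[RHS](II0 mu); apply: eq_II => x.
    by rewrite pathsum_cst mulr0 mulr0.
  by move=> e' y /andP[y0 _] _; rewrite /edge_ind leNgt (lt_le_trans t0 y0) mulr0.
have [t1|/ltW t1] := leP t tf; first by apply: load_cum; rewrite /Hset/= t0.
rewrite (cum_ge_tf gU t1) -totE; apply: load_visited => e' y /andP[_ hy] _.
by rewrite /edge_ind (le_trans hy t1).
Qed.

Lemma finite_rates i : {ae mu, forall t, \sum_(w <- ws) nf (h (w, i)) t = nf (r i) t}.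
Proof.
have [_ [_ [_ [hr _]]]] := hLam.
have ae0 : {ae mu, forall t, forall n, oapp (fun p => isW tail head src dst p -> p \notin pairs ->
    nf (h p) t = 0) True (unpickle n)}.
  apply: ae_foralln => n; case: (unpickle n) => [p|] /=; last exact: aeW.
  have [hp|hp] := boolP (isW tail head src dst p); last by apply: aeW.
  have [np|np] := boolP (p \in pairs); first by apply: aeW.
  by move: (long_walks_unused hp np); apply: ae_mp => t ->.
move: (ae_and ae0 (hr i)); apply: ae_mp => t [h0 hi].
have [ht|ht] := boolP (0 <= t <= tf); last first.
  by rewrite /on_horizon (negPf ht) big1.
rewrite on_horizonE//; apply: EFin_inj; rewrite -hi// -sumEFin.
rewrite (@esum_finite _ _ _ [seq (w, i) | w <- ws]).
- by rewrite big_map; apply: eq_bigr => w _; rewrite on_horizonE.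
- by rewrite map_inj_uniq ?uniq_walks// => ? ? [].
- by move=> _ /mapP[w hw ->]; split => //; exact: (isW_ws i hw).
- move=> p _; rewrite lee_fin -(on_horizonE (h p) ht); by have [_ h2 _] := mass_density p.
- move=> [w i'] [hw /= ei] hn; move: (h0 (pickle (w, i'))); rewrite pickleK /= => h1.
  rewrite -(on_horizonE (h (w, i')) ht) h1// mem_pairs; apply: contra hn => hw'.
  by apply/mapP; exists w => //; rewrite ei.
Qed.

Lemma finite_total_rate : {ae mu, forall t, \sum_(p <- finite_flow) p.1 t = \sum_i nf (r i) t}.
Proof.
have : {ae mu, forall t, forall i, i \in enum I -> \sum_(w <- ws) nf (h (w, i)) t = nf (r i) t}.
  by apply: ae_all_seq => i _; exact: finite_rates.
apply: ae_mp => t ht; rewrite /finite_flow big_map big_allpairs_dep exchange_big.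
rewrite big_enum; apply: eq_bigr => i _; apply: ht; exact: mem_enum.
Qed.

End FiniteSupport.

Lemma total_costE (f z : E -> R -> R) : (forall e, Lplus tf (f e)) -> (forall e, gd (z e)) ->
  (forall e, aeeq tf (f e) (z e)) ->
  total_cost tf D f = (\sum_e II mu (fun t => z e t * (TT e (z e) t - t)))%:E.
Proof.
move=> fL gz fz; rewrite -sumEFin; apply: eq_bigr => e _.
have Tz : TT e (f e) = TT e (z e).
  by apply: (exit_time_aeeq) => //; exact: gdL.
have bT : bm (fun t => TT e (f e) t - t) by exact: (exit_time_bm e (fL e)).
have [L1f _ _] := Lplus_density (fL e); have [L1z _ sz] := gz e.
have Lf := L1M L1f bT; have Lz := L1M L1z bT.
transitivity ((II mu (fun t => nf (f e) t * (TT e (f e) t - t)))%:E).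
  rewrite -II_EFin//; apply: integral_supp => x hx.
    by rewrite on_horizonE// exit_timeE//; ring.
  by rewrite /on_horizon; case: ifP => // _; rewrite mul0r.
rewrite -Tz; congr EFin; apply: ae_eq_II => //.
move: (aeeq_horizon (fz e)); apply: ae_mp => t ->.
by rewrite on_horizon_id.
Qed.

(** * System optimal flows *)

Section Optimal.
Variable h : seq E * I -> R -> R.
Hypothesis hLam : LamD h.
Hypothesis opt : forall h', LamD h' -> (total_cost tf D (l h) <= total_cost tf D (l h'))%E.

Let glL e : Lplus tf (l h e). Proof. by have [/(_ _ hLam)[]] := Hl. Qed.
Let gls e : supported_on tf' tf (l h e). Proof. by have [/(_ _ hLam)[_ []]] := Hl. Qed.
Let glf : flow_eq tail head src dst tf (Dstd D) h (l h).
Proof. by have [/(_ _ hLam)[_ []]] := Hl. Qed.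

Local Notation U := (early_part (l h)).
Local Notation T := (fun e => TT e (U e)).
Local Notation hs := (finite_flow h).

Let gU e : gd (U e). Proof. exact: (early_part_density glL). Qed.
Let mT e : measurable_fun setT (T e).
Proof. exact: (exit_time_meas e (gdL (gU e))). Qed.
Let geT e t : t <= T e t. Proof. exact: (exit_time_ge e t (gdL (gU e))). Qed.
Let bT e : bm (fun t => T e t - t). Proof. exact: (exit_time_bm e (gdL (gU e))). Qed.
Let Ult e t : U e t != 0 -> t <= tf'. Proof. by move=> /early_part_supp/andP[]. Qed.
Let hload b : (forall e, bm (b e)) -> load T hs b = \sum_e II mu (fun x => U e x * b e x).
Proof. exact: (finite_load hLam glL gls glf (A3 hLam)). Qed.

Let rho t := \sum_i nf (r i) t.
Let grho : gd rho.
Proof.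
split; first by apply: L1_sum => i _; have [] := Lplus_density (Hr i).
  by move=> t; apply: sumr_ge0 => i _; have [_ h0 _] := Lplus_density (Hr i).
move=> t; apply: contraNT => ht; rewrite /rho big1// => i _.
by rewrite /on_horizon (negPf ht).
Qed.

Let hs_rate : {ae mu, forall t, \sum_(p <- hs) p.1 t = rho t}.
Proof. exact: (finite_total_rate hLam glL gls glf (A3 hLam)). Qed.

Let hs_ok : load_ok hs. Proof. exact: (finite_flow_ok hLam). Qed.

Let rho_L1 : L1 mu rho. Proof. by have [] := grho. Qed.

Lemma optimal_conservation (beta : V -> R -> R) : (forall v, bm (beta v)) -> (forall t, beta d t = 0) ->
  \sum_e II mu (fun t => U e t * beta (tail e) t) =
  II mu (fun t => rho t * beta s t) + \sum_e II mu (fun t => U e t * beta (head e) (T e t)).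
Proof.
apply: (load_conservation mT hs_ok) => //; first exact: (finite_flow_walks).
Qed.

(** Assumption (3) keeps every walk inside the horizon, exit times included, so the load of late
    exits is 0. *)
Let exit_U e : {ae mu, forall t, U e t * (1 - (T e t <= tf)%R%:R) = 0}.
Proof.
have [L0 u0 _] := gU e.
have bE e' : bm (fun t : R => (1 - (T e' t <= tf)%R%:R : R)).
  by apply: bmB; [exact: bm_cst|exact: (bm_le _ (mT e'))].
have le1 e' t : 0 <= 1 - (T e' t <= tf)%R%:R :> R by rewrite subr_ge0 lern1 leq_b1.
apply: II_eq0_ae; [exact: (L1M L0 (bE e))|by move=> t; rewrite mulr_ge0|].
have tot : \sum_e' II mu (fun t => U e' t * (1 - (T e' t <= tf)%R%:R)) = 0.
  rewrite -(hload bE) (load_visited hLam glL gls (A3 hLam) (b2 := fun _ _ => 0)).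
    rewrite /load big1// => p _; rewrite -[RHS](II0 mu); apply: eq_II => x.
    by rewrite pathsum_cst mulr0 mulr0.
  by move=> e' y _ /andP[_ ->]; rewrite subrr.
have ge0 e' : 0 <= II mu (fun t => U e' t * (1 - (T e' t <= tf)%R%:R)).
  by apply: II_ge0 => t; have [_ u0' _] := gU e'; rewrite mulr_ge0.
apply/eqP; rewrite eq_le ge0 andbT -tot (bigD1 e)//= lerDl; exact: sumr_ge0.
Qed.

Definition cut_flow_atoms := [seq (p.1, first_visit head d s p.2) | p <- hs].

Let cut_ok : load_ok cut_flow_atoms.
Proof.
rewrite /cut_flow_atoms; elim: hs hs_ok => [|p ps IH] ok /=; first by constructor.
by have [h1 h2 h3] := load_ok_cons ok; constructor => //; exact: IH.
Qed.

Let cut_walks w : w \in map snd cut_flow_atoms -> is_walk_from tail head s d w.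
Proof.
rewrite -map_comp => /mapP[p hp ->] /=; apply: first_visit_walk.
by apply: (finite_flow_walks (h := h)); exact: map_f.
Qed.

(** Cutting walks only removes visits, so the cut load has a density relative to [U]. No cut walk
    uses an edge leaving [d], hence that density can be set to 0 there. *)
Let cut_flow : exists uu : E -> R -> R, [/\ forall e, measurable_fun setT (uu e),
  forall e t, 0 <= uu e t <= U e t, forall e t, tail e = d -> uu e t = 0 &
  forall b, (forall e, bm (b e)) -> load T cut_flow_atoms b = \sum_e II mu (fun t => uu e t * b e t)].
Proof.
have [|||f [mf f01 hf]] := @load_density_lebesgue _ _ T mT U cut_flow_atoms cut_ok.
- by move=> e; have [] := gU e.
- by move=> e; have [_ u0 _] := gU e.
- move=> e A mA.
  have bA e' : bm (fun x : R => (e' == e)%:R * \1_A x : R) by apply: bmM; [exact: bm_cst|exact: bm_indic].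
  apply: (@le_trans _ _ (load T hs (fun e' x => (e' == e)%:R * \1_A x))); last first.
    rewrite (hload bA) (bigD1 e)//= big1 ?addr0 => [|e' /negPf en].
      by rewrite le_eqVlt; apply/orP; left; apply/eqP; apply: eq_II => x; rewrite eqxx mul1r.
    by rewrite -[RHS](II0 mu); apply: eq_II => x; rewrite en mul0r mulr0.
  rewrite /cut_flow_atoms; elim: hs hs_ok => [|p ps IH] ok /=; first by rewrite /load !big_nil.
  have [h1 h2 h3] := load_ok_cons ok; rewrite !load_cons; apply: lerD; last exact: IH.
  apply: le_II; [exact: L1_pathsum|exact: L1_pathsum|] => t.
  rewrite ler_wpM2l//=; apply: first_visit_le => e' x.
  by rewrite mulr_ge0// indicE.
exists (fun e t => U e t * f e t * (tail e != d)%:R); split.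
- move=> e; apply: measurable_funM => //; apply: measurable_funM => //.
  by have [h1 _ _] := gU e; exact: (L1_meas h1).
- move=> e t; have [_ /(_ t) u0 _] := gU e; have /andP[f0 f1] := f01 e t.
  rewrite -mulrA mulr_ge0 ?mulr_ge0//= ler_piMr// mulr_ile1//; by case: (_ != _).
- by move=> e t ->; rewrite eqxx mulr0.
move=> b hb.
have bb e : bm (fun t => (tail e != d)%:R * b e t) by apply: bmM => //; exact: bm_cst.
transitivity (load T cut_flow_atoms (fun e t => (tail e != d)%:R * b e t)).
  rewrite /load /cut_flow_atoms [LHS]big_map [RHS]big_map; apply: eq_big_seq => p hp /=; apply: eq_II => t.
  rewrite -first_visit_tail//.
  by apply: (finite_flow_walks (h := h)); exact: map_f.
rewrite (hf _ bb); apply: eq_bigr => e _; apply: eq_II => t; ring.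
Qed.

Lemma no_exit e : tail e = d -> {ae mu, forall t, U e t = 0}.
Proof.
move=> ed; have [uu [muu uuU uud uuload]] := cut_flow.
have uu0 e' t : 0 <= uu e' t by have /andP[] := uuU e' t.
have uule e' t : uu e' t <= U e' t by have /andP[] := uuU e' t.
have UL1 e' : L1 mu (U e') by have [] := gU e'.
have uuL e' : L1 mu (uu e').
  apply: (@L1_dom _ _ _ mu _ (U e')); [exact: muu|exact: UL1|] => t.
  by rewrite ger0_norm.
have uun e' t : uu e' t != 0 -> U e' t != 0.
  by apply: contraNneq => U0; rewrite eq_le uu0 andbT -U0.
have guu e' : gd (uu e').
  split => // t /uun; by have [_ _ h3] := gU e'; exact: h3.
have rate : {ae mu, forall t, \sum_(p <- cut_flow_atoms) p.1 t = rho t}.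
  by move: hs_rate; apply: ae_mp => t <-; rewrite /cut_flow_atoms big_map.
have exitS e' : II mu (fun t => uu e' t * (T e' t <= tf)%R%:R) = II mu (uu e').
  apply: ae_eq_II => //; first by apply: (L1M (uuL e')); exact: (bm_le _ (mT e')).
  move: (exit_U e'); apply: ae_mp => t /eqP; rewrite mulf_eq0 => /orP[/eqP U0|].
    have -> : uu e' t = 0 by apply/eqP; apply: contraTT isT => /uun; rewrite U0 eqxx.
    by rewrite mul0r.
  by rewrite subr_eq0 => /eqP <-; rewrite mulr1.
have [g [gg gs gd0 WCg costg]] := improved_flow tf'0 tf'f tau0
  (fun e f hf => exit_time_meas e (gdL hf))
  (fun e f t hf => exit_time_ge e t (gdL hf))
  (fun e f t hf ht => exit_time_tau e (gdL hf) ht)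
  (fun e f x y hf hx xy hy => exit_time_mono e (gdL hf) hx xy hy)
  (fun e f hf => exit_time_bm e (gdL hf))
  (exit_time_out) (exit_time_cum)
  (exit_time_le) (exit_time_ext)
  guu (fun e t hu => Ult (uun e t hu)) uud grho mT geT bT
  (fun e t ht => exit_time_le e (gU e) (guu e) (uule e) ht) exitS
  (load_conservation mT cut_ok cut_walks rho_L1 rate uuload).
have gs' e' t : g e' t != 0 -> 0 <= t <= tf'.
  by move=> hg; have [_ _ /(_ t hg)/andP[-> _]] := gg e'; rewrite (gs e').
(* The improved flow satisfies conservation for its own travel times, so it decomposes into walks
   and is a competitor for the optimum. *)
have [xi fxi] := @feasible_nonempty R V E I tail head s d (fun e => TT e (g e)) tau tf' g
  (fun i => nf (r i)) N hN tau0
  (fun e => exit_time_meas e (gdL (gg e)))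
  (fun e => let: And3 h1 _ _ := gg e in h1) (fun e => let: And3 _ h1 _ := gg e in h1)
  gs' (fun e t ht => exit_time_tau e (gdL (gg e)) (gs' e t ht)) (fun e t => gd0 e t)
  (fun i => let: And3 h1 _ _ := Lplus_density (Hr i) in h1)
  (fun i => let: And3 _ h1 _ := Lplus_density (Hr i) in h1) WCg.
have [lamB lB] := realize gg gs fxi.
have := opt lamB; rewrite (total_costE glL gU (early_part_aeeq gls)).
have [lBL _] := Hl.1 _ lamB.
rewrite (total_costE lBL gg lB) lee_fin => /le_trans/(_ costg) le1.
have LT e' : L1 mu (fun t => U e' t * (T e' t - t)) by exact: (L1M (UL1 e') (bT e')).
have Luu e' : L1 mu (fun t => uu e' t * (T e' t - t)) by exact: (L1M (uuL e') (bT e')).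
(* Edge by edge [uu] costs at most as much as [U], while in total [U] costs no more; so the costs
   agree on every edge. On an edge leaving [d] this cost is 0, and a travel time of at least [tau]
   leaves no flow there. *)
have d0 e' : 0 <= II mu (fun t => U e' t * (T e' t - t)) - II mu (fun t => uu e' t * (T e' t - t)).
  by rewrite subr_ge0; apply: le_II => // t; rewrite ler_wpM2r// subr_ge0.
have z0 : II mu (fun t => U e t * (T e t - t)) = 0.
  have uz : II mu (fun t => uu e t * (T e t - t)) = 0.
    by rewrite -[RHS](II0 mu); apply: eq_II => t; rewrite uud// mul0r.
  apply/eqP; rewrite eq_le; apply/andP; split; last first.
    by rewrite -[leLHS]uz -subr_ge0.
  have : \sum_e' (II mu (fun t => U e' t * (T e' t - t)) - II mu (fun t => uu e' t * (T e' t - t))) <= 0.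
    by rewrite sumrB subr_le0.
  by apply: le_trans; rewrite (bigD1 e)//= uz subr0 lerDl sumr_ge0.
have [_ u0 _] := gU e.
have : {ae mu, forall t, U e t * (T e t - t) = 0}.
  by apply: II_eq0_ae => // t; rewrite mulr_ge0// subr_ge0.
apply: ae_mp => t /eqP; rewrite mulf_eq0 => /orP[/eqP//|].
have [//|/early_part_supp ht] := eqVneq (U e t) 0.
have := exit_time_tau e (gdL (gU e)) ht => hh.
by rewrite subr_eq0 => /eqP h1; move: hh; rewrite h1 => hh; exfalso; move: tau0 hh; lra.
Qed.

Lemma optimal_implementable gso : (forall e, Lplus tf (gso e)) ->
  (forall e, aeeq tf (l h e) (gso e)) ->
  implementable tail head src dst tf' tf r gamma D l gso.
Proof.
move=> gsoL lgso.
(* By [no_exit] this changes [U] only on a null set, and it makes the flow vanish identically on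
   edges leaving [d], as the linear program assumes. *)
pose u e := if tail e == d then fun=> 0 else U e.
have gu e : gd (u e) by rewrite /u; case: ifP => // _; exact: density_on0.
have aeu e : {ae mu, forall t, U e t = u e t}.
  by rewrite /u; case: eqP => [/no_exit//|_]; exact: aeW.
have usupp e t : u e t != 0 -> 0 <= t <= tf'.
  by rewrite /u; case: ifP => _; [rewrite eqxx|exact: early_part_supp].
have uL1 e : L1 mu (u e) by have [] := gu e.
have u0 e t : 0 <= u e t by have [_ h0 _] := gu e.
have ud e t : tail e = d -> u e t = 0 by rewrite /u => ->; rewrite eqxx.
have TU e : TT e (u e) = T e.
  by apply/esym; exact: (exit_time_ext e (gU e) (gu e) (aeu e)).
have IU e b : bm b -> II mu (fun t => U e t * b t) = II mu (fun t => u e t * b t).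
  move=> hb; have [L0 _ _] := gU e; apply: ae_eq_II; [exact: (L1M L0 hb)|exact: (L1M (uL1 e) hb)|].
  by move: (aeu e); apply: ae_mp => t ->.
have WCu (beta : V -> R -> R) : (forall v, bm (beta v)) -> (forall t, beta d t = 0) ->
    \sum_e II mu (fun t => u e t * beta (tail e) t) =
    II mu (fun t => rho t * beta s t) + \sum_e II mu (fun t => u e t * beta (head e) (TT e (u e) t)).
  move=> hb bd; have := optimal_conservation hb bd.
  rewrite (eq_bigr _ (fun e _ => IU e _ (hb (tail e)))) => ->; congr (_ + _).
  apply: eq_bigr => e _; rewrite TU; apply: IU; exact: (bm_comp (hb _) (mT e)).
pose c i e t := gamma i * (TT e (u e) t - t).
have bc i e : bm (c i e) by apply: bmM; [exact: bm_cst|rewrite TU; exact: bT].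
have [C hC] : exists C, forall i e t, 0 <= c i e t <= C.
  have [k hk] := choice (fun p : I * E => (bc p.1 p.2).2).
  exists (\sum_p `|k p|) => i e t; apply/andP; split.
    by rewrite mulr_ge0 ?(ltW (gamma0 i))// subr_ge0 TU.
  apply: le_trans (ler_norm _) (le_trans (hk (i, e) t) _).
  by rewrite (bigD1 (i, e))//= (le_trans (ler_norm _))// lerDl sumr_ge0.
have mTu e : measurable_fun setT (TT e (u e)) by rewrite TU.
have tauu e t : u e t != 0 -> t + tau <= TT e (u e) t.
  by move=> /usupp ht; apply: (exit_time_tau e (gdL (gu e)) ht).
have [p [xi [bp p0 fxi hp]]] := @tolls_exist R V E I tail head s d (fun e => TT e (u e)) tau tf' u
  (fun i => nf (r i)) c C N hN tau0 mTu uL1 u0 usupp tauu ud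
  (fun i => let: And3 h1 _ _ := Lplus_density (Hr i) in h1)
  (fun i => let: And3 _ h1 _ := Lplus_density (Hr i) in h1) bc hC WCu.
have ult e t : u e t != 0 -> t <= tf' by move=> /usupp/andP[].
have [lamB lB] := realize gu ult fxi.
set hB := assignment_flow xi in lamB lB.
have [lBL _] := Hl.1 _ lamB.
exists p; split; first by move=> e; apply: measurable_funTS; have [] := bp e.
split; first by move=> e t _; exact: p0.
exists hB; split; [split; first exact: lamB|split].
- have TE e y : Hset tf y -> TT e (u e) y = Tt (Dstd D) (l hB) e y.
    move=> hy; rewrite /Tt /Dstd -(exit_timeE e (l hB e) hy); congr (_ _); apply/esym.
    exact: (exit_time_aeeq e (lBL e) (gdL (gu e)) (lB e)).
  have costE w i t : isW tail head src dst (w, i) -> Hset tf t ->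
      Psi gamma D (l hB) (w, i) t + tollw p D (l hB) w t =
      pathsum (fun e => TT e (u e)) (fun e x => c i e x + p e x) w t.
    move=> hw ht.
    have visH k : (k <= size w)%N -> Hset tf (Aw (Dstd D) (l hB) w k t).
      by move=> kw; exact: (A3 lamB hw).
    rewrite (tollw_pathsum TE)// pathsumD; congr (_ + _).
    rewrite /Psi /= (Aw_pathend TE)//; last by move=> k kw; apply: visH; exact: ltnW.
    by rewrite take_size pathend_pathsum addrAC subrr add0r pathsumZ.
  move=> [w i] hw; move: hp; apply: ae_mp => t opt_t ht hpos [w' i'] hw' /= ei; subst i'.
  rewrite !costE//; move: hpos; rewrite /hB /assignment_flow /=.
  case: ifP => [wws hpos|_]; last by rewrite ltxx.
  by apply: (opt_t _ _ _ wws hpos); rewrite -(isW_single w' i).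
- move=> e; apply: aeeq_trans (lgso e); apply: aeeq_trans (aeeq_sym (early_part_aeeq gls e)).
  apply: aeeq_trans (lB e) _; move: (aeu e); apply: ae_mp => t -> _; by [].
rewrite (eq_bigr (fun e => (II mu (fun t => nf (gso e) t * p e t))%:E)) ?sumEFin ?ltry// => e _.
have [L0 _ _] := Lplus_density (gsoL e).
rewrite -II_EFin; last exact: (L1M L0 (bp e)).
apply: integral_supp => t ht; first by rewrite on_horizonE// mulrC.
by rewrite /on_horizon; case: ifP => // _; rewrite mul0r.
Qed.

End Optimal.

End Network.

Theorem theorem4p4
  (R : realType)
  (V E : finType) (etail ehead : E -> V)
  (I : finType) (src dst : I -> V)
  (tf' tf : R) (gamma : I -> R) (r : I -> R -> R)
  (D : E -> (R -> R) -> R -> R)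
  (l : (seq E * I -> R -> R) -> E -> R -> R)
  (lu : (E -> R -> R) -> (seq E * I -> R -> R) -> E -> R -> R)
  (* setting *)
  (Htf : 0 <= tf' /\ tf' < tf)
  (Hgamma : forall i, 0 < gamma i)
  (Hr : forall i, Lplus tf (r i) /\ ~ aeeq tf (r i) (fun=> 0))
  (HD0 : forall e f t, Lplus tf f -> Hset tf t -> 0 <= D e f t)
  (HDwd : forall e f f', Lplus tf f -> Lplus tf f' -> aeeq tf f f' ->
            forall t, Hset tf t -> D e f t = D e f' t)
  (Hl : l_spec etail ehead src dst tf' tf r (Dstd D) l)
  (Hlu : forall u : E -> R -> R, (forall e, Lplus tf (u e)) ->
            l_spec etail ehead src dst tf' tf r (Du D u) (lu u))
  (* standing assumption (1) *)
  (A1 : exists2 tmin : R, 0 < tmin &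
     forall e f, Lplus tf f ->
       abs_cont 0 tf (D e f) /\
       nondecr_on (Hset tf) (fun t => t + D e f t) /\
       (forall t : R, 0 <= t <= tf' -> tmin <= D e f t) /\
       exists fm, Lplus tf fm /\
         forall t, Hset tf t -> int_pre tf (fun x => x + D e f x) t f = int0 t fm)
  (* standing assumption (2) *)
  (A2 : exists tmax : R, forall h, Lam etail ehead src dst tf' tf r (Dstd D) h ->
     forall e (t : R), 0 <= t <= tf' -> D e (l h e) t <= tmax)
  (* standing assumption (3) *)
  (A3 : forall h, Lam etail ehead src dst tf' tf r (Dstd D) h ->
     forall w, isW etail ehead src dst w -> forall j, (j <= size w.1)%N ->
     forall t, Hset tf t -> Hset tf (Aw (Dstd D) (l h) w.1 j t))
  (* standing assumption (4) *)
  (A4 : forall u : E -> R -> R, (forall e, Lplus tf (u e)) ->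
     (forall e, supported_on tf' tf (u e)) ->
     forall h, Lam etail ehead src dst tf' tf r (Du D u) h ->
     (forall e, aeeq tf (lu u h e) (u e)) ->
     forall e, aeeq tf (l h e) (u e))
  (* single source, single destination *)
  (s d : V) (Hsd : forall i, src i = s /\ dst i = d)
  (* hypothesis (i) *)
  (Hi : forall e f ft, Lplus tf f -> Lplus tf ft ->
     (forall t, Hset tf t -> (int0 t ft <= int0 t f)%E) ->
     forall t, Hset tf t ->
       (int_pre tf (fun x : R => (x + D e ft x)%R) t ft <=
        int_pre tf (fun x : R => (x + D e f x)%R) t f)%E)
  (* hypothesis (ii) *)
  (Hii : forall e f ft, Lplus tf f -> Lplus tf ft -> aele tf ft f ->
     forall t, Hset tf t -> D e ft t <= D e f t) :
  forall g : E -> R -> R,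
    system_optimal etail ehead src dst tf' tf r D l g ->
    implementable etail ehead src dst tf' tf r gamma D l g.
Proof.
move=> g [gL [[h [hLam lg]] opt]].
have [tf'0 tf'f] := Htf; have [tau tau0 A1'] := A1.
pose N := (Num.truncn (tf' / tau)).+1.
have hN : tf' < N%:R * tau.
  by have /andP[_] := truncn_itv (divr_ge0 tf'0 (ltW tau0)); rewrite ltr_pdivrMr.
have HrL i : Lplus tf (r i) by have [] := Hr i.
have [lhL _] := Hl.1 _ hLam.
have gg e : density_on tf (on_horizon tf (g e)) by exact: Lplus_density.
have gh e : aeeq tf (g e) (on_horizon tf (g e)) by exact: aeeq_on_horizon.
apply: (optimal_implementable tf'0 tf'f tau0 Hgamma HrL HD0 HDwd Hl Hlu A1' A3 A4 hN Hsd Hi Hii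
  hLam _ gL lg) => h' hLam'.
(* Optimality is known for [g]; total cost depends only on almost everywhere classes, so it passes
   to [l h]. *)
rewrite (total_costE tf'0 tf'f HD0 HDwd A1' lhL gg (fun e => aeeq_trans (lg e) (gh e))).
rewrite -(total_costE tf'0 tf'f HD0 HDwd A1' gL gg gh); exact: opt.
Qed.
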